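(* Let $\nu\in\mathcal P(Y)$, and let $c_{\mathrm{ext}},\mu_{\mathrm{ext}},\nu_{\mathrm{ext}},\psi_{\mathrm{ext}},\gamma_{\mathrm{ext}}$ and $P$ be as defined in the context. If $c$ satisfies the extended twist condition (given in the context), then there exists a unique optimal transport map $T_{\mathrm{ext}}$ from $\mu_{\mathrm{ext}}$ to $\nu_{\mathrm{ext}}$ for the cost $c_{\mathrm{ext}}$, and it satisfies $\gamma_{\mathrm{ext}}=(\mathrm{id}_{B\times[0,P]},T_{\mathrm{ext}})_\#\mu_{\mathrm{ext}}$ and $$\nabla_x c_{\mathrm{ext}}(x,T_{\mathrm{ext}}(x))=\nabla\psi_{\mathrm{ext}}^{c_{\mathrm{ext}}}(x)\qquad\text{for all }x\in B\times[0,P].$$ In particular, if $\bar p\in\arg\min_{\mathcal P_{\mathrm{ac}}(B)}F_\nu$ is the unique minimiser of $F_\nu$ over $\mathcal P_{\mathrm{ac}}(B)$, then $T:=T_{\mathrm{ext}}|_{X_{\bar p}}$ is the optimal transport map from $\mu_{\bar p}$ to $\nu$ for the cost $c$.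
   Context: Setting. Let $d\ge 2$, let $B\subset\mathbb R^{d-1}$ be compact with non-empty interior, let $X:=B\times[0,+\infty)$ with points written $x=(s,p)$, and let $Y\subset\mathbb R^d$ be non-empty and compact. The cost $c:X\times Y\to[0,+\infty)$ satisfies: (A) $c$ is locally Lipschitz; (B) for all $s\in B$ and $y\in Y$ the function $c((s,\cdot),y):[0,+\infty)\to[0,+\infty)$ is strictly increasing and unbounded; (C) the set of functions $\{c((\cdot,p),y):B\to[0,+\infty)\mid p\in[0,+\infty),\,y\in Y\}$ is equicontinuous. Extended twist condition: there exist open sets $\Omega_X,\Omega_Y\subset\mathbb R^d$ with $X\subset\Omega_X$, $Y\subset\Omega_Y$ and an extension of $c$ to $\Omega_X\times\Omega_Y$ such that $c\in\mathcal C^1(\Omega_X\times\Omega_Y)$, for all $x_0\in\Omega_X$ the map $\nabla_xc(x_0,\cdot):\Omega_Y\to\mathbb R^d$ is injective, and there is a constant $\ell>0$ such that $\min_{y\in Y}\|\nabla_xc(x_0,y)\|\ge\ell$ for all $x_0\in\Omega_X$. Notation. $\mathcal C(A)$: continuous real functions on $A$; $\mathcal P(A)$: Borel probability measures on $A$; $\mathcal P_{\mathrm{ac}}(B)$: those on $B$ absolutely continuous with respect to $\mathcal L^{d-1}$, identified with their densities. $\mathcal L^d|_A$ is the restriction of Lebesgue measure to $A$; $\delta_y$ is the Dirac mass at $y$; $T_\#\mu$ is the pushforward of $\mu$ by $T$. For $\bar p\in\mathcal P_{\mathrm{ac}}(B)$: $X_{\bar p}:=\{(s,p)\in X:p\le\bar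 p(s)\}$ and $\mu_{\bar p}:=\mathcal L^d|_{X_{\bar p}}$. $\Gamma(\mu,\nu)$ is the set of non-negative measures on the product space with marginals $\mu,\nu$. $F_\nu(\bar p):=\inf_{\gamma\in\Gamma(\mu_{\bar p},\nu)}\int_{X\times Y}c\,\mathrm d\gamma$; it has a unique minimiser over $\mathcal P_{\mathrm{ac}}(B)$. For $\psi\in\mathcal C(Y)$: $\psi^c(x):=\inf_{y\in Y}\{c(x,y)-\psi(y)\}$ and $G_\nu(\psi):=\inf_{\bar p\in\mathcal P_{\mathrm{ac}}(B)}\{\int_X\psi^c\,\mathrm d\mu_{\bar p}+\int_Y\psi\,\mathrm d\nu\}$. An optimal transport map from $\mu$ to $\nu$ for a cost $c$ is a Borel map $T$ with $T_\#\mu=\nu$ minimising $\int c(x,T(x))\,\mathrm d\mu(x)$ among all such maps. Define $q:B\times Y\times\mathbb R\to[0,+\infty)$ by $q(s,y,\sigma):=c((s,\cdot),y)^{-1}(\sigma)$ if $\sigma\ge c((s,0),y)$, and $0$ otherwise. For each $\psi\in\mathcal C(Y)$, $\tau_\psi\in\mathbb R$ is the unique constant such that $\bar p_\psi(s):=\max_{y\in Y}q(s,y,\psi(y)+\tau_\psi)$ is a probability density on $B$. The set $\mathcal S=\{\bar p_\psi\mid\psi\in\mathcal C(Y)\}$ is uniformly bounded; $P>0$ is a uniform upper bound on $\mathcal S$. Extended objects. $y_{\mathrm{ext}}\in\mathbb R^d\setminus Y$; $Y_{\mathrm{ext}}:=Y\cup\{y_{\mathrm{ext}}\}$; $c_{\mathrm{ext}}:X\times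 Y_{\mathrm{ext}}\to[0,+\infty)$ equals $c$ for $y\in Y$ and $c_{\mathrm{ext}}(x,y_{\mathrm{ext}}):=0$; $\mu_{\mathrm{ext}}:=\mathcal L^d|_{B\times[0,P]}$; $\nu_{\mathrm{ext}}:=\nu+(P-1)\delta_{y_{\mathrm{ext}}}$. With $\bar p$ the minimiser of $F_\nu$, $\psi$ a maximiser of $G_\nu$ over $\mathcal C(Y)$, and $\gamma$ an optimal transport plan from $\mu_{\bar p}$ to $\nu$ (a minimiser of $\int c\,\mathrm d\tilde\gamma$ over $\tilde\gamma\in\Gamma(\mu_{\bar p},\nu)$): $\gamma_{\mathrm{ext}}:=\gamma+(\mathcal L^d|_{\{(s,p):s\in B,\ \bar p(s)\le p\le P\}})\otimes\delta_{y_{\mathrm{ext}}}$, and $\psi_{\mathrm{ext}}:=\psi$ on $Y$, $\psi_{\mathrm{ext}}(y_{\mathrm{ext}}):=-\tau_\psi$. Finally $\psi_{\mathrm{ext}}^{c_{\mathrm{ext}}}(x):=\min_{y\in Y_{\mathrm{ext}}}\{c_{\mathrm{ext}}(x,y)-\psi_{\mathrm{ext}}(y)\}$.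
   Formalization: In ν_ext the factor P−1 is replaced by P·L^{d-1}(B)−1 (the same if B has measure 1; otherwise the masses differ and no map exists); the gradient identity is stated at every x where ψ_ext^{c_ext} is differentiable, which is almost every x, instead of at all x. The map is unique a.e. *)

(* Defs.v *)
From HB Require Import structures.
From mathcomp Require Import all_boot all_order all_algebra.
From mathcomp Require Import all_classical all_reals all_analysis.
From mathcomp Require Import measurable_realfun.

Set Implicit Arguments.
Unset Strict Implicit.
Unset Printing Implicit Defensive.
Import Order.TTheory GRing.Theory Num.Theory.
Import numFieldNormedType.Exports.

Local Open Scope classical_set_scope.
Local Open Scope ring_scope.

Section borel_matrix.
Variables (R : realType) (m n : nat).
Local Notation opens := (@open 'M[R]_(m, n)).

HB.instance Definition _ := @isMeasurable.Build (sigma_display opens) 'M[R]_(m, n)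
  <<s opens >> (@sigma_algebra0 _ setT opens) (@sigma_algebraC _ opens)
  (@sigma_algebra_bigcup _ setT opens).

End borel_matrix.

Lemma borel_matrixE (R : realType) m n :
  @measurable _ 'M[R]_(m, n) = <<s open >>.
Proof. by []. Qed.

Lemma open_measurable_mx (R : realType) m n (A : set 'M[R]_(m, n)) :
  open A -> measurable A.
Proof. exact: sub_sigma_algebra. Qed.

Lemma measurable_coord (R : realType) m n i j :
  measurable_fun [set: 'M[R]_(m, n)] (fun x => x i j).
Proof.
apply: (measurability _ (@RGenOpens.measurableE R)).
move=> _ [_ [a [b ->] <-]]; rewrite setTI; apply: open_measurable_mx.
by apply: open_comp (@interval_open _ _ _ _ _) => // x _; exact: coord_continuous.
Qed.

Lemma measurable_fun_rVP d (T : measurableType d) (R : realType) n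
    (f : T -> 'rV[R]_n) :
  (forall i, measurable_fun setT (fun t => f t 0 i)) <-> measurable_fun setT f.
Proof.
split=> [mf|mf i]; last first.
  exact: (measurableT_comp (measurable_coord 0 i)).
apply: (measurability _ (borel_matrixE R 1 n)).
move=> _ [V oV <-]; rewrite setTI.
pose C (z : 'rV[rat]_n * nat) : 'rV[R]_n := map_mx ratr z.1.
pose U z := ball (C z) (z.2.+1%:R^-1).
pose G z := if `[< U z `<=` V >] then f @^-1` U z else set0.
rewrite (_ : f @^-1` V = \bigcup_z G z); last first.
  apply/seteqP; split=> [t Vft|t [z _]]; last first.
    by rewrite /G; case: asboolP => // zV /zV.
  have /nbhs_ballP[e /= e0 eV] := open_nbhs_nbhs (conj oV Vft).
  have [k ke] : exists k : nat, k.+1%:R^-1 < e / 2.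
    have e20 : 0 < e / 2 by rewrite divr_gt0.
    have [k _ /(_ k (leqnn k)) /= ke] := near_infty_natSinv_lt (PosNum e20).
    by exists k.
  have k0 : 0 < k.+1%:R^-1 :> R by rewrite invr_gt0.
  have /choice[q hq] : forall i, exists q : rat, ball (f t 0 i) k.+1%:R^-1 (ratr q : R).
    move=> i; have lt_itv : f t 0 i - k.+1%:R^-1 < f t 0 i + k.+1%:R^-1.
      by rewrite ltrD2l gtrN.
    have [q] := rat_in_itvoo lt_itv; rewrite in_itv /= => /andP[q1 q2].
    by exists q; rewrite /ball /= ltr_distlC q1 q2.
  exists (\row_i q i, k) => //; rewrite /G.
  have ftU : U (\row_i q i, k) (f t).
    split => // i j; rewrite !mxE (ord1 i); exact/ball_sym/hq.
  case: asboolP => //= nU; exfalso; apply: nU => y Uy; apply: eV.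
  rewrite (splitr e); apply: (@ball_triangle _ _ (C (\row_i q i, k))).
    by apply: le_ball (ltW ke) _ _; exact: ball_sym.
  by apply: le_ball (ltW ke) _ _.
apply: countable_bigcupT_measurable; first exact: countableP.
move=> z; rewrite /G; case: asboolP => // _.
rewrite (_ : _ @^-1` _ = \bigcap_(i in [set: 'I_n])
    ((fun t => f t 0 i) @^-1` ball (C z 0 i) (z.2.+1%:R^-1))); last first.
  apply/seteqP; split=> [t [_ h] i _|t h]; first exact: h.
  by split=> [|i j]; [rewrite invr_gt0|rewrite (ord1 i); exact: h].
apply: fin_bigcap_measurable => // i _.
rewrite -[X in measurable X]setTI; apply: mf => //.
exact: measurable_ball.
Qed.

Section cons_rV.
Variables (R : realType) (n : nat).

Definition cons_rV (z : R * 'rV[R]_n) : 'rV[R]_n.+1 :=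
  row_mx z.1%:M z.2 : 'rV[R]_(1 + n).

Lemma cons_rV0 z : cons_rV z 0 0 = z.1.
Proof.
have := @row_mxEl _ _ 1 n z.1%:M z.2 0 0; rewrite [RHS]mxE eqxx mulr1n => <-.
by congr (row_mx _ _ _ _); exact/val_inj.
Qed.

Lemma cons_rVS z i : cons_rV z 0 (lift ord0 i) = z.2 0 i.
Proof.
rewrite -(@row_mxEr _ _ 1 n z.1%:M z.2 0 i).
by congr (row_mx _ _ _ _); exact/val_inj.
Qed.

Lemma measurable_cons_rV : measurable_fun setT cons_rV.
Proof.
apply/measurable_fun_rVP => i; case: (unliftP ord0 i) => [j|] ->.
  under eq_fun do rewrite cons_rVS.
  exact: (measurableT_comp (measurable_coord 0 j) measurable_snd).
under eq_fun do rewrite cons_rV0.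
exact: measurable_fst.
Qed.

Variable mu : {sigma_finite_measure set 'rV[R]_n -> \bar R}.

Definition cons_measure := pushforward (lebesgue_measure \x mu)%E cons_rV.

Let cons_measure0 : cons_measure set0 = 0%E.
Proof. by rewrite /cons_measure /pushforward preimage_set0 measure0. Qed.

Let cons_measure_ge0 A : (0 <= cons_measure A)%E.
Proof. by apply: integral_ge0 => x _; exact: measure_ge0. Qed.

Let cons_measure_sigma_additive : semi_sigma_additive cons_measure.
Proof.
move=> F mF tF mUF; rewrite /cons_measure /pushforward preimage_bigcup.
have mpre A : measurable A -> measurable (cons_rV @^-1` A).
  by move=> mA; rewrite -[X in measurable X]setTI; exact: measurable_cons_rV.
apply: measure_semi_sigma_additive => [k||]; first exact: mpre.
  apply/trivIsetP => i j _ _ ij; rewrite -preimage_setI.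
  by move/trivIsetP : tF => /(_ _ _ _ _ ij) ->//; rewrite preimage_set0.
by rewrite -preimage_bigcup; exact: mpre.
Qed.

HB.instance Definition _ := isMeasure.Build _ _ _ cons_measure
  cons_measure0 cons_measure_ge0 cons_measure_sigma_additive.

Let cons_measure_sigma_finite : sigma_finite setT cons_measure.
Proof.
have /sigma_finiteP[L [TL ndL Loo]] := sigma_finiteT (@lebesgue_measure R).
have /sigma_finiteP[M [TM ndM Moo]] := sigma_finiteT mu.
pose F k := L k `*` M k.
have TF : setT = \bigcup_k F k.
  apply/seteqP; split=> // -[t s] _.
  have [i _ Lit] : (\bigcup_k L k) t by rewrite -TL.
  have [j _ Mjs] : (\bigcup_k M k) s by rewrite -TM.
  exists (maxn i j) => //; split => /=.
    by move: t Lit; exact/subsetPset/ndL/leq_maxl.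
  by move: s Mjs; exact/subsetPset/ndM/leq_maxr.
have Foo k : measurable (F k) /\ ((lebesgue_measure \x mu) (F k) < +oo)%E.
  have [mL Lfin] := Loo k; have [mM Mfin] := Moo k.
  split; first exact: measurableX.
  by rewrite product_measure1E// lte_mul_pinfty// ge0_fin_numE.
pose g (x : 'rV[R]_n.+1) : R * 'rV[R]_n := (x 0 0, \row_i x 0 (lift ord0 i)).
have consK : cancel cons_rV g.
  move=> [t s]; rewrite /g cons_rV0; congr (_, _); apply/rowP => i.
  by rewrite mxE cons_rVS.
have mg : measurable_fun setT g.
  apply: measurable_fun_pair; first exact: measurable_coord.
  apply/measurable_fun_rVP => i; under eq_fun do rewrite mxE.
  exact: measurable_coord.
exists (fun k => g @^-1` F k).
  by rewrite -preimage_bigcup -TF preimage_setT.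
move=> k; have [mFk Fkoo] := Foo k; split.
  by rewrite -[X in measurable X]setTI; exact: mg.
rewrite /cons_measure /pushforward -comp_preimage.
by rewrite (_ : g \o cons_rV = id) //; apply/funext.
Qed.

HB.instance Definition _ := Measure_isSigmaFinite.Build _ _ _ cons_measure
  cons_measure_sigma_finite.

End cons_rV.

Fixpoint lebesgue_rV (R : realType) n :
    {sigma_finite_measure set 'rV[R]_n -> \bar R} :=
  match n with
  | 0 => dirac (0 : 'rV[R]_0)
  | n'.+1 => cons_measure (lebesgue_rV R n')
  end.

Section transport.
Variables (R : realType) (n : nat).
Implicit Types (D Y : set 'rV[R]_n) (c : 'rV[R]_n -> 'rV[R]_n -> R)
  (mu nu : set 'rV[R]_n -> \bar R) (T : 'rV[R]_n -> 'rV[R]_n)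
  (psi : 'rV[R]_n -> R).

Definition lebesgue_on D : set 'rV[R]_n -> \bar R :=
  fun A => lebesgue_rV R n (A `&` D).

Definition couplings mu nu : set {measure set ('rV[R]_n * 'rV[R]_n) -> \bar R} :=
  [set gamma | forall A, measurable A ->
     gamma (A `*` setT) = mu A /\ gamma (setT `*` A) = nu A].

Definition plan_cost D Y c
    (gamma : {measure set ('rV[R]_n * 'rV[R]_n) -> \bar R}) : \bar R :=
  (\int[gamma]_(z in D `*` Y) (c z.1 z.2)%:E)%E.

Definition is_optimal_plan D Y c mu nu gamma :=
  couplings mu nu gamma /\
  forall gamma', couplings mu nu gamma' ->
    (plan_cost D Y c gamma <= plan_cost D Y c gamma')%E.

(* A map from D to Y is a total function of which only the restriction to D
   matters. *)
Definition is_transport_map D mu nu T :=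
  measurable_fun D T /\
  forall A, measurable A -> mu (D `&` T @^-1` A) = nu A.

(* When nu is concentrated on Y, the domain of integration is all of D up to a
   mu-null set; it keeps the values of c outside D * Y out of the definition. *)
Definition map_cost D Y c mu T : \bar R :=
  (\int[mu]_(x in D `&` T @^-1` Y) (c x (T x))%:E)%E.

Definition is_optimal_map D Y c mu nu T :=
  is_transport_map D mu nu T /\
  forall T', is_transport_map D mu nu T' ->
    (map_cost D Y c mu T <= map_cost D Y c mu T')%E.

Definition is_unique_optimal_map D Y c mu nu T :=
  is_optimal_map D Y c mu nu T /\
  forall T', is_optimal_map D Y c mu nu T' ->
    {ae mu, forall x, D x -> T' x = T x}.

Definition ctransform Y c psi : 'rV[R]_n -> R :=
  fun x => inf [set c x y - psi y | y in Y].

Definition grad (f : 'rV[R]_n -> R) (x : 'rV[R]_n) : 'rV[R]_n :=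
  \row_i 'D_(delta_mx 0 i) f x.

(* The library norm on row vectors is the maximum norm. *)
Definition euclidean_norm (v : 'rV[R]_n) : R :=
  Num.sqrt (\sum_i v 0 i ^+ 2).

End transport.

Definition C1_on (R : realType) (V : normedModType R) (U : set V)
    (f : V -> R) :=
  forall z, U z -> differentiable f z /\
    forall v, {for z, continuous (fun z' => 'd f z' v)}.

(* Points of R^d, with d = m + 1, are written x = (s, p) with s in R^m. *)
Section cylinder.
Variables (R : realType) (m : nat).
Local Notation E := 'rV[R]_(m + 1).
Implicit Types (B : set 'rV[R]_m) (Y : set E) (c : E -> E -> R)
  (nu : set E -> \bar R) (pbar : 'rV[R]_m -> R) (psi : E -> R)
  (P tau : R) (yext : E).

Definition cyl_point (s : 'rV[R]_m) (p : R) : E := row_mx s p%:M.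
Definition base (x : E) : 'rV[R]_m := lsubmx x.
Definition height (x : E) : R := rsubmx x 0 0.

Definition cylinder B : set E := [set x | B (base x) /\ 0 <= height x].

Definition slab B P : set E := [set x | B (base x) /\ 0 <= height x <= P].

Record cost_assumptions B Y c : Prop := {
  cost_ge0 : forall x y, cylinder B x -> Y y -> 0 <= c x y ;
  cost_locally_lipschitz : forall z, (cylinder B `*` Y) z ->
    exists2 U, nbhs z U &
      [lipschitz c w.1 w.2 | w in U `&` (cylinder B `*` Y)] ;
  cost_increasing : forall s y, B s -> Y y ->
    forall p p', 0 <= p -> p < p' -> c (cyl_point s p) y < c (cyl_point s p') y ;
  cost_unbounded : forall s y, B s -> Y y ->
    forall M, exists2 p, 0 <= p & M < c (cyl_point s p) y ;
  cost_equicontinuous :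
    equicontinuous [set i : R * E | 0 <= i.1 /\ Y i.2]
      (fun i => (fun s => c (cyl_point s i.1) i.2) : subspace B -> R)
}.

(* cE is an extension of c witnessing the extended twist condition. *)
Record extended_twist B Y c (OmX OmY : set E) (cE : E -> E -> R) : Prop := {
  twist_openX : open OmX ;
  twist_openY : open OmY ;
  twist_subX : cylinder B `<=` OmX ;
  twist_subY : Y `<=` OmY ;
  twist_extends : forall x y, cylinder B x -> Y y -> cE x y = c x y ;
  twist_C1 : C1_on (OmX `*` OmY) (fun z : E * E => cE z.1 z.2) ;
  twist_injective : forall x, OmX x -> forall y y', OmY y -> OmY y' ->
    grad (cE ^~ y) x = grad (cE ^~ y') x -> y = y' ;
  twist_grad_ge : exists2 l, 0 < l & forall x y, OmX x -> Y y ->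
    l <= euclidean_norm (grad (cE ^~ y) x)
}.

Definition is_density B pbar :=
  [/\ measurable_fun B pbar, (forall s, B s -> 0 <= pbar s) &
      (\int[lebesgue_rV R m]_(s in B) (pbar s)%:E = 1)%E].

Definition subgraph B pbar : set E :=
  [set x | B (base x) /\ 0 <= height x <= pbar (base x)].

Definition mu_of B pbar := lebesgue_on (subgraph B pbar).

Definition Ffun B Y c nu pbar : \bar R :=
  ereal_inf [set plan_cost (cylinder B) Y c gamma |
    gamma in couplings (mu_of B pbar) nu].

Definition is_minimiser_F B Y c nu pbar :=
  is_density B pbar /\
  forall p, is_density B p -> (Ffun B Y c nu pbar <= Ffun B Y c nu p)%E.

Definition Gfun B Y c nu psi : \bar R :=
  ereal_inf [set (\int[mu_of B p]_(x in cylinder B) (ctransform Y c psi x)%:E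
                  + \int[nu]_(y in Y) (psi y)%:E)%E | p in is_density B].

Definition is_maximiser_G B Y c nu psi :=
  {within Y, continuous psi} /\
  forall phi, {within Y, continuous phi} ->
    (Gfun B Y c nu phi <= Gfun B Y c nu psi)%E.

Definition qfun c (s : 'rV[R]_m) (y : E) (sigma : R) : R :=
  if c (cyl_point s 0) y <= sigma
  then get [set p | 0 <= p /\ c (cyl_point s p) y = sigma] else 0.

(* For compact Y and continuous psi this supremum is a maximum. *)
Definition level_profile Y c psi tau : 'rV[R]_m -> R :=
  fun s => sup [set qfun c s y (psi y + tau) | y in Y].

Definition tau_of B Y c psi : R :=
  get [set tau | is_density B (level_profile Y c psi tau)].

Definition pbar_of B Y c psi : 'rV[R]_m -> R :=
  level_profile Y c psi (tau_of B Y c psi).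

Definition is_uniform_bound B Y c P :=
  forall psi, {within Y, continuous psi} ->
    forall s, B s -> pbar_of B Y c psi s <= P.

Definition ext_Y Y yext : set E := Y `|` [set yext].

Definition ext_c c yext : E -> E -> R :=
  fun x y => if y == yext then 0 else c x y.

Definition ext_mu B P := lebesgue_on (slab B P).

(* P * |B| - 1 is the mass of ext_mu not sent to nu; it is P - 1 when
   |B| = 1. *)
Definition ext_nu B nu P yext : set E -> \bar R :=
  fun A => (nu A + (P%:E * lebesgue_rV R m B - 1) * dirac yext A)%E.

Definition ext_gamma B pbar P yext (gamma : set (E * E) -> \bar R) :
    set (E * E) -> \bar R :=
  fun A => (gamma A +
    (lebesgue_on [set x : E | B (base x) /\ (pbar (base x) <= height x <= P)%R]
       \x dirac yext) A)%E.

Definition ext_psi psi tau yext : E -> R :=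
  fun y => if y == yext then - tau else psi y.

End cylinder.

(* Main.v *)
Require Import Defs.
From HB Require Import structures.
From mathcomp Require Import all_boot all_order all_algebra.
From mathcomp Require Import all_classical all_reals all_analysis.
From mathcomp Require Import measurable_realfun lra ring.

Set Implicit Arguments.
Unset Strict Implicit.
Unset Printing Implicit Defensive.
Import Order.TTheory GRing.Theory Num.Theory.
Import numFieldNormedType.Exports.

Local Open Scope classical_set_scope.
Local Open Scope ring_scope.

(** Write f for the c-transform of psi, tau for its threshold and S for the set
    of the points x of the cylinder with f x <= tau.  The c_ext-transform F of
    psi_ext is min(f, tau): it is the lower envelope of the functions
    c_ext(., y) - psi_ext y, indexed by the compact set Y with yext added.

    _Unique minimisers._  Distinct functions of this family never have the same
    gradient at a point: on Y this is the twist condition, and the constant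
    function indexed by yext differs from the others because the gradient of c
    does not vanish.  Where two minimisers coexist, some partial derivative
    therefore takes two values, and F has a concave kink along a coordinate
    line.  A line carries only countably many kinks between two given rational
    slopes, so that by Fubini the minimiser is unique off a Lebesgue-null set
    (non_unique_null).  Where it is unique, F is differentiable
    (differentiable_envelope), and wherever F is differentiable its gradient is
    that of every active function, so that the minimiser is unique
    (differentiable_unique_argmin).  The map T of the theorem sends x to the
    minimiser at x.

    _T carries Lebesgue measure on S to nu._  A bathtub argument bounds G_nu phi
    below by tau - \int (tau - f_phi)^+ + \int phi dnu, where f_phi is the
    c-transform of phi and tau is the threshold of psi, with equality at psi.
    Since tau is kept fixed, the maximality of psi can be tested on
    phi = psi + t h without differentiating the threshold.  The envelope theorem
    gives \int h dnu <= \int_S h(T x) dx for continuous h with values in [0, 1];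
    the same inequality for 1 - h makes both equalities
    (target_measure_transported).

    _Complementary slackness._  The map x |-> (x, T x) pushes Lebesgue measure on
    S to a competitor for the optimal plan, whose cost equals the dual value.
    Comparison of the costs forces three non-negative quantities to vanish: the
    integral of the gap c - f - psi against gamma, the mass that pbar puts above
    the level tau, and the mass below tau that it misses (no_slack).  Hence the
    subgraph of pbar is S up to a null set, and gamma lives on the graph of T
    (optimal_plan_graph).

    _Optimality and uniqueness._  For any transport map T', the cost of T' is a
    constant plus the integral of C(x, T' x) - F x - G(T' x), where F and G are
    potentials with F + G <= C.  It is least exactly when this integrand
    vanishes almost everywhere, that is when T' x is the minimiser at x
    (unique_optimal_of_potentials).  Taking psi_ext for G gives the extended
    problem, and psi the problem on the subgraph of pbar. *)

(** * Lebesgue measure along coordinate lines *)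

Section lebesgue_slices.
Variables (R : realType).

Lemma measurable_preimage d1 d2 (T1 : measurableType d1) (T2 : measurableType d2)
    (f : T1 -> T2) A : measurable_fun setT f -> measurable A -> measurable (f @^-1` A).
Proof. by move=> mf mA; rewrite -[X in measurable X]setTI; exact: mf. Qed.

Lemma lebesgue_rVS n (A : set 'rV[R]_n.+1) : measurable A ->
  lebesgue_rV R n.+1 A =
  (\int[lebesgue_measure]_t
     lebesgue_rV R n (xsection (@cons_rV R n @^-1` A) t))%E.
Proof. by []. Qed.

Lemma lebesgue_rVS_swap n (A : set 'rV[R]_n.+1) : measurable A ->
  lebesgue_rV R n.+1 A =
  (\int[lebesgue_rV R n]_s
     lebesgue_measure (ysection (@cons_rV R n @^-1` A) s))%E.
Proof.
move=> mA; have mA' := measurable_preimage (@measurable_cons_rV R n) mA.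
rewrite [LHS](_ : _ = (lebesgue_measure \x^ lebesgue_rV R n)%E
  (@cons_rV R n @^-1` A)) //.
apply: product_measure_unique => // X1 X2 mX1 mX2.
exact: product_measure2E.
Qed.

Lemma cons_rVD n t r (s v : 'rV[R]_n) :
  cons_rV (t, s) + cons_rV (r, v) = cons_rV (t + r, s + v).
Proof.
apply/rowP => i; rewrite mxE; case: (unliftP ord0 i) => [j|] ->.
  by rewrite !cons_rVS mxE.
by rewrite !cons_rV0.
Qed.

Lemma delta_rV0 n t : t *: delta_mx 0 0 = cons_rV (t, 0) :> 'rV[R]_n.+1.
Proof.
apply/rowP => i; rewrite mxE [X in _ * X]mxE eqxx /=.
case: (unliftP ord0 i) => [j|] ->; first by rewrite cons_rVS mxE mulr0.
by rewrite cons_rV0 mulr1.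
Qed.

Lemma delta_rV_lift n t (j : 'I_n) :
  t *: delta_mx 0 (lift ord0 j) = cons_rV (0, t *: delta_mx 0 j) :> 'rV[R]_n.+1.
Proof.
apply/rowP => i; rewrite mxE [X in _ * X]mxE eqxx /=.
case: (unliftP ord0 i) => [k|] ->.
  by rewrite cons_rVS !mxE eqxx /= (inj_eq lift_inj).
by rewrite cons_rV0 (negbTE (neq_lift _ _)) mulr0.
Qed.

(** By Fubini one coordinate can be integrated first, and a countable set of
    parameters is null.  The induction on the dimension mirrors the recursive
    definition of the measure, which peels off the coordinate 0. *)
Lemma countable_lines_null n (i : 'I_n) (A : set 'rV[R]_n) : measurable A ->
  (forall x, countable [set t | A (x + t *: delta_mx 0 i)]) ->
  lebesgue_rV R n A = 0%E.
Proof.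
elim: n i A => [[]//|n IH] i A mA cA.
have mA' := measurable_preimage (@measurable_cons_rV R n) mA.
case: (unliftP ord0 i) cA => [j|] -> cA.
  rewrite lebesgue_rVS//; apply: integral0_eq => t _; apply: (IH j).
    exact: measurable_xsection.
  move=> s; apply: sub_countable (cA (cons_rV (t, s))).
  apply: subset_card_le => r /=; rewrite /xsection /= inE /=.
  by rewrite delta_rV_lift cons_rVD addr0.
rewrite lebesgue_rVS_swap//; apply: integral0_eq => s _.
apply: countable_lebesgue_measure0.
apply: sub_countable (cA (cons_rV (0, s))); apply: subset_card_le => r /=.
by rewrite /ysection /= inE /= delta_rV0 cons_rVD add0r addr0.
Qed.

Lemma cyl_point_lshift m (s : 'rV[R]_m) p i : cyl_point s p 0 (lshift 1 i) = s 0 i.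
Proof. by rewrite /cyl_point row_mxEl. Qed.

Lemma cyl_point_rshift m (s : 'rV[R]_m) p i : cyl_point s p 0 (rshift m i) = p.
Proof. by rewrite /cyl_point row_mxEr mxE (ord1 i) eqxx mulr1n. Qed.

Lemma measurable_cyl_point m :
  measurable_fun setT (fun z : 'rV[R]_m * R => cyl_point z.1 z.2).
Proof.
apply/measurable_fun_rVP => i; case: (split_ordP i) => j ->.
  under eq_fun do rewrite cyl_point_lshift.
  exact: (measurableT_comp (measurable_coord 0 j) measurable_fst).
under eq_fun do rewrite cyl_point_rshift.
exact: measurable_snd.
Qed.

Lemma cyl_point_cons m t (s : 'rV[R]_m) p :
  cyl_point (cons_rV (t, s)) p = cons_rV (t, cyl_point s p) :> 'rV[R]_(m.+1 + 1).
Proof.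
apply/rowP => i; case: (unliftP ord0 i) => [j|] ->.
  rewrite cons_rVS /=; case: (split_ordP j) => k ->.
    rewrite cyl_point_lshift.
    rewrite (_ : lift _ _ = lshift 1 (lift ord0 k)); last exact/val_inj.
    by rewrite cyl_point_lshift cons_rVS.
  rewrite cyl_point_rshift (_ : lift _ _ = rshift m.+1 k) ?cyl_point_rshift//.
  exact/val_inj.
rewrite cons_rV0 (_ : ord0 = lshift 1 ord0); last exact/val_inj.
by rewrite cyl_point_lshift cons_rV0.
Qed.

Lemma cyl_point0 (s : 'rV[R]_0) p : cyl_point s p = cons_rV (p, s) :> 'rV[R]_(0 + 1).
Proof.
apply/rowP => i; rewrite (ord1 i) cons_rV0 -[RHS](@cyl_point_rshift 0 s p 0).
by congr (cyl_point _ _ _ _); exact/val_inj.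
Qed.

(** The recursive definition splits off the first coordinate, whereas the
    cylinder singles out the last one. *)
Lemma lebesgue_rV_height m (A : set 'rV[R]_(m + 1)) : measurable A ->
  lebesgue_rV R (m + 1) A =
  (\int[lebesgue_rV R m]_s lebesgue_measure [set p | A (cyl_point s p)])%E.
Proof.
elim: m A => [|m IH] A mA.
  rewrite lebesgue_rVS_swap//; apply: eq_integral => s _; congr (lebesgue_measure _).
  by apply/seteqP; split => p; rewrite /ysection /= inE /= cyl_point0.
have mC := measurable_preimage (@measurable_cyl_point m.+1) mA.
have mcons : measurable_fun [set: (measurableTypeR R * 'rV[R]_m)%type]
  (@cons_rV R m) by exact: measurable_cons_rV.
transitivity (\int[pushforward (lebesgue_measure \x lebesgue_rV R m)
  (@cons_rV R m)]_s lebesgue_measure [set p | A (cyl_point s p)])%E; last by [].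
rewrite (ge0_integral_pushforward mcons)//=; last first.
  have := measurable_fun_xsection (@lebesgue_measure R) mC.
  congr (measurable_fun _ _); apply/funext => s /=; congr (lebesgue_measure _).
  by apply/seteqP; split => p; rewrite /xsection /= inE.
rewrite preimage_setT fubini_tonelli1//; last first.
  have := measurable_fun_xsection (@lebesgue_measure R) mC.
  move/measurableT_comp => /(_ _ _ _ _ mcons).
  congr (measurable_fun _ _); apply/funext => s /=; congr (lebesgue_measure _).
  by apply/seteqP; split => p; rewrite /xsection /= inE.
rewrite [LHS]lebesgue_rVS//; apply: eq_integral => t _.
rewrite IH; last first.
  apply: measurable_xsection.
  exact: (measurable_preimage (@measurable_cons_rV R (m + 1)) mA).
apply: eq_integral => s _; congr (lebesgue_measure _).
apply/seteqP; split => p; rewrite /xsection /= inE /= cyl_point_cons //.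
Qed.

Lemma measurable_box n (M : R) :
  measurable [set x : 'rV[R]_n | forall i, `|x 0 i| <= M].
Proof.
rewrite (_ : mkset _ = \bigcap_(i in [set: 'I_n])
  ((fun x : 'rV[R]_n => x 0 i) @^-1` `[- M, M]%classic)); last first.
  apply/seteqP; split => [x h i _ /=|x h i]; first by rewrite in_itv/= -ler_norml.
  by have := h i I; rewrite /= in_itv/= -ler_norml.
apply: fin_bigcap_measurable => // i _.
exact: (measurable_preimage (measurable_coord 0 i)).
Qed.

Lemma lebesgue_rV_box_fin n (M : R) :
  (lebesgue_rV R n [set x | forall i, (`|x 0%R i| <= M)%R] < +oo)%E.
Proof.
elim: n => [|n IH].
  by rewrite /= diracE ltry.
rewrite [X in (X < _)%E](_ : _ = ((lebesgue_measure \x lebesgue_rV R n)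
  (`[(- M)%R, M%R]%classic `*` [set x : 'rV[R]_n | forall i, (`|x 0%R i| <= M)%R]))%E); last first.
  congr (product_measure1 _ _ _); apply/seteqP; split => [[t s] /= h|[t s] /= [h1 h2] i].
    split; first by have := h 0; rewrite cons_rV0 ler_norml /= in_itv.
    by move=> i; have := h (lift ord0 i); rewrite cons_rVS.
  case: (unliftP ord0 i) => [j|] ->; first by rewrite cons_rVS; exact: h2.
  by rewrite cons_rV0 ler_norml; move: h1; rewrite in_itv.
have mB := @measurable_box n M.
rewrite product_measure1E// lte_mul_pinfty//.
by rewrite /= lebesgue_measure_itv/=; case: ifP => _.
Qed.

Lemma lebesgue_rV_ball_gt0 n (x : 'rV[R]_n) e : 0 < e ->
  (0 < lebesgue_rV R n (ball x e))%E.
Proof.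
move=> e0; elim: n x => [|n IH] x.
  rewrite /= diracE mem_set//; split => // i [] //.
rewrite [X in (_ < X)%E](_ : _ = ((lebesgue_measure \x lebesgue_rV R n)
  (ball (x 0%R 0%R) e `*` ball (\row_i x 0%R (lift ord0 i)) e))%E); last first.
  congr (product_measure1 _ _ _); apply/seteqP.
  split => [[t s] /= [_ h]|[t s] /= [h1 [_ h2]]].
    split; first by have := h 0 0; rewrite cons_rV0.
    split => // i j; rewrite (ord1 i); have := h 0 (lift ord0 j).
    by rewrite cons_rVS mxE.
  split => // i j; rewrite (ord1 i); case: (unliftP ord0 j) => [k|] ->.
    by rewrite cons_rVS; have := h2 0 k; rewrite mxE.
  by rewrite cons_rV0.
have mb k (y : 'rV[R]_k) : measurable (ball y e).
  by apply: open_measurable_mx; exact: ball_open.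
rewrite product_measure1E//; last exact: measurable_ball.
by rewrite mule_gt0//= lebesgue_measure_ball ?ltW// lte_fin mulrn_wgt0.
Qed.

End lebesgue_slices.

(** * Borel sets and continuous functions *)

Section borel_and_continuity.
Variable R : realType.

Lemma closed_measurable_mx m n (A : set 'M[R]_(m, n)) : closed A -> measurable A.
Proof.
move=> cA; rewrite -(setCK A); apply: measurableC; apply: open_measurable_mx.
exact: closed_openC.
Qed.

Lemma measurable_row_mx n k :
  measurable_fun setT (fun z : 'rV[R]_n * 'rV[R]_k => row_mx z.1 z.2).
Proof.
apply/measurable_fun_rVP => i; case: (split_ordP i) => j ->.
  under eq_fun do rewrite row_mxEl.
  exact: (measurableT_comp (measurable_coord 0 j) measurable_fst).
under eq_fun do rewrite row_mxEr.
exact: (measurableT_comp (measurable_coord 0 j) measurable_snd).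
Qed.

(** The product sigma-algebra contains the open sets because it is the image of
    the Borel sigma-algebra of 'rV_(n + k) under concatenation. *)
Lemma open_measurable_prod n k (U : set ('rV[R]_n * 'rV[R]_k)) :
  open U -> measurable U.
Proof.
move=> oU; pose g (x : 'rV[R]_(n + k)) := (lsubmx x, rsubmx x).
rewrite (_ : U = (fun z => row_mx z.1 z.2) @^-1` (g @^-1` U)); last first.
  by apply/seteqP; split => -[x y]; rewrite /g /= row_mxKl row_mxKr.
apply: (measurable_preimage (@measurable_row_mx n k)); apply: open_measurable_mx.
apply: open_comp => // x _.
exact: (cvg_pair (@continuous_lsubmx R 1 n k x) (@continuous_rsubmx R 1 n k x)).
Qed.

Lemma within_continuous_openI (T : topologicalType) (D : set T) (f : T -> R) V :
  {within D, continuous f} -> open V ->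
  exists2 U, open U & D `&` f @^-1` V = D `&` U.
Proof.
move=> /continuousP/(_ V) + oV => /(_ oV) /open_subspaceP[U oU e].
by exists U => //; rewrite setIC -e setIC.
Qed.

Lemma within_continuous_measurable_rV n (D : set 'rV[R]_n) (f : 'rV[R]_n -> R) :
  measurable D -> {within D, continuous f} -> measurable_fun D f.
Proof.
move=> mD cf; apply: (measurability _ (@RGenOpens.measurableE R)).
move=> _ [_ [a [b ->] <-]].
have oab : open (`]a, b[%classic : set R) by exact: interval_open.
have [U oU ->] := within_continuous_openI cf oab.
by apply: measurableI => //; exact: open_measurable_mx.
Qed.

Lemma within_continuous_measurable_prod n k (D : set ('rV[R]_n * 'rV[R]_k))
    (f : 'rV[R]_n * 'rV[R]_k -> R) :
  measurable D -> {within D, continuous f} -> measurable_fun D f.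
Proof.
move=> mD cf; apply: (measurability _ (@RGenOpens.measurableE R)).
move=> _ [_ [a [b ->] <-]].
have oab : open (`]a, b[%classic : set R) by exact: interval_open.
have [U oU ->] := within_continuous_openI cf oab.
by apply: measurableI => //; exact: open_measurable_prod.
Qed.

(** The distance to A truncated at 1; the truncation keeps the infimum over a
    non-empty set when A is empty. *)
Definition trunc_dist (V : normedModType R) (A : set V) x : R :=
  inf (1 |` [set `|x - a| | a in A]).

Section trunc_dist.
Variables (V : normedModType R) (A : set V).

Lemma trunc_dist_lbound x : lbound (1 |` [set `|x - a| | a in A]) 0.
Proof. by move=> _ [->|[a _ <-]]. Qed.

Lemma trunc_dist_has_inf x : has_inf (1 |` [set `|x - a| | a in A]).
Proof. by split; [exists 1; left|exists 0; exact: trunc_dist_lbound]. Qed.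

Lemma trunc_dist_ge0 x : 0 <= trunc_dist A x.
Proof.
apply: lb_le_inf; first by exists 1; left.
exact: trunc_dist_lbound.
Qed.

Lemma trunc_dist_lipschitz x y : trunc_dist A x <= trunc_dist A y + `|x - y|.
Proof.
rewrite -lerBlDr; apply: lb_le_inf; first by exists 1; left.
move=> _ [->|[a Aa <-]]; rewrite lerBlDr.
  apply: (@le_trans _ _ 1); last by rewrite lerDl.
  by apply: ge_inf; [have [] := trunc_dist_has_inf x|left].
apply: (@le_trans _ _ `|x - a|).
  by apply: ge_inf; [have [] := trunc_dist_has_inf x|right; exists a].
by rewrite [leRHS]addrC; exact: ler_distD.
Qed.

Lemma continuous_trunc_dist : continuous (trunc_dist A).
Proof.
move=> x; apply/cvgrPdist_lt => e e0; near=> y.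
have xye : `|x - y| < e by near: y; apply: cvgr_dist_lt.
rewrite (le_lt_trans _ xye)// ler_distl.
rewrite lerBlDr trunc_dist_lipschitz distrC trunc_dist_lipschitz//.
Unshelve. all: by end_near. Qed.

Lemma trunc_dist0 x : A x -> trunc_dist A x = 0.
Proof.
move=> Ax; apply/eqP; rewrite eq_le trunc_dist_ge0 andbT.
apply: ge_inf; first by have [] := trunc_dist_has_inf x.
by right; exists x => //; rewrite subrr normr0.
Qed.

Lemma trunc_dist_gt0 x : open (~` A) -> ~ A x -> 0 < trunc_dist A x.
Proof.
move=> oA nAx; have /nbhs_ballP[e /= e0 eA] := open_nbhs_nbhs (conj oA nAx).
apply: (@lt_le_trans _ _ (Num.min 1 e)); first by rewrite lt_min ltr01.
apply: lb_le_inf; first by exists 1; left.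
move=> _ [->|[a Aa <-]]; first by rewrite ge_min lexx.
rewrite ge_min; apply/orP; right; rewrite leNgt; apply/negP => xa.
by have := eA a; rewrite -ball_normE /= => /(_ xa).
Qed.

End trunc_dist.

(** The functions min(1, k d(x, ~A)) increase to the indicator of an open set A,
    so that continuous functions determine a finite measure on open sets, and
    these generate the sigma-algebra. *)
Lemma measure_eq_continuous n (m1 m2 : {measure set 'rV[R]_n -> \bar R}) :
  (m1 setT < +oo)%E -> (m2 setT < +oo)%E ->
  (forall h : 'rV[R]_n -> R, continuous h -> (forall x, 0 <= h x <= 1) ->
    (\int[m1]_x (h x)%:E = \int[m2]_x (h x)%:E)%E) ->
  forall A, measurable A -> m1 A = m2 A.
Proof.
move=> m1oo m2oo hE A mA.
apply: (@measure_unique _ _ _ (@open 'rV[R]_n) (fun=> setT)) => //.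
- by move=> U V; exact: openI.
- by move=> ?; exact: openT.
- by rewrite bigcup_const//; exists 0%N.
move=> {mA}A oA.
pose h k x := Num.min 1 (k%:R * trunc_dist (~` A) x).
have ch k : continuous (h k).
  move=> x; apply: (@continuous_min _ _ (fun=> 1)
      (fun y => k%:R * trunc_dist (~` A) y) x); first exact: cst_continuous.
  apply: (@cvgM R _ (nbhs x) _ (fun=> k%:R) (trunc_dist (~` A))).
    exact: cvg_cst.
  exact: continuous_trunc_dist.
have h01 k x : 0 <= h k x <= 1.
  by rewrite le_min ler01 mulr_ge0 ?trunc_dist_ge0//= ge_min lexx.
have hlim x : limn (fun k => (h k x)%:E) = (\1_A x)%:E.
  apply: cvg_lim => //; apply: cvg_near_cst; rewrite indicE.
  have [Ax|nAx] := pselect (A x); last first.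
    near=> k; rewrite memNset//; congr EFin; rewrite /h trunc_dist0//.
    by rewrite mulr0 min_r.
  have d0 : 0 < trunc_dist (~` A) x by apply: trunc_dist_gt0; rewrite ?setCK //.
  near=> k; rewrite mem_set//; congr EFin; rewrite /h min_l//.
  rewrite -ler_pdivrMr// mul1r; near: k; exact: nbhs_infty_ger.
have mh k : measurable_fun setT (EFin \o h k).
  apply/measurable_EFinP; apply: within_continuous_measurable_rV => //.
  exact: continuous_subspaceT.
have cvgh (mu : {measure set 'rV[R]_n -> \bar R}) :
    (\int[mu]_x (h k x)%:E)%E @[k --> \oo] --> mu A.
  have -> : mu A = (\int[mu]_x (\1_A x)%:E)%E.
    by rewrite integral_indic ?setIT//; exact: open_measurable_mx.
  under eq_integral do rewrite -hlim.
  apply: cvg_monotone_convergence => //.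
  - by move=> k x _; rewrite lee_fin; case/andP: (h01 k x).
  - move=> x _ i j ij; rewrite lee_fin /h le_min ge_min lexx/=.
    rewrite ge_min; apply/orP; right; rewrite ler_wpM2r ?trunc_dist_ge0//.
    by rewrite ler_nat.
have e : (fun k => \int[m2]_x (h k x)%:E)%E = (fun k => \int[m1]_x (h k x)%:E)%E.
  by apply/funext => k; rewrite hE.
by have := cvgh m2; rewrite e => m1m2; exact: (cvg_unique _ (cvgh m1) m1m2).
Unshelve. all: by end_near. Qed.

End borel_and_continuity.

(** * Lower envelopes of compact families *)

Section lower_envelope.
Variables (R : realType) (V : normedModType R) (T : topologicalType).
Variables (Om : set V) (K : set T) (u : V -> T -> R).

Definition envelope (x : V) : R := inf [set u x y | y in K].

Definition argmin (x : V) : set T :=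
  [set y | K y /\ forall y', K y' -> u x y <= u x y'].

(** Continuity at the points of [Om * K], with y restricted to K but x free. *)
Definition jointly_continuous := forall x y, Om x -> K y -> forall e, 0 < e ->
  \forall y' \near y & x' \near x, K y' -> `|u x' y' - u x y| < e.

Hypothesis Omo : open Om.
Hypothesis Kc : compact K.
Hypothesis K0 : K !=set0.
Hypothesis uc : jointly_continuous.

Lemma near_all_compact (x : V) (P : V -> T -> Prop) :
  (forall y, K y -> \forall y' \near y & x' \near x, K y' -> P x' y') ->
  \forall x' \near x, forall y, K y -> P x' y.
Proof.
by move=> h; have /compact_near_coveringP/near_covering_withinP := Kc; apply.
Qed.

Lemma argmin_exists x : Om x -> argmin x !=set0.
Proof.
move=> Omx; have [|y yK ymin] := compact_EVT_min K0 Kc (f := u x).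
  apply/subspace_continuousP => y Ky; apply/cvgrPdist_lt => e e0.
  have [[A B] /= [Ay Bx] AB] := uc Omx Ky e0.
  rewrite near_withinE; near=> y' => Ky'; rewrite distrC.
  apply: (AB (y', x)) => //; split => /=; last exact: nbhs_singleton.
  by near: y'.
exists y; split; first by rewrite inE in yK.
by move=> y' Ky'; apply: ymin; rewrite inE.
Unshelve. all: by end_near. Qed.

Lemma envelope_eq x y : argmin x y -> envelope x = u x y.
Proof.
move=> [Ky ymin]; apply/eqP; rewrite eq_le; apply/andP; split.
  apply: ge_inf; last by exists y.
  by exists (u x y) => _ [y' Ky' <-]; exact: ymin.
apply: lb_le_inf; first by exists (u x y), y.
by move=> _ [y' Ky' <-]; exact: ymin.
Qed.

Lemma envelope_le x y : Om x -> K y -> envelope x <= u x y.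
Proof.
by move=> /argmin_exists[y0 y0x]; rewrite (envelope_eq y0x); apply: y0x.2.
Qed.

Lemma argminE x y : Om x -> K y -> u x y <= envelope x -> argmin x y.
Proof.
move=> Omx Ky uxy; split => // y' Ky'.
by rewrite (le_trans uxy)// envelope_le.
Qed.

Lemma near_jointly_lt x y (d : R) : Om x -> K y -> u x y < d ->
  \forall y' \near y & x' \near x, K y' -> u x' y' < d.
Proof.
move=> Omx Ky uxy; have d0 : 0 < d - u x y by rewrite subr_gt0.
have [[A B] AB h] := uc Omx Ky d0; exists (A, B) => // z Az Kz.
by have := h z Az Kz; rewrite ltr_distl subrKC => /andP[].
Qed.

Lemma near_jointly_gt x y (d : R) : Om x -> K y -> d < u x y ->
  \forall y' \near y & x' \near x, K y' -> d < u x' y'.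
Proof.
move=> Omx Ky uxy; have d0 : 0 < u x y - d by rewrite subr_gt0.
have [[A B] AB h] := uc Omx Ky d0; exists (A, B) => // z Az Kz.
by have := h z Az Kz; rewrite ltr_distl subKr => /andP[].
Qed.

Lemma near_lt_at x y (d : R) : Om x -> K y -> u x y < d ->
  \forall x' \near x, u x' y < d.
Proof.
move=> Omx Ky uxy; have [[A B] /= [Ay Bx] AB] := near_jointly_lt Omx Ky uxy.
near=> x'; apply: (AB (y, x')) => //; split => /=; first exact: nbhs_singleton.
by near: x'.
Unshelve. all: by end_near. Qed.

Lemma continuous_envelope x : Om x -> {for x, continuous envelope}.
Proof.
move=> Omx; have [y yx] := argmin_exists Omx; have [Ky ymin] := yx.
apply/cvgrPdist_lt => e e0; near=> x'; rewrite distrC ltr_distl.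
have Omx' : Om x' by near: x'; exact: open_nbhs_nbhs.
apply/andP; split; last first.
  apply: le_lt_trans (envelope_le Omx' Ky) _; near: x'.
  by apply: near_lt_at => //; rewrite (envelope_eq yx) ltrDl.
have [y' yx'] := argmin_exists Omx'; rewrite (envelope_eq yx').
have [Ky' _] := yx'.
suff : forall y, K y -> envelope x - e < u x' y by apply.
near: x'; apply: near_all_compact => z Kz; apply: near_jointly_gt => //.
by rewrite (lt_le_trans _ (envelope_le Omx Kz))// ltrBlDr ltrDl.
Unshelve. all: by end_near. Qed.

(** If y0 is the only minimiser at x0, the indices far from y0 are strictly worse
    at x0, hence remain worse nearby, by compactness.  The indices close to y0
    have almost the same increment as y0 from x0 to x, and are no better at x0. *)
Lemma envelope_first_order x0 y0 : Om x0 -> argmin x0 = [set y0] ->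
  (forall e, 0 < e -> \forall y \near y0 & x \near x0, K y ->
     u x y0 - u x0 y0 - e * `|x - x0| <= u x y - u x0 y) ->
  forall e, 0 < e ->
    \forall x \near x0, u x y0 - e * `|x - x0| <= envelope x <= u x y0.
Proof.
move=> Omx0 y0E hu e e0.
have [Ky0 y0min] : argmin x0 y0 by rewrite y0E.
have near_ge : \forall x \near x0, forall y, K y ->
    u x y0 - e * `|x - x0| <= u x y.
  apply: near_all_compact => y Ky.
  have [->|yy0] := pselect (y = y0).
    have [[A B] AB h] := hu e e0; exists (A, B) => // z Az Kz.
    have := h z Az Kz; have := y0min _ Kz; lra.
  have uyy0 : u x0 y0 < u x0 y.
    rewrite ltNge; apply/negP => le; apply: yy0.
    suff : argmin x0 y by rewrite y0E.
    by split => // z Kz; exact: le_trans le (y0min _ Kz).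
  pose d := (u x0 y0 + u x0 y) / 2.
  have [dl dr] : u x0 y0 < d /\ d < u x0 y by rewrite /d; split; lra.
  have [[A B] [/= Ay Bx] h] := near_jointly_gt Omx0 Ky dr.
  exists (A, B `&` [set x | u x y0 < d]) => /=.
    by split => //; apply: filterI => //; exact: near_lt_at.
  move=> [y' x] /= [Ay' [Bx' xd]] Ky'.
  have := h (y', x) (conj Ay' Bx') Ky' => /= dxy'.
  have : 0 <= e * `|x - x0| by rewrite mulr_ge0// ltW.
  lra.
near=> x.
have Omx : Om x by near: x; exact: open_nbhs_nbhs.
rewrite (envelope_le Omx Ky0) andbT.
have [y yx] := argmin_exists Omx; rewrite (envelope_eq yx).
suff : forall y, K y -> u x y0 - e * `|x - x0| <= u x y by apply; case: yx.
by near: x.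
Unshelve. all: by end_near. Qed.

(** This is the closedness of the set of pairs (x, y) with y minimising at x,
    followed by the projection along the compact set K. *)
Lemma open_no_argmin (Q : V -> T -> Prop) :
  (forall x y, Om x -> K y -> ~ Q x y ->
    \forall y' \near y & x' \near x, K y' -> ~ Q x' y') ->
  open (Om `&` [set x | ~ exists y, argmin x y /\ Q x y]).
Proof.
move=> hQ; rewrite openE => x [Omx nQ].
suff : \forall x' \near x, forall y, K y -> ~ (argmin x' y /\ Q x' y).
  move=> h; near=> x'; split; first by near: x'; exact: open_nbhs_nbhs.
  move=> [y [yx' Qx'y]]; have [Ky _] := yx'.
  suff : forall y, K y -> ~ (argmin x' y /\ Q x' y) by move/(_ y Ky); apply.
  by near: x'.
apply: near_all_compact => y Ky.
have [yx|nyx] := pselect (argmin x y).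
  have nQxy : ~ Q x y by move=> Qxy; apply: nQ; exists y.
  have [[A B] AB h] := hQ x y Omx Ky nQxy; exists (A, B) => // z Az Kz [_].
  exact: h.
have lty : envelope x < u x y.
  by rewrite ltNge; apply/negP => le; apply: nyx; exact: argminE.
pose d := (envelope x + u x y) / 2.
have [dl dr] : envelope x < d /\ d < u x y by rewrite /d; split; lra.
have [[A B] [/= Ay Bx] h] := near_jointly_gt Omx Ky dr.
exists (A, B `&` [set x | envelope x < d]) => /=.
  split => //; apply: filterI => //.
  exact: (cvgr_lt _ (continuous_envelope Omx)).
move=> [y' x'] /= [Ay' [Bx' xd]] Ky' [+ _] => yx'.
have := h (y', x') (conj Ay' Bx') Ky'; rewrite /= -(envelope_eq yx').
by rewrite ltNge (ltW xd).
Unshelve. all: by end_near. Qed.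

End lower_envelope.

(** * Derivatives and kinks of envelopes *)

Section derivatives_of_envelopes.
Variable R : realType.

Lemma dnbhs0_radius (P : set R) : (\forall h \near 0^', P h) ->
  exists2 e : R, 0 < e & forall h : R, h != 0 -> `|h| < e -> P h.
Proof.
move=> /nbhs_ballP[e /= e0 eP]; exists e => // h h0 he; apply: eP => //.
by rewrite -ball_normE /= sub0r normrN.
Qed.

Lemma derive_local_min (V : normedModType R) (f : V -> R) x v :
  (\forall y \near x, f x <= f y) -> derivable f x v -> 'D_v f x = 0.
Proof.
move=> fx df; pose q h := h^-1 *: ((f \o shift x) (h *: v) - f x).
have cq : q h @[h --> 0^'] --> 'D_v f x by exact: df.
have hv : h *: v + x @[h --> 0] --> x.
  rewrite -[X in _ --> X]add0r -(scale0r v); apply: cvgD; last exact: cvg_cst.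
  by apply: cvgZr_tmp; exact: cvg_id.
have : \forall h \near 0^', f x <= f (h *: v + x).
  exact: (nbhs_dnbhs (hv _ fx)).
move=> /dnbhs0_radius[e e0 he].
have qM h : h != 0 -> q h * h = f (h *: v + x) - f x.
  by move=> h0; rewrite /q /= -[_ *: _]/(_ * _) mulrC mulVKf.
apply/eqP; rewrite eq_le; apply/andP; split; rewrite leNgt; apply/negP => D0.
  have /dnbhs0_radius[d d0 hd] : \forall h \near 0^', 0 < q h.
    exact: (cvgr_gt _ cq _ D0).
  have m0 : 0 < Num.min e d by rewrite lt_min e0.
  pose h := - (Num.min e d / 2).
  have hn : h < 0 by rewrite /h oppr_lt0 divr_gt0.
  have hn0 : h != 0 by rewrite lt_eqF.
  have : `|h| < Num.min e d by rewrite ltr0_norm// /h; lra.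
  rewrite lt_min => /andP[/(he _ hn0) + /(hd _ hn0)].
  have := qM _ hn0; nra.
have /dnbhs0_radius[d d0 hd] : \forall h \near 0^', q h < 0.
  exact: (cvgr_lt _ cq _ D0).
have m0 : 0 < Num.min e d by rewrite lt_min e0.
pose h := Num.min e d / 2.
have hp : 0 < h by rewrite /h divr_gt0.
have hn0 : h != 0 by rewrite gt_eqF.
have : `|h| < Num.min e d by rewrite gtr0_norm// /h; lra.
rewrite lt_min => /andP[/(he _ hn0) + /(hd _ hn0)].
have := qM _ hn0; nra.
Qed.

(** The difference u(., y) - envelope is non-negative and vanishes at x. *)
Lemma envelope_derive (V : normedModType R) (T : topologicalType) (Om : set V)
    (K : set T) (u : V -> T -> R) x y v : open Om -> compact K -> K !=set0 ->
  jointly_continuous Om K u -> Om x -> argmin K u x y ->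
  derivable (u ^~ y) x v -> derivable (envelope K u) x v ->
  'D_v (u ^~ y) x = 'D_v (envelope K u) x.
Proof.
move=> Omo Kc K0 uc Omx yx du de; apply/eqP; rewrite -subr_eq0 -deriveB//.
apply/eqP; apply: derive_local_min; last exact: derivableB.
near=> x'; rewrite /= !fctE -(envelope_eq yx) subrr subr_ge0.
apply: (envelope_le Kc K0 uc); last by case: yx.
by near: x'; exact: open_nbhs_nbhs.
Unshelve. all: by end_near. Qed.

(** A strict local maximum is determined by a rational interval on which it is
    the only strict maximum. *)
Lemma strict_local_max_countable (g : R -> R) :
  countable [set t | \forall s \near t^', g s < g t].
Proof.
pose F (z : rat * rat) := [set t : R | [/\ ratr z.1 < t, t < ratr z.2 &
  forall s, ratr z.1 < s -> s < ratr z.2 -> s != t -> g s < g t]].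
apply: (@sub_countable _ _ _ (\bigcup_z F z)); last first.
  apply: bigcup_countable => // z _.
  have [[t Ft]|nF] := pselect (exists t, F z t); last first.
    rewrite (_ : F z = set0)//; apply/seteqP; split => // t Ft; apply: nF.
    by exists t.
  apply: (@sub_countable _ _ _ [set t]); last exact: countable1.
  apply: subset_card_le => s Fs /=; apply/eqP/negP => /negP st.
  case: Ft Fs => [t1 t2 t3] [s1 s2 s3].
  have := t3 s s1 s2 st; have := s3 t t1 t2; rewrite eq_sym => /(_ st).
  by move=> h1 h2; have := lt_trans h1 h2; rewrite ltxx.
apply: subset_card_le => t /= /nbhs_ballP[e /= e0 eP].
have [q1] := rat_in_itvoo (ltac:(lra) : t - e < t).
rewrite in_itv /= => /andP[q1l q1r].
have [q2] := rat_in_itvoo (ltac:(lra) : t < t + e).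
rewrite in_itv /= => /andP[q2l q2r].
exists (q1, q2) => //; split => //= s s1 s2 st; apply: eP => //.
by rewrite /ball /= ltr_distl; apply/andP; split; lra.
Qed.

(** At such a parameter the envelope lies below a function of slope at most q and
    below one of slope at least r.  Once the affine function of slope (q + r) / 2
    is subtracted, the parameter becomes a strict local maximum. *)
Lemma kinks_countable (V : normedModType R) (T : topologicalType) (Om : set V)
    (K : set T) (u : V -> T -> R) (q r : R) x v :
  open Om -> compact K -> K !=set0 -> jointly_continuous Om K u ->
  (forall x y, Om x -> K y -> derivable (u ^~ y) x v) -> q < r ->
  countable [set t | [/\ Om (x + t *: v),
    exists y, argmin K u (x + t *: v) y /\ 'D_v (u ^~ y) (x + t *: v) <= q &
    exists y, argmin K u (x + t *: v) y /\ r <= 'D_v (u ^~ y) (x + t *: v)]].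
Proof.
move=> Omo Kc K0 uc du qr; pose mid := (q + r) / 2.
pose g t := envelope K u (x + t *: v) - mid * t.
apply: sub_countable (strict_local_max_countable g).
apply: subset_card_le => t /= [Omt [y1 [y1t y1q]] [y2 [y2t y2r]]].
pose z := x + t *: v.
pose Q y h := h^-1 *: (u (h *: v + z) y - u z y).
have cQ y : K y -> Q y h @[h --> 0^'] --> 'D_v (u ^~ y) z.
  by move=> Ky; exact: (du z y Omt Ky).
have QM y h : h != 0 -> Q y h * h = u (h *: v + z) y - u z y.
  by move=> h0; rewrite /Q -[_ *: _]/(_ * _) mulrC mulVKf.
have /dnbhs0_radius[d1 d10 hd1] : \forall h \near 0^', Q y1 h < mid.
  by apply: (cvgr_lt _ (cQ _ y1t.1)); rewrite (le_lt_trans y1q)// /mid; lra.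
have /dnbhs0_radius[d2 d20 hd2] : \forall h \near 0^', mid < Q y2 h.
  by apply: (cvgr_gt _ (cQ _ y2t.1)); rewrite (lt_le_trans _ y2r)// /mid; lra.
have hv : h *: v + z @[h --> 0] --> z.
  rewrite -[X in _ --> X]add0r -(scale0r v); apply: cvgD; last exact: cvg_cst.
  by apply: cvgZr_tmp; exact: cvg_id.
have /nbhs_ballP[d3 /= d30 hd3] : \forall h \near 0, Om (h *: v + z).
  by apply: (hv Om); exact: open_nbhs_nbhs.
pose d := Num.min d1 (Num.min d2 d3).
have d0 : 0 < d by rewrite !lt_min d10 d20.
apply/nbhs_ballP; exists d => // s; rewrite /ball /= => ts st.
pose h := s - t; have h0 : h != 0 by rewrite subr_eq0.
have : `|h| < d by rewrite /h distrC.
rewrite !lt_min => /and3P[/(hd1 _ h0) h1 /(hd2 _ h0) h2 h3].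
have Ez : x + s *: v = h *: v + z.
  by rewrite /z /h scalerBl [RHS]addrC -addrA subrKC.
have Oms : Om (h *: v + z).
  by apply: hd3; rewrite /ball /= sub0r normrN.
rewrite /g Ez -/z.
have := envelope_le Kc K0 uc Oms y1t.1; have := envelope_eq y1t.
have := envelope_le Kc K0 uc Oms y2t.1; have := envelope_eq y2t.
rewrite -/z => e2 l2 e1 l1.
have := QM y1 _ h0; have := QM y2 _ h0; rewrite -e1 -e2 => q2 q1.
have -> : s = t + h by rewrite /h subrKC.
have [hn|hp|/eqP] := ltgtP h 0; last by rewrite (negbTE h0).
  have : Q y2 h * h < mid * h by rewrite ltr_nM2r.
  lra.
have : Q y1 h * h < mid * h by rewrite ltr_pM2r.
lra.
Qed.

End derivatives_of_envelopes.

(** * Differentiability and increments *)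

Section first_order_contact.
Variables (R : realType) (V : normedModType R).

Lemma differentiable_contact (f g : V -> R) x : differentiable f x ->
  (forall e, 0 < e -> \forall y \near x, `|g y - f y| <= e * `|y - x|) ->
  differentiable g x.
Proof.
move=> df gf; have gfx : g x = f x.
  have := gf 1 ltr01 => /nbhs_singleton.
  by rewrite subrr normr0 mulr0 normr_le0 subr_eq0 => /eqP.
have [cdf fE] := (diff_locallyP _ _).1 df.
have gE : g \o shift x = cst (g x) + 'd f x +o_ 0 id.
  apply/eqaddoP => e e0; have e20 : 0 < e / 2 by rewrite divr_gt0.
  have /eqaddoP/(_ _ e20) fe := fE.
  have ge : \forall h \near 0, `|g (h + x) - f (h + x)| <= e / 2 * `|h|.
    have hx : h + x @[h --> 0] --> x.
      by rewrite -[X in _ --> X]add0r; apply: cvgD; [exact: cvg_id|exact: cvg_cst].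
    have H : \forall h \near 0, `|g (h + x) - f (h + x)| <= e / 2 * `|h + x - x|.
      exact: (hx _ (gf _ e20)).
    by near=> h; rewrite -[h in leRHS](addrK x); near: h.
  near=> h.
  have h1 : `|(f \o shift x - (cst (f x) + 'd f x)) h| <= e / 2 * `|h| by near: h.
  have h2 : `|g (h + x) - f (h + x)| <= e / 2 * `|h| by near: h.
  rewrite (_ : (_ - _) h = (g (h + x) - f (h + x)) +
    (f \o shift x - (cst (f x) + 'd f x)) h); last first.
    by rewrite !fctE gfx /=; ring.
  by rewrite (le_trans (ler_normD _ _))// [e in leRHS]splitr mulrDl lerD.
by apply/diff_locallyP; rewrite (diff_unique cdf gE).
Unshelve. all: by end_near. Qed.

Lemma is_derive_line (f : V -> R) x w t : derivable f (x + t *: w) w ->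
  is_derive t 1 (fun t => f (x + t *: w)) ('D_w f (x + t *: w)).
Proof.
move=> df; have E : (fun h => h^-1 *:
    (((fun t => f (x + t *: w)) \o shift t) (h *: (1 : R)) - f (x + t *: w))) =
    (fun h => h^-1 *: ((f \o shift (x + t *: w)) (h *: w) - f (x + t *: w))).
  apply/funext => h /=; congr (_ *: (f _ - _)).
  by rewrite -[_ *: 1]/(_ * 1) mulr1 scalerDl addrCA.
by split; rewrite /derivable /derive E.
Qed.

End first_order_contact.

Section C1_increments.
Variables (R : realType) (n k : nat).
Variables (O : set ('rV[R]_n * 'rV[R]_k)) (f : 'rV[R]_n * 'rV[R]_k -> R).
Hypothesis fC1 : C1_on O f.

Lemma differentiable_partial x y : O (x, y) ->
  differentiable (fun x => f (x, y)) x /\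
  forall v, 'd (fun x => f (x, y)) x v = 'd f (x, y) (v, 0).
Proof.
move=> Oxy; have [df _] := fC1 Oxy.
have dp : is_diff x (fun x => (x, y)) (fun v => (v, 0)).
  exact: (@is_diff_pair R 'rV[R]_n 'rV[R]_n 'rV[R]_k id id (cst y) (cst 0) x _ _).
have [dc dE] : is_diff x (f \o (fun x => (x, y))) ('d f (x, y) \o (fun v => (v, 0))).
  apply: is_diff_comp; exact: differentiableP.
by split => // v; rewrite dE.
Qed.

Lemma derive_partial x y v : O (x, y) ->
  'D_v (fun x => f (x, y)) x = 'd f (x, y) (v, 0).
Proof. by move=> /differentiable_partial[df dE]; rewrite deriveE. Qed.

Lemma diff_coord x y h : O (x, y) -> 'd f (x, y) (h, 0) =
  \sum_i h 0 i * 'd f (x, y) (delta_mx 0 i, 0).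
Proof.
move=> Oxy; have [df dE] := differentiable_partial Oxy.
rewrite -dE {1}(row_sum_delta h) linear_sum; apply: eq_bigr => i _.
by rewrite linearZ /= -[_ *: _]/(_ * _) dE.
Qed.

Lemma coord_le_norm (h : 'rV[R]_n) i : `|h 0 i| <= `|h|.
Proof.
rewrite [leRHS]/Num.norm /= mx_normrE.
by apply: (le_trans _ (le_bigmax _ _ (0, i))).
Qed.

(** The mean value theorem on the segment from x0 to x, applied to the difference
    of the two partial functions, whose derivatives are uniformly close. *)
Lemma C1_increment_uniform x0 y0 : O (x0, y0) -> open O ->
  forall e, 0 < e -> \forall y \near y0 & x \near x0,
    `|(f (x, y) - f (x0, y)) - (f (x, y0) - f (x0, y0))| <= e * `|x - x0|.
Proof.
move=> O0 oO e e0.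
pose D (i : 'I_n) (z : 'rV[R]_n * 'rV[R]_k) := 'd f z (delta_mx 0 i, 0).
(* Two errors for each of the n coordinates; n.+1 avoids a division by 0. *)
pose e' := e / (2 * n.+1%:R).
have e'0 : 0 < e' by rewrite divr_gt0// mulr_gt0.
have near_ok : \forall z \near (x0, y0),
    O z /\ forall i, `|D i (x0, y0) - D i z| < e'.
  apply: filterI; first exact: open_nbhs_nbhs.
  apply: (@filter_forall _ 'I_n (fun i z => `|D i (x0, y0) - D i z| < e')
    (nbhs (x0, y0)) _) => i.
  have [_ /(_ (delta_mx 0 i, 0)) cD] := fC1 O0.
  by have /cvgrPdist_lt := cD; apply.
have [[A B] [/= /nbhs_ballP[r /= r0 rA] By] AB] := near_ok.
exists (B, ball x0 r) => /=; first by split => //; exact: nbhsx_ballx.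
move=> [y x] /= [By' xr].
pose w := x - x0.
pose p t : 'rV[R]_n := x0 + t *: w.
have pA (t : R) : 0 <= t <= 1 -> A (p t).
  move=> /andP[t0 t1]; apply: rA; rewrite -ball_normE /= /p opprD addNKr normrN.
  rewrite normrZ ger0_norm//; move: xr; rewrite -ball_normE /= distrC => xr.
  by apply: le_lt_trans xr; rewrite ler_piMl.
have pO (t : R) z : 0 <= t <= 1 -> B z -> O (p t, z).
  by move=> t01 Bz; have [] := AB (p t, z) (conj (pA _ t01) Bz).
pose G z t := f (p t, z).
have dG z (t : R) : 0 <= t <= 1 -> B z -> is_derive t 1 (G z) ('d f (p t, z) (w, 0)).
  move=> t01 Bz; rewrite -(derive_partial _ (pO t z t01 Bz)).
  have [df _] := differentiable_partial (pO t z t01 Bz).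
  exact: (is_derive_line (diff_derivable df)).
have By0 : B y0 by exact: nbhs_singleton.
pose H (t : R) := G y t - G y0 t.
have dH (t : R) : 0 <= t <= 1 ->
    is_derive t 1 H ('d f (p t, y) (w, 0) - 'd f (p t, y0) (w, 0)).
  by move=> t01; apply: is_deriveB; exact: dG.
have [t t01] : exists2 t, t \in `]0, 1[%R & H 1 - H 0 =
    ('d f (p t, y) (w, 0) - 'd f (p t, y0) (w, 0)) * (1 - 0).
  apply: (@MVT R H (fun t => 'd f (p t, y) (w, 0) - 'd f (p t, y0) (w, 0))) => //.
    move=> t; rewrite in_itv /= => /andP[t0 t1].
    by apply: dH; rewrite !ltW.
  apply: derivable_within_continuous => t; rewrite in_itv /= => t01.
  by have [] := dH t t01.
have {}t01 : 0 <= t <= 1 by move: t01; rewrite in_itv/= => /andP[/ltW -> /ltW ->].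
have p0 : p 0 = x0 by rewrite /p scale0r addr0.
have p1 : p 1 = x by rewrite /p scale1r /w subrKC.
rewrite /H /G p0 p1 subr0 mulr1 => E.
rewrite (_ : _ - _ = f (x, y) - f (x, y0) - (f (x0, y) - f (x0, y0))); last by ring.
have {}E : f (x, y) - f (x, y0) - (f (x0, y) - f (x0, y0)) =
    \sum_i w 0 i * D i (p t, y) - \sum_i w 0 i * D i (p t, y0).
  by rewrite E; congr (_ - _); apply: diff_coord; exact: pO.
rewrite E -sumrB (le_trans (ler_norm_sum _ _ _))//.
apply: (@le_trans _ _ (\sum_(i < n) e / n.+1%:R * `|w|)); last first.
  rewrite sumr_const card_ord -mulrnAl ler_wpM2r// -mulr_natr.
  by rewrite mulrAC ler_pdivrMr// ler_wpM2l ?ler_nat// ltW.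
apply: ler_sum => i _; rewrite -mulrBr normrM mulrC ler_pM// ?coord_le_norm//.
have [_ /(_ i) h1] := AB (p t, y) (conj (pA _ t01) By').
have [_ /(_ i) h2] := AB (p t, y0) (conj (pA _ t01) By0).
apply: (le_trans (ler_distD (D i (x0, y0)) _ _)).
rewrite (_ : e / n.+1%:R = e' + e'); last first.
  by rewrite /e' invfM mulrA -mulrDl -splitr.
apply: lerD; last exact: (ltW h2).
by rewrite [leLHS]distrC; exact: (ltW h1).
Qed.

End C1_increments.

(** * Almost everywhere unique minimisers *)

Lemma measure_bigcup_countable0 d (X : measurableType d) (R : realType)
    (mu : {measure set X -> \bar R}) (I : countType) (F : I -> set X) :
  (forall i, measurable (F i)) -> (forall i, mu (F i) = 0%E) ->
  mu (\bigcup_i F i) = 0%E.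
Proof.
move=> mF F0; pose G j := if unpickle j is Some i then F i else set0.
have mG j : measurable (G j) by rewrite /G; case: unpickle.
have G0 j : mu (G j) = 0%E by rewrite /G; case: unpickle.
rewrite (_ : \bigcup_i F i = \bigcup_j G j).
  apply/measure_negligible; first exact: bigcup_measurable.
  by apply: negligible_bigcup => j; exists (G j); split; [exact: mG|exact: G0|].
apply/seteqP; split => [x [i _ Fx]|x [j _]]; rewrite /G.
  by exists (pickle i) => //; rewrite /G pickleK.
by case: unpickle => // i Fx; exists i.
Qed.

Section twisted_envelope.
Variables (R : realType) (n k : nat).
Variables (Om : set 'rV[R]_n) (K : set 'rV[R]_k) (u : 'rV[R]_n -> 'rV[R]_k -> R).
Local Notation ei i := (delta_mx 0 i : 'rV[R]_n).

(** The properties of a cost under which the minimiser is almost everywhere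
    unique.  They are stated for an abstract family because the extended cost
    has the extra index yext, isolated from Y, where it is constant. *)
Record twisted_family : Prop := {
  family_open : open Om ;
  family_compact : compact K ;
  family_nonempty : K !=set0 ;
  family_continuous : jointly_continuous Om K u ;
  family_differentiable : forall x y, Om x -> K y -> differentiable (u ^~ y) x ;
  family_derive_continuous : forall i,
    jointly_continuous Om K (fun x y => 'D_(ei i) (u ^~ y) x) ;
  family_increment : forall x0 y0, Om x0 -> K y0 -> forall e, 0 < e ->
    \forall y \near y0 & x \near x0, K y ->
      `|(u x y - u x0 y) - (u x y0 - u x0 y0)| <= e * `|x - x0| ;
  family_twist : forall x y y', Om x -> K y -> K y' ->
    grad (u ^~ y) x = grad (u ^~ y') x -> y = y' }.

Hypothesis tw : twisted_family.

Let Omo := family_open tw.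
Let Kc := family_compact tw.
Let K0 := family_nonempty tw.
Let uc := family_continuous tw.

Definition unique_argmin x := exists y, argmin K u x = [set y].

Lemma unique_argminP x : Om x ->
  (forall i y y', argmin K u x y -> argmin K u x y' ->
    'D_(ei i) (u ^~ y) x = 'D_(ei i) (u ^~ y') x) -> unique_argmin x.
Proof.
move=> Omx h; have [y yx] := argmin_exists Kc K0 uc Omx; exists y.
apply/seteqP; split => [y' y'x|_ ->//] /=.
apply: (family_twist tw Omx y'x.1 yx.1).
by apply/rowP => i; rewrite !mxE; exact: h.
Qed.

(** The envelope has first-order contact with the active function. *)
Lemma differentiable_envelope x : Om x -> unique_argmin x ->
  differentiable (envelope K u) x.
Proof.
move=> Omx [y yE]; have yx : argmin K u x y by rewrite yE.
apply: (differentiable_contact (family_differentiable tw Omx yx.1)) => e e0.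
have := envelope_first_order Omo Kc K0 uc Omx yE _ e0; move=> H.
near=> x'; have : u x' y - e * `|x' - x| <= envelope K u x' <= u x' y.
  near: x'; apply: H => d d0.
  have [[A B] AB h] := family_increment tw Omx yx.1 d0.
  exists (A, B) => // z Az Kz; have := h z Az Kz.
  by rewrite ler_norml => /andP[]; lra.
move=> /andP[h1 h2]; rewrite ler_norml; apply/andP; split; first lra.
have : 0 <= e * `|x' - x| by rewrite mulr_ge0// ltW.
lra.
Unshelve. all: by end_near. Qed.

Lemma grad_envelope x y : Om x -> argmin K u x y ->
  differentiable (envelope K u) x -> grad (u ^~ y) x = grad (envelope K u) x.
Proof.
move=> Omx yx de; apply/rowP => i; rewrite !mxE.
apply: (envelope_derive Omo Kc K0 uc Omx yx); last exact: diff_derivable.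
by apply: diff_derivable; exact: (family_differentiable tw Omx yx.1).
Qed.

Lemma differentiable_unique_argmin x : Om x ->
  differentiable (envelope K u) x -> unique_argmin x.
Proof.
move=> Omx de; apply: unique_argminP => // i y y' yx y'x.
have := grad_envelope Omx yx de; rewrite -(grad_envelope Omx y'x de).
by move=> /rowP/(_ i); rewrite !mxE.
Qed.

Let below i (q : rat) := Om `&` [set x | exists y, argmin K u x y /\
  'D_(ei i) (u ^~ y) x <= ratr q].
Let above i (q : rat) := Om `&` [set x | exists y, argmin K u x y /\
  ratr q <= 'D_(ei i) (u ^~ y) x].

Lemma measurable_argmin_set (Q : 'rV[R]_n -> 'rV[R]_k -> Prop) :
  (forall x y, Om x -> K y -> ~ Q x y ->
    \forall y' \near y & x' \near x, K y' -> ~ Q x' y') ->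
  measurable (Om `&` [set x | exists y, argmin K u x y /\ Q x y]).
Proof.
move=> hQ; have := open_no_argmin Omo Kc K0 uc hQ => oQ.
rewrite (_ : _ `&` _ = Om `\`
  (Om `&` [set x | ~ exists y, argmin K u x y /\ Q x y])); last first.
  apply/seteqP; split => [x [Omx Qx]|x [Omx]]; first by split => // -[_].
  by move=> /not_andP[//|/contrapT].
by apply: measurableD; exact: open_measurable_mx.
Qed.

Let measurable_below i q : measurable (below i q).
Proof.
apply: measurable_argmin_set => x y Omx Ky /negP; rewrite -ltNge => lt.
have [[A B] AB h] := near_jointly_gt (family_derive_continuous tw i) Omx Ky lt.
by exists (A, B) => // z Az Kz; have := h z Az Kz; rewrite ltNge => /negP.
Qed.

Let measurable_above i q : measurable (above i q).
Proof.
apply: measurable_argmin_set => x y Omx Ky /negP; rewrite -ltNge => lt.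
have [[A B] AB h] := near_jointly_lt (family_derive_continuous tw i) Omx Ky lt.
by exists (A, B) => // z Az Kz; have := h z Az Kz; rewrite ltNge => /negP.
Qed.

(** Two minimisers whose i-th partial derivatives are separated by two rationals;
    only countably many sets are needed to catch every point with several
    minimisers. *)
Let kink (z : 'I_n * (rat * rat)) : set 'rV[R]_n :=
  if z.2.1 < z.2.2 then below z.1 z.2.1 `&` above z.1 z.2.2 else set0.

Let measurable_kink z : measurable (kink z).
Proof. by rewrite /kink; case: ifP => // _; exact: measurableI. Qed.

(** On each line in the direction i the set is countable. *)
Let kink_null z : lebesgue_rV R n (kink z) = 0%E.
Proof.
apply: (countable_lines_null (measurable_kink z) (i := z.1)) => x.
rewrite /kink; case: ifPn => [qr|_]; last by apply: countable0.
apply: (sub_countable _ (kinks_countable x (v := ei z.1) (q := ratr z.2.1)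
  (r := ratr z.2.2) Omo Kc K0 uc _ _)).
- by apply: subset_card_le => t [[? ?] [? ?]].
- move=> x' y Omx' Ky.
  by apply: diff_derivable; exact: (family_differentiable tw).
- by rewrite ltr_rat.
Qed.

Lemma non_unique_null : exists N, [/\ measurable N, lebesgue_rV R n N = 0%E,
  N `<=` Om & forall x, Om x -> (N x <-> ~ unique_argmin x)].
Proof.
exists (\bigcup_z kink z); split.
- by apply: countable_bigcupT_measurable.
- by apply: measure_bigcup_countable0.
- move=> x [z _]; rewrite /kink; case: ifP => // _ [[]//].
move=> x Omx; split.
  move=> [z _]; rewrite /kink; case: ifP => // qr [[_ [y [yx yq]]] [_ [y' [y'x y'r]]]].
  move=> [y0 yE]; move: yx y'x yq y'r; rewrite yE => -> -> h1 h2.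
  by have := le_trans h2 h1; rewrite ler_rat leNgt qr.
move=> nuniq; apply: contrapT => nN; apply: nuniq; apply: unique_argminP => //.
have le i y y' : argmin K u x y -> argmin K u x y' ->
    'D_(ei i) (u ^~ y) x <= 'D_(ei i) (u ^~ y') x.
  move=> yx y'x; rewrite leNgt; apply/negP => lt; apply: nN.
  have [r] := rat_in_itvoo lt; rewrite in_itv/= => /andP[r1 r2].
  have [q] := rat_in_itvoo r1; rewrite in_itv/= => /andP[q1 q2].
  exists (i, (q, r)) => //; rewrite /kink /= -(ltr_rat R) q2.
  by split; split => //; [exists y'|exists y]; split => //; exact: ltW.
by move=> i y y' yx y'x; apply/eqP; rewrite eq_le !le.
Qed.

Definition argmin_map (y0 : 'rV[R]_k) x : 'rV[R]_k :=
  if `[< Om x /\ unique_argmin x >] then get (argmin K u x) else y0.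

Lemma argmin_mapE y0 x : Om x -> unique_argmin x ->
  argmin K u x = [set argmin_map y0 x].
Proof.
move=> Omx ux; rewrite /argmin_map asboolT//; case: ux => y yE.
have yx : argmin K u x y by rewrite yE.
have : [set y] (get (argmin K u x)).
  by rewrite -[X in X _]yE; exact: (getPex (ex_intro _ y yx)).
by move=> /= ->.
Qed.

Lemma argmin_map_in y0 x : K y0 -> K (argmin_map y0 x).
Proof.
move=> Ky0; have [[Omx ux]|nx] := pselect (Om x /\ unique_argmin x).
  suff [] : argmin K u x (argmin_map y0 x) by [].
  by rewrite (argmin_mapE y0 Omx ux).
by rewrite /argmin_map asboolF.
Qed.

(** Where the minimiser is unique, the preimage of a closed set F is the set of
    the points that have a minimiser in F, which is closed relatively to Om. *)
Lemma measurable_argmin_map y0 : measurable_fun setT (argmin_map y0).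
Proof.
have [N [mN _ NOm NE]] := non_unique_null.
have mcl F : closed F -> measurable (argmin_map y0 @^-1` F).
  move=> cF; pose W := Om `&` [set x | exists y, argmin K u x y /\ F y].
  have mW : measurable W.
    apply: measurable_argmin_set => x y _ _ nFy.
    exists (~` F, setT) => /=; last by move=> z [].
    split; last exact: filterT.
    by apply: open_nbhs_nbhs; split => //; exact: closed_openC.
  have mG : measurable (Om `\` N).
    by apply: measurableD => //; exact: open_measurable_mx.
  rewrite (_ : _ @^-1` F = (W `&` (Om `\` N)) `|`
      ((if `[< F y0 >] then setT else set0) `\` (Om `\` N))); last first.
    apply/seteqP; split => x /=.
      have [[Omx ux]|nx] := pselect (Om x /\ unique_argmin x).
        move=> Fx; left; split; last by split => // /(NE _ Omx).
        by split => //; exists (argmin_map y0 x); rewrite (argmin_mapE y0 Omx ux).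
      rewrite /argmin_map asboolF// => Fy0; right; rewrite asboolT//; split => //.
      move=> [Omx nN]; apply: nx; split => //; apply: contrapT => nu.
      by apply: nN; apply/NE.
    move=> [[[Omx [y [yx Fy]]] [_ nN]]|].
      have ux : unique_argmin x by apply: contrapT => nu; apply: nN; apply/NE.
      by move: yx; rewrite (argmin_mapE y0 Omx ux) => <-.
    case: asboolP => [Fy0|]; last by move=> _ [].
    move=> [_ nG]; rewrite /argmin_map asboolF// => -[Omx ux]; apply: nG.
    by split => // /(NE _ Omx).
  apply: measurableU; first exact: measurableI.
  by apply: measurableD => //; case: ifP.
apply: (measurability _ (borel_matrixE R 1 k)) => _ [V oV <-].
rewrite setTI -[X in measurable X]setCK preimage_setC; apply: measurableC.
apply: mcl.
exact: open_closedC.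
Qed.

End twisted_envelope.

(** * The extended family *)

Section extended_family.
Variables (R : realType) (m : nat).
Local Notation E := 'rV[R]_(m + 1).
Variables (B : set 'rV[R]_m) (Y : set E) (c cE : E -> E -> R) (OmX OmY : set E).
Variables (yext : E) (psi : E -> R) (tau : R).
Hypothesis Yc : compact Y.
Hypothesis nYyext : ~ Y yext.
Hypothesis twist : extended_twist B Y c OmX OmY cE.
Hypothesis psic : {within Y, continuous psi}.

Let oX := twist_openX twist.
Let oY := twist_openY twist.
Let YOm := twist_subY twist.
Let cC1 := twist_C1 twist.
Local Notation Ye := (ext_Y Y yext).

Definition ext_family : E -> E -> R :=
  fun x y => ext_c cE yext x y - ext_psi psi tau yext y.

Lemma ext_family_in x y : Y y -> ext_family x y = cE x y - psi y.
Proof.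
move=> Yy; rewrite /ext_family /ext_c /ext_psi.
by have -> : (y == yext) = false by apply/negbTE/eqP => e; rewrite e in Yy.
Qed.

Lemma ext_family_out x : ext_family x yext = tau.
Proof. by rewrite /ext_family /ext_c /ext_psi eqxx sub0r opprK. Qed.

(** The point yext does not belong to the closed set Y, so that the two parts of
    the index set do not interact locally. *)
Lemma near_ext_in (x y : E) (P : E -> E -> Prop) : Y y ->
  (\forall y' \near y & x' \near x, Y y' -> P x' y') ->
  \forall y' \near y & x' \near x, Ye y' -> P x' y'.
Proof.
move=> Yy [[A C] /= [Ay Cx] AC]; exists (A `&` ~` [set yext], C) => /=.
  split => //; apply: filterI => //; apply: open_nbhs_nbhs; split.
    apply: closed_openC; apply: compact_closed; last exact: compact_set1.
    exact: norm_hausdorff.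
  by move=> e; rewrite e in Yy.
by move=> [y' x'] /= [[Ay' ne] Cx'] [Yy'|//]; apply: (AC (y', x')).
Qed.

Lemma near_ext_out (x : E) (P : E -> E -> Prop) : (\forall x' \near x, P x' yext) ->
  \forall y' \near yext & x' \near x, Ye y' -> P x' y'.
Proof.
move=> Px; exists (~` Y, [set x' | P x' yext]) => /=.
  split => //; apply: open_nbhs_nbhs; split => //; apply: closed_openC.
  by apply: compact_closed => //; exact: norm_hausdorff.
by move=> [y' x'] /= [nY Px'] [//|->].
Qed.

Lemma cost_continuous (x y : E) : OmX x -> OmY y -> forall e, 0 < e ->
  \forall y' \near y & x' \near x, `|cE x' y' - cE x y| < e.
Proof.
move=> Omx Omy e e0; have [df _] := cC1 (conj Omx Omy : (OmX `*` OmY) (x, y)).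
have /cvgrPdist_lt/(_ e e0) := differentiable_continuous df.
move=> [[A C] /= [Ax Cy] AC]; exists (C, A) => //= -[y' x'] /= [Cy' Ax'].
by rewrite distrC; apply: (AC (x', y')).
Qed.

Lemma potential_family_continuous :
  jointly_continuous OmX Y (fun x y => cE x y - psi y).
Proof.
move=> x y Omx Yy e e0; have e20 : 0 < e / 2 by rewrite divr_gt0.
have [[A C] /= [Ay Cx] AC] := cost_continuous Omx (YOm Yy) e20.
have /subspace_continuousP/(_ y Yy)/cvgrPdist_lt/(_ _ e20) := psic.
rewrite near_withinE => psiy.
exists (A `&` [set y' | Y y' -> `|psi y - psi y'| < e / 2], C) => /=.
  by split => //; exact: filterI.
move=> [y' x'] /= [[Ay' py'] Cx'] Yy'.
have := AC (y', x') (conj Ay' Cx') => /= h1; have h2 := py' Yy'.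
rewrite (_ : _ - _ = (cE x' y' - cE x y) + (psi y - psi y')); last by ring.
by rewrite (le_lt_trans (ler_normD _ _))// [e]splitr ltrD.
Qed.

Lemma ext_family_continuous : jointly_continuous OmX Ye ext_family.
Proof.
move=> x y Omx [Yy|->] e e0; last first.
  by apply: near_ext_out; near=> x'; rewrite !ext_family_out subrr normr0.
apply: near_ext_in => //; rewrite ext_family_in//.
have [[A C] AC h] := potential_family_continuous Omx Yy e0.
exists (A, C) => // -[y' x'] z Yy'; rewrite /= ext_family_in//.
exact: h z Yy'.
Unshelve. all: by end_near. Qed.

Let family_inE y : Y y -> ext_family ^~ y = (fun x => cE x y) - cst (psi y).
Proof. by move=> Yy; apply/funext => x; rewrite ext_family_in. Qed.

Let family_outE : ext_family ^~ yext = cst tau.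
Proof. by apply/funext => x; rewrite ext_family_out. Qed.

Lemma cost_differentiable x y : OmX x -> OmY y ->
  differentiable (fun x => cE x y) x.
Proof.
move=> Omx Omy.
by have [] := differentiable_partial cC1 (conj Omx Omy : (OmX `*` OmY) (x, y)).
Qed.

Lemma ext_family_differentiable x y : OmX x -> Ye y ->
  differentiable (ext_family ^~ y) x.
Proof.
move=> Omx [Yy|->]; last by rewrite family_outE; exact: differentiable_cst.
rewrite family_inE//; apply: differentiableB; last exact: differentiable_cst.
exact: cost_differentiable (YOm Yy).
Qed.

Lemma ext_family_derive_in x y v : OmX x -> Y y ->
  'D_v (ext_family ^~ y) x = 'D_v (fun x => cE x y) x.
Proof.
move=> Omx Yy; rewrite family_inE// deriveB.
- by rewrite derive_cst subr0.
- exact: diff_derivable (cost_differentiable Omx (YOm Yy)).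
- exact: derivable_cst.
Qed.

Lemma ext_family_derive_out x v : 'D_v (ext_family ^~ yext) x = 0.
Proof. by rewrite family_outE derive_cst. Qed.

Lemma ext_family_grad_in x y : OmX x -> Y y ->
  grad (ext_family ^~ y) x = grad (cE ^~ y) x.
Proof.
by move=> Omx Yy; apply/rowP => i; rewrite !mxE ext_family_derive_in.
Qed.

Lemma ext_family_grad_out x : grad (ext_family ^~ yext) x = 0.
Proof. by apply/rowP => i; rewrite !mxE ext_family_derive_out. Qed.

(** The two families differ by a term that depends on y only. *)
Lemma ext_c_grad x y : OmX x -> Ye y ->
  grad (ext_c cE yext ^~ y) x = grad (ext_family ^~ y) x.
Proof.
move=> Omx [Yy|->].
  rewrite ext_family_grad_in//; congr (grad _ x); apply/funext => z.
  rewrite /ext_c.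
  by have -> : (y == yext) = false by apply/negbTE/eqP => e; rewrite e in Yy.
rewrite ext_family_grad_out (_ : _ ^~ _ = cst 0).
  by apply/rowP => i; rewrite !mxE derive_cst.
by apply/funext => z; rewrite /ext_c eqxx.
Qed.

(** This makes the constant function indexed by yext distinguishable by its
    gradient from those indexed by Y. *)
Lemma grad_cost_neq0 x y : OmX x -> Y y -> grad (cE ^~ y) x != 0.
Proof.
move=> Omx Yy; have [l l0 h] := twist_grad_ge twist.
apply/eqP => g0; have := h x y Omx Yy; rewrite g0 leNgt => /negP; apply.
rewrite /euclidean_norm big1 ?sqrtr0// => i _.
by rewrite mxE expr0n.
Qed.

Lemma ext_family_twisted : twisted_family OmX Ye ext_family.
Proof.
split => //.
- by apply: compactU => //; exact: compact_set1.
- by exists yext; right.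
- exact: ext_family_continuous.
- exact: ext_family_differentiable.
- move=> i x y Omx [Yy|->] e e0; last first.
    apply: near_ext_out; near=> x'.
    by rewrite !ext_family_derive_out subrr normr0.
  apply: near_ext_in => //.
  have Oxy : (OmX `*` OmY) (x, y) by split => //; exact: YOm.
  have [_ /(_ (delta_mx 0 i, 0))/cvgrPdist_lt/(_ e e0)] := cC1 Oxy.
  move=> [[A C] /= [Ax Cy] AC].
  exists (C, A `&` OmX) => /=.
    by split => //; apply: filterI => //; exact: open_nbhs_nbhs.
  move=> [y' x'] /= [Cy' [Ax' Omx']] Yy'; rewrite !ext_family_derive_in//.
  rewrite !(derive_partial cC1) //; last by split => //; exact: YOm.
  by rewrite distrC; apply: (AC (x', y')).
- move=> x y Omx [Yy|->] e e0; last first.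
    apply: near_ext_out; near=> x'; rewrite subrr normr0.
    by rewrite mulr_ge0// ltW.
  apply: near_ext_in => //.
  have Oxy : (OmX `*` OmY) (x, y) by split => //; exact: YOm.
  have oXY : open (OmX `*` OmY).
    rewrite openE => -[x' y'] [Ox' Oy']; exists (OmX, OmY) => //.
    by split; exact: open_nbhs_nbhs.
  have [[A C] AC h] := C1_increment_uniform cC1 Oxy oXY e0.
  exists (A, C) => // -[y' x'] z Yy'; have := h _ z.
  rewrite /= !ext_family_in// (_ : cE x' y' - cE x y' - _ = cE x' y' - psi y' -
    (cE x y' - psi y') - (cE x' y - psi y - (cE x y - psi y)))//.
  by ring.
- move=> x y y' Omx [Yy|->] [Yy'|->] //.
  + rewrite !ext_family_grad_in//.
    by apply: (twist_injective twist Omx); exact: YOm.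
  + rewrite ext_family_grad_in// ext_family_grad_out => /eqP.
    by rewrite (negbTE (grad_cost_neq0 Omx Yy)).
  + rewrite ext_family_grad_out ext_family_grad_in// => /esym/eqP.
    by rewrite (negbTE (grad_cost_neq0 Omx Yy')).
Unshelve. all: by end_near. Qed.

End extended_family.

(** * Geometry of the cylinder *)

Lemma closed_preimage (T U : topologicalType) (f : T -> U) D :
  continuous f -> closed D -> closed (f @^-1` D).
Proof. by move=> cf cD; apply: preimage_closed cD => x _; exact: cf. Qed.

Section cylinder_geometry.
Variables (R : realType) (m : nat).
Local Notation E := 'rV[R]_(m + 1).
Implicit Types (B : set 'rV[R]_m) (x : E) (s : 'rV[R]_m).
Local Notation lambda := (lebesgue_rV R (m + 1)).

Lemma base_cyl s p : base (cyl_point s p) = s.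
Proof. exact: row_mxKl. Qed.

Lemma height_cyl s (p : R) : height (cyl_point s p) = p.
Proof. by rewrite /height row_mxKr mxE eqxx mulr1n. Qed.

Lemma cyl_base_height x : cyl_point (base x) (height x) = x.
Proof. by rewrite /cyl_point /height -mx11_scalar hsubmxK. Qed.

Lemma heightE x : height x = x 0 (rshift m 0).
Proof. by rewrite /height mxE. Qed.

Definition vertical : E := delta_mx 0 (rshift m 0).

Lemma base_vertical x t : base (x + t *: vertical) = base x.
Proof.
apply/rowP => i; rewrite !mxE eqxx /=.
by rewrite eq_lrshift mulr0 addr0.
Qed.

Lemma height_vertical x t : height (x + t *: vertical) = height x + t.
Proof. by rewrite !heightE !mxE !eqxx mulr1. Qed.

Lemma measurable_base : measurable_fun setT (@base R m).
Proof.
apply/measurable_fun_rVP => i.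
under eq_fun do rewrite mxE.
exact: measurable_coord.
Qed.

Lemma measurable_height : measurable_fun setT (@height R m).
Proof.
rewrite (_ : @height R m = fun x => x 0 (rshift m 0)); first exact: measurable_coord.
by apply/funext => x; rewrite heightE.
Qed.

Lemma continuous_base : continuous (@base R m).
Proof. by have := @continuous_lsubmx R 1 m 1; exact. Qed.

Lemma continuous_height : continuous (@height R m).
Proof.
rewrite (_ : @height R m = fun x => x 0 (rshift m 0)); first exact: coord_continuous.
by apply/funext => x; rewrite heightE.
Qed.

Lemma closed_cylinder B : closed B -> closed (cylinder B).
Proof.
move=> cB; apply: closedI.
  by apply: closed_preimage cB; exact: continuous_base.
apply: (@closed_preimage _ _ (@height R m) [set p : R | 0 <= p]).
  exact: continuous_height.
exact: closed_ge.
Qed.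

Lemma closed_slab B P : closed B -> closed (slab B P).
Proof.
move=> cB; rewrite (_ : slab B P = cylinder B `&` (@height R m @^-1` [set p | p <= P])).
  apply: closedI; first exact: closed_cylinder.
  apply: (@closed_preimage _ _ (@height R m) [set p : R | p <= P]).
    exact: continuous_height.
  exact: closed_le.
by apply/seteqP; split => [x [Bx /andP[? ?]]|x [[Bx h0] hP]]; split => //; apply/andP.
Qed.

Lemma slab_le B P x : slab B P x -> cylinder B x.
Proof. by move=> [? /andP[]]. Qed.

Lemma slab_box B P : compact B -> exists M, forall x, slab B P x ->
  forall i, `|x 0 i| <= M.
Proof.
move=> /compact_bounded[M0 [_ hM]]; pose M := Num.max (M0 + 1) P.
exists M => x [Bx /andP[h0 hP]] i; case: (split_ordP i) => j ->.
  have -> : x 0 (lshift 1 j) = (base x) 0 j by rewrite mxE.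
  apply: (le_trans (coord_le_norm _ _)); apply: (@le_trans _ _ (M0 + 1)).
    by apply: (hM _ _ _ Bx); rewrite ltrDl.
  by rewrite le_max lexx.
rewrite (ord1 j) -heightE ger0_norm// (le_trans hP)//.
by rewrite le_max lexx orbT.
Qed.

Lemma compact_slab B P : compact B -> compact (slab B P).
Proof.
move=> cB; apply: bounded_closed_compact; last first.
  by apply: closed_slab; apply: compact_closed => //; exact: norm_hausdorff.
have [M hM] := slab_box P cB.
exists (Num.max M 0); split; first exact: num_real.
move=> N MN x xs; rewrite /= /Num.norm /= mx_normrE.
apply/bigmax_leP; split; first by rewrite ltW// (le_lt_trans _ MN)// le_max lexx orbT.
move=> [i j] _ /=; rewrite (ord1 i) (le_trans (hM _ xs j))//.
by rewrite ltW// (le_lt_trans _ MN)// le_max lexx.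
Qed.

Lemma bounded_box_fin n (A : set 'rV[R]_n) M : measurable A ->
  (forall x : 'rV[R]_n, A x -> forall i, `|x 0 i| <= M) ->
  (lebesgue_rV R n A < +oo)%E.
Proof.
move=> mA AM; apply: le_lt_trans (lebesgue_rV_box_fin n M).
apply: le_measure; rewrite ?inE//.
exact: measurable_box.
Qed.

Lemma lebesgue_slab_fin B P : compact B -> (lambda (slab B P) < +oo)%E.
Proof.
move=> cB; have [M hM] := slab_box P cB.
apply: bounded_box_fin hM; apply: closed_measurable_mx; apply: closed_slab.
by apply: compact_closed => //; exact: norm_hausdorff.
Qed.

Lemma lebesgue_base_gt0 B : measurable B -> interior B !=set0 ->
  (0 < lebesgue_rV R m B)%E.
Proof.
move=> mB [x]; rewrite /interior /= => /nbhs_ballP[e /= e0 eB].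
apply: (lt_le_trans (lebesgue_rV_ball_gt0 x e0)).
by apply: le_measure; rewrite ?inE//; apply: open_measurable_mx; exact: ball_open.
Qed.

Lemma lebesgue_base_fin B : compact B -> (lebesgue_rV R m B < +oo)%E.
Proof.
move=> cB; have [M [_ hM]] := compact_bounded cB.
apply: (@bounded_box_fin _ _ (M + 1)).
  by apply: closed_measurable_mx; apply: compact_closed => //; exact: norm_hausdorff.
move=> x Bx i; apply: (le_trans (coord_le_norm _ _)).
by apply: (hM _ _ _ Bx); rewrite ltrDl.
Qed.

Lemma lebesgue_graph_null (A : set E) : measurable A ->
  (forall s p p', A (cyl_point s p) -> A (cyl_point s p') -> p = p') ->
  lambda A = 0%E.
Proof.
move=> mA A1; apply: (countable_lines_null mA (i := rshift m 0)) => x.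
have sub t t' : A (x + t *: vertical) -> A (x + t' *: vertical) -> t = t'.
  rewrite -(cyl_base_height (x + t *: _)) -(cyl_base_height (x + t' *: _)).
  rewrite !base_vertical !height_vertical => At At'.
  exact: addrI (A1 _ _ _ At At').
have [[t At]|nA] := pselect (exists t, A (x + t *: vertical)).
  apply: (@sub_countable _ _ _ [set t]); last exact: countable1.
  by apply: subset_card_le => t' At' /=; exact: sub.
rewrite (_ : mkset _ = set0)//; apply/seteqP; split => // t At; apply: nA.
by exists t.
Qed.

Section subgraph.
Variables (B : set 'rV[R]_m) (g : 'rV[R]_m -> R).
Hypothesis mB : measurable B.
Hypothesis mg : measurable_fun B g.

Lemma measurable_comp_base : measurable_fun (@base R m @^-1` B) (g \o @base R m).
Proof.
apply: (measurable_comp mB) => //.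
  by move=> _ [x /= Bx <-].
exact: measurable_funTS measurable_base.
Qed.

Lemma measurable_below_graph :
  measurable (@base R m @^-1` B `&` [set x | height x <= g (base x)]).
Proof.
have mD := measurable_preimage measurable_base mB.
apply: measurable_fun_le => //; first exact: measurable_funTS measurable_height.
exact: measurable_comp_base.
Qed.

Lemma measurable_above_graph :
  measurable (@base R m @^-1` B `&` [set x | g (base x) <= height x]).
Proof.
have mD := measurable_preimage measurable_base mB.
apply: measurable_fun_le => //; last exact: measurable_funTS measurable_height.
exact: measurable_comp_base.
Qed.

Lemma measurable_cylinder : measurable (@cylinder R m B).
Proof.
apply: measurableI; first exact: (measurable_preimage measurable_base mB).
rewrite [X in measurable X](_ : _ = @height R m @^-1` `[0, +oo[%classic).
  exact: measurable_preimage measurable_height _.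
by apply/seteqP; split => x /=; rewrite in_itv/= andbT.
Qed.

Lemma measurable_subgraph : measurable (subgraph B g).
Proof.
rewrite (_ : subgraph B g =
  (@base R m @^-1` B `&` [set x | height x <= g (base x)]) `&` cylinder B).
  by apply: measurableI; [exact: measurable_below_graph|exact: measurable_cylinder].
apply/seteqP; split => x; first by move=> [Bx /andP[h0 hg]].
by move=> [[Bx hg] [_ h0]]; split => //; apply/andP.
Qed.

Lemma lebesgue_subgraph : (forall s, B s -> 0 <= g s) ->
  lambda (subgraph B g) = (\int[lebesgue_rV R m]_(s in B) (g s)%:E)%E.
Proof.
move=> g0; rewrite lebesgue_rV_height; last exact: measurable_subgraph.
rewrite [RHS]integral_mkcond; apply: eq_integral => s _; rewrite patchE.
case: ifPn => [|]; rewrite ?inE ?notin_setE => Bs.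
  rewrite [X in lebesgue_measure X](_ : _ = `[0%R, g s]%classic).
    rewrite lebesgue_measure_itv /= lte_fin oppr0 adde0.
    have := g0 _ Bs; rewrite le_eqVlt => /predU1P[<-|->//].
    by rewrite ltxx.
  by apply/seteqP; split => p /=;
    rewrite /subgraph /= base_cyl height_cyl in_itv/= => // -[].
rewrite [X in lebesgue_measure X](_ : _ = set0) ?measure0//.
by apply/seteqP; split => // p [/=]; rewrite base_cyl.
Qed.

End subgraph.

End cylinder_geometry.

(** * Transforms on the cylinder and their sublevel sets *)

Lemma measure_eq_off_null d (X : measurableType d) (R : realType)
    (mu : {measure set X -> \bar R}) (A D N : set X) :
  measurable A -> measurable D -> measurable N -> mu N = 0%E ->
  (forall x, ~ N x -> A x <-> D x) -> mu A = mu D.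
Proof.
move=> mA mD mN N0 AD.
have le (A' D' : set X) : measurable A' -> measurable D' ->
    (forall x, ~ N x -> A' x -> D' x) -> (mu A' <= mu D')%E.
  move=> mA' mD' A'D'; rewrite -[leRHS]adde0 -N0.
  apply: le_trans (measureU2 mu mD' mN).
  apply: le_measure; rewrite ?inE//; first exact: measurableU.
  by move=> x A'x; have [Nx|nNx] := pselect (N x); [right|left; exact: A'D'].
by apply/eqP; rewrite eq_le !le// => x /AD[].
Qed.

Section potential_on_cylinder.
Variables (R : realType) (m : nat).
Local Notation E := 'rV[R]_(m + 1).
Variables (B : set 'rV[R]_m) (Y : set E) (c cE : E -> E -> R) (OmX OmY : set E).
Hypothesis Bc : compact B.
Hypothesis Bi : interior B !=set0.
Hypothesis Yc : compact Y.
Hypothesis Y0 : Y !=set0.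
Hypothesis hc : cost_assumptions B Y c.
Hypothesis twist : extended_twist B Y c OmX OmY cE.
Local Notation lambda := (lebesgue_rV R (m + 1)).

Let oX := twist_openX twist.
Let XOm := twist_subX twist.
Let YOm := twist_subY twist.

Lemma base_closed : closed B.
Proof. by apply: compact_closed => //; exact: norm_hausdorff. Qed.

Lemma base_measurable : measurable B.
Proof. exact: closed_measurable_mx base_closed. Qed.

Lemma measurable_slab H : measurable (@slab R m B H).
Proof. by apply: closed_measurable_mx; apply: closed_slab; exact: base_closed. Qed.

Lemma target_closed : closed Y.
Proof. by apply: compact_closed => //; exact: norm_hausdorff. Qed.

Lemma cyl_in s p : B s -> 0 <= p -> cylinder B (cyl_point s p).
Proof. by move=> Bs p0; split; rewrite ?base_cyl ?height_cyl. Qed.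

Lemma cyl_Om s p : B s -> 0 <= p -> OmX (cyl_point s p).
Proof. by move=> Bs p0; apply: XOm; exact: cyl_in. Qed.

Lemma cE_increasing s y p p' : B s -> Y y -> 0 <= p -> p < p' ->
  cE (cyl_point s p) y < cE (cyl_point s p') y.
Proof.
move=> Bs Yy p0 pp'; have p'0 : 0 <= p' by rewrite ltW// (le_lt_trans p0).
rewrite !(twist_extends twist)//; try exact: cyl_in.
exact: (cost_increasing hc).
Qed.

Lemma cE_nondecreasing s y p p' : B s -> Y y -> 0 <= p -> p <= p' ->
  cE (cyl_point s p) y <= cE (cyl_point s p') y.
Proof.
move=> Bs Yy p0; rewrite le_eqVlt => /predU1P[->//|pp'].
by rewrite ltW// cE_increasing.
Qed.

Lemma cyl_point_continuous (p : R) : continuous (fun s : 'rV[R]_m => cyl_point s p).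
Proof.
move=> s A /nbhs_ballP[e /= e0 eA]; apply/nbhs_ballP; exists e => // s' [_ ss'].
apply: eA; split => // i j; rewrite (ord1 i); case: (split_ordP j) => k ->.
  by rewrite !cyl_point_lshift; exact: ss'.
by rewrite !cyl_point_rshift; exact: ballxx.
Qed.

Lemma cyl_point_vertical_continuous (s : 'rV[R]_m) : continuous (fun p : R => cyl_point s p).
Proof.
move=> p A /nbhs_ballP[e /= e0 eA]; apply/nbhs_ballP; exists e => // p' pp'.
apply: eA; split => // i j; rewrite (ord1 i); case: (split_ordP j) => k ->.
  by rewrite !cyl_point_lshift; exact: ballxx.
by rewrite !cyl_point_rshift.
Qed.

(** For each (s, y) some height p works by unboundedness, and it still works for
    nearby (s, y) by continuity; monotonicity extends it to greater heights, and
    compactness of B and Y makes it uniform. *)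
Lemma cost_proper M : exists2 H, 0 <= H & forall s y p, B s -> Y y -> H <= p ->
  M < cE (cyl_point s p) y.
Proof.
have : \forall p \near +oo, B `*` Y `<=` [set z | 0 <= p ->
    M < cE (cyl_point z.1 p) z.2].
  have cBY : compact (B `*` Y) by exact: compact_setX.
  have /compact_near_coveringP/near_covering_withinP := cBY.
  apply => -[s y] [/= Bs Yy].
  have [p0 p00 Mp0] := cost_unbounded hc Bs Yy M.
  have {}Mp0 : M < cE (cyl_point s p0) y.
    by rewrite (twist_extends twist)//; exact: cyl_in.
  have e0 : 0 < cE (cyl_point s p0) y - M by rewrite subr_gt0.
  have [[A C] /= [Ay Cx] AC] :=
    cost_continuous twist (cyl_Om Bs p00) (YOm Yy) e0.
  have Cs := @cyl_point_continuous p0 s _ Cx.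
  exists ([set s' | C (cyl_point s' p0)] `*` A, [set p | p0 <= p]) => /=.
    split; last exact: nbhs_pinfty_ge (num_real _).
    by exists ([set s' | C (cyl_point s' p0)], A).
  move=> [[s' y'] p] /= [[Cs' Ay'] p0p] [Bs' Yy'] p_ge0.
  apply: lt_le_trans (cE_nondecreasing Bs' Yy' p00 p0p).
  have := AC (y', cyl_point s' p0) (conj Ay' Cs').
  by rewrite /= ltr_distl subKr => /andP[].
move=> [H [_ hH]]; exists (Num.max (H + 1) 0); first by rewrite le_max lexx orbT.
move=> s y p Bs Yy; rewrite ge_max => /andP[Hp p0].
by apply: (hH p _ (s, y)) => //; rewrite (lt_le_trans _ Hp)// ltrDl.
Qed.

Section potential.
Variable psi : E -> R.
Hypothesis psic : {within Y, continuous psi}.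

(** The c-transform is taken with the extension cE, so that it is defined and
    continuous on the whole open set OmX. *)
Definition potential : E -> R := ctransform Y cE psi.

Let fam := potential_family_continuous twist psic.

Lemma potential_exists x : OmX x -> exists2 y, Y y & potential x = cE x y - psi y.
Proof.
move=> Omx; have [y yx] := argmin_exists Yc Y0 fam Omx.
by exists y; [case: yx|exact: (envelope_eq yx)].
Qed.

Lemma potential_le x y : OmX x -> Y y -> potential x <= cE x y - psi y.
Proof. exact: (envelope_le Yc Y0 fam). Qed.

Lemma potential_continuous x : OmX x -> {for x, continuous potential}.
Proof. exact: (continuous_envelope oX Yc Y0 fam). Qed.

Lemma ctransform_potential x : cylinder B x -> ctransform Y c psi x = potential x.
Proof.
move=> Bx; rewrite /potential /ctransform; congr inf; apply/seteqP; split.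
  by move=> _ [y Yy <-]; exists y => //; rewrite (twist_extends twist).
by move=> _ [y Yy <-]; exists y => //; rewrite (twist_extends twist).
Qed.

Lemma potential_increasing s p p' : B s -> 0 <= p -> p < p' ->
  potential (cyl_point s p) < potential (cyl_point s p').
Proof.
move=> Bs p0 pp'; have p'0 : 0 <= p' by rewrite ltW// (le_lt_trans p0).
have [y Yy ->] := potential_exists (cyl_Om Bs p'0).
apply: (le_lt_trans (potential_le (cyl_Om Bs p0) Yy)).
by rewrite ltrD2r cE_increasing.
Qed.

Lemma psi_bounded : exists2 K, 0 <= K & forall y, Y y -> `|psi y| <= K.
Proof.
have [M [_ hM]] := compact_bounded (continuous_compact psic Yc).
exists (Num.max (M + 1) 0); first by rewrite le_max lexx orbT.
move=> y Yy; rewrite le_max; apply/orP; left.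
by apply: (hM (M + 1)); rewrite ?ltrDl//; exists y.
Qed.

Lemma potential_proper tau : exists2 H, 0 <= H & forall x, cylinder B x ->
  potential x <= tau -> height x <= H.
Proof.
have [K K0 hK] := psi_bounded; have [H H0 hH] := cost_proper (tau + K).
exists H => // x [Bx h0] fx; rewrite leNgt; apply/negP => Hx.
have [y Yy fE] := potential_exists (XOm (conj Bx h0)).
have := hH _ _ _ Bx Yy (ltW Hx); rewrite cyl_base_height.
by have := hK y Yy; rewrite ler_norml => /andP[_]; move: fx; rewrite fE; lra.
Qed.

Lemma potential_ge K : (forall y, Y y -> psi y <= K) -> forall x, cylinder B x ->
  - K <= potential x.
Proof.
move=> hK x Bx; have [y Yy ->] := potential_exists (XOm Bx).
rewrite (twist_extends twist)//; have := cost_ge0 hc Bx Yy; have := hK y Yy.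
lra.
Qed.

Lemma potential_within A : A `<=` OmX -> {within A, continuous potential}.
Proof.
move=> AOm; apply: continuous_in_subspaceT => x; rewrite inE => Ax.
exact: (potential_continuous (AOm _ Ax)).
Qed.

Lemma measurable_potential : measurable_fun (cylinder B) potential.
Proof.
apply: within_continuous_measurable_rV; last exact: potential_within.
exact: (measurable_cylinder base_measurable).
Qed.

Definition sublevel tau := cylinder B `&` [set x | potential x <= tau].

Lemma measurable_sublevel tau : measurable (sublevel tau).
Proof.
apply: measurable_fun_le => //; last exact: measurable_potential.
exact: (measurable_cylinder base_measurable).
Qed.

Lemma sublevel_slab tau : exists2 H, 0 <= H & sublevel tau `<=` slab B H.
Proof.
have [H H0 hH] := potential_proper tau; exists H => // x [[Bx h0] fx].
by split => //; apply/andP; split => //; exact: hH.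
Qed.

Lemma sublevel_fin tau : (lambda (sublevel tau) < +oo)%E.
Proof.
have [H H0 sH] := sublevel_slab tau.
apply: le_lt_trans (lebesgue_slab_fin H Bc); apply: le_measure => //; rewrite inE.
  exact: measurable_sublevel.
exact: measurable_slab.
Qed.

Lemma level_set_measurable tau : measurable (cylinder B `&` [set x | potential x = tau]).
Proof.
rewrite (_ : _ `&` _ = cylinder B `&` potential @^-1` [set tau])//.
apply: measurable_potential => //.
exact: (measurable_cylinder base_measurable).
Qed.

(** The c-transform is strictly increasing along vertical lines. *)
Lemma level_set_null tau : lambda (cylinder B `&` [set x | potential x = tau]) = 0%E.
Proof.
apply: lebesgue_graph_null; first exact: level_set_measurable.
move=> s p p' /= [[]]; rewrite base_cyl height_cyl => Bs p0 fp.
move=> [[]]; rewrite base_cyl height_cyl => _ p'0 fp'.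
have [pp'|pp'|//] := ltgtP p p'.
  by have := potential_increasing Bs p0 pp'; rewrite fp fp' ltxx.
by have := potential_increasing Bs p'0 pp'; rewrite fp fp' ltxx.
Qed.

Lemma bottom_null : lambda (cylinder B `&` [set x | height x = 0]) = 0%E.
Proof.
apply: lebesgue_graph_null.
  apply: measurableI; first exact: (measurable_cylinder base_measurable).
  exact: (measurable_preimage (@measurable_height R m) (measurable_set1 0)).
by move=> s p p' [_ /=]; rewrite height_cyl => -> [_ /=]; rewrite height_cyl => ->.
Qed.

Lemma lebesgue_slab H : 0 <= H ->
  lambda (slab B H) = (H%:E * lebesgue_rV R m B)%E.
Proof.
move=> H0; rewrite -[LHS]/(lambda (subgraph B (cst H))).
rewrite lebesgue_subgraph//; last exact: base_measurable.
transitivity (\int[lebesgue_rV R m]_(s in B) cst H%:E s)%E => //.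
by rewrite integral_cst//; exact: base_measurable.
Qed.

Lemma strict_sublevelE tau : cylinder B `&` [set x | potential x < tau] =
  \bigcup_k sublevel (tau - k.+1%:R^-1).
Proof.
apply/seteqP; split => [x [Bx /= fx]|x [k _ [Bx /= fx]]]; last first.
  split => //=; apply: (le_lt_trans fx); rewrite ltrBlDr ltrDl.
  by rewrite invr_gt0.
have e0 : 0 < tau - potential x by rewrite subr_gt0.
have [k _ /(_ k (leqnn k)) /= ke] := near_infty_natSinv_lt (PosNum e0).
by exists k => //; split => //=; rewrite lerBrDr -lerBrDl ltW.
Qed.

Lemma sublevelE tau : sublevel tau = \bigcap_k sublevel (tau + k.+1%:R^-1).
Proof.
apply/seteqP; split => [x [Bx /= fx] k _|x h].
  by split => //=; rewrite (le_trans fx)// lerDl.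
have [Bx _] := h 0%N I; split => //=; apply/ler_addgt0Pr => e e0.
have [k _ /(_ k (leqnn k)) /= ke] := near_infty_natSinv_lt (PosNum e0).
by have [_ /= fx] := h k I; rewrite (le_trans fx)// lerD2l ltW.
Qed.

(** The mass of the sublevel sets is finite, non-decreasing and, since level sets
    are null, continuous in tau.  It vanishes for very negative tau and exceeds 1 for
    large tau, when the sublevel set contains a slab of mass 2. *)
Lemma sublevel_unit : exists tau, lambda (sublevel tau) = 1%E.
Proof.
pose S := [set tau | lambda (sublevel tau) <= 1]%E.
have le_sub t t' : t <= t' -> sublevel t `<=` sublevel t'.
  by move=> tt' x [Bx /= fx]; split => //=; exact: le_trans tt'.
have le_lam t t' : t <= t' -> (lambda (sublevel t) <= lambda (sublevel t'))%E.
  by move=> tt'; apply: le_measure; rewrite ?inE; [exact: measurable_sublevel..|exact: le_sub].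
have [K K0 hK] := psi_bounded.
have S0 : S (- K - 1).
  rewrite /S /= (_ : sublevel _ = set0) ?measure0//.
  apply/seteqP; split => // x [Bx /= fx].
  have := potential_ge (fun y Yy => le_trans (ler_norm _) (hK y Yy)) Bx; lra.
have [M SM] : exists M, ~ S M.
  have Bgt0 := lebesgue_base_gt0 base_measurable Bi.
  pose b := fine (lebesgue_rV R m B).
  have bE : lebesgue_rV R m B = b%:E.
    by rewrite fineK// ge0_fin_numE ?measure_ge0//; exact: lebesgue_base_fin.
  have b0 : 0 < b by rewrite -lte_fin -bE.
  (* The height for which the slab has mass 2. *)
  pose H := 2 / b; have H0 : 0 <= H by rewrite /H divr_ge0// ltW.
  have sOm : slab B H `<=` OmX by move=> x /slab_le; exact: XOm.
  have [M [_ hM]] := compact_bounded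
    (continuous_compact (potential_within sOm) (compact_slab (P := H) Bc)).
  exists (M + 1) => /=; apply/negP; rewrite -ltNge.
  apply: (@lt_le_trans _ _ (lambda (slab B H))).
    by rewrite lebesgue_slab// bE -EFinM lte_fin /H divfK ?gt_eqF// ltr1n.
  apply: le_measure; rewrite ?inE.
  - exact: measurable_slab.
  - exact: measurable_sublevel.
  move=> x xs; split; first exact: slab_le xs.
  apply: (le_trans (ler_norm _)); apply: (hM (M + 1)); first by rewrite ltrDl.
  by exists x.
have ubS : has_ubound S.
  exists M => t St; rewrite leNgt; apply/negP => Mt; apply: SM.
  by apply: (le_trans (le_lam _ _ (ltW Mt))).
have hsS : has_sup S by split => //; exists (- K - 1).
pose t := sup S; exists t; apply/eqP; rewrite eq_le; apply/andP; split.
  rewrite (_ : sublevel t = (cylinder B `&` [set x | potential x < t]) `|`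
    (cylinder B `&` [set x | potential x = t])); last first.
    apply/seteqP; split => [x [Bx /=]|x [[Bx /= fx]|[Bx /= fx]]]; last 2 first.
    - by split => //=; exact: ltW.
    - by split => //=; rewrite fx.
    by rewrite le_eqVlt => /predU1P[fx|fx]; [right|left].
  have mst : measurable (cylinder B `&` [set x | potential x < t]).
    rewrite strict_sublevelE; apply: bigcup_measurable => k _.
    exact: measurable_sublevel.
  apply: (le_trans (measureU2 _ _ _)) => //; first exact: level_set_measurable.
  rewrite [X in (_ + X <= _)%E]level_set_null adde0 strict_sublevelE.
  pose F k := sublevel (t - k.+1%:R^-1).
  have ndF : {homo F : i j / (i <= j)%N >-> (i <= j)%O}.
    move=> i j ij; apply/subsetPset; apply: le_sub.
    by rewrite lerD2l lerN2 lef_pV2 ?posrE// ler_nat.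
  have cvgF := @nondecreasing_cvg_mu _ _ _ lambda F
    (fun k => measurable_sublevel _) (bigcup_measurable (fun k _ =>
      measurable_sublevel _)) ndF.
  apply: (cvge_to_le cvgF); near=> k => /=.
  have e0 : 0 < k.+1%:R^-1 :> R by rewrite invr_gt0.
  have [t' St' tt'] := sup_adherent e0 hsS.
  exact: le_trans (le_lam _ _ (ltW tt')) St'.
rewrite sublevelE.
pose F k := sublevel (t + k.+1%:R^-1).
have niF : {homo F : i j / (i <= j)%N >-> (j <= i)%O}.
  move=> i j ij; apply/subsetPset; apply: le_sub.
  by rewrite lerD2l lef_pV2 ?posrE// ler_nat.
have cvgF := @nonincreasing_cvg_mu _ _ _ lambda F (sublevel_fin _)
  (fun k => measurable_sublevel _) (bigcap_measurable (ex_intro _ 0%N I)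
    (fun k _ => measurable_sublevel _)) niF.
apply: (cvge_to_ge cvgF); near=> k => /=.
rewrite leNgt; apply/negP => /ltW St.
have := ub_le_sup ubS St; rewrite -/t; apply/negP; rewrite -ltNge.
by rewrite ltrDl invr_gt0.
Unshelve. all: by end_near. Qed.

Lemma potential_vertical_continuous s p : B s -> 0 <= p ->
  {for p, continuous (fun p => potential (cyl_point s p))}.
Proof.
move=> Bs p0; apply: (@continuous_comp _ _ _ (fun p => cyl_point s p) potential).
  exact: cyl_point_vertical_continuous.
exact: potential_continuous (cyl_Om Bs p0).
Qed.

Lemma qfunP s y sigma : B s -> Y y -> cE (cyl_point s 0) y <= sigma ->
  0 <= qfun c s y sigma /\ cE (cyl_point s (qfun c s y sigma)) y = sigma.
Proof.
move=> Bs Yy le0; have cle0 : c (cyl_point s 0) y <= sigma.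
  by rewrite -(twist_extends twist)//; exact: cyl_in.
have ex : exists p, 0 <= p /\ c (cyl_point s p) y = sigma.
  have [H H0 hH] := cost_proper sigma.
  have [p pH pE] : exists2 p, p \in `[0, H]%R & cE (cyl_point s p) y = sigma.
    apply: IVT => //; last first.
      by rewrite ge_min le0 /= le_max (ltW (hH _ _ _ Bs Yy (lexx _))) orbT.
    apply: continuous_in_subspaceT => p; rewrite inE /= in_itv/= => /andP[p0 _].
    apply: (@continuous_comp _ _ _ (fun p => cyl_point s p) (fun x => cE x y)).
      exact: cyl_point_vertical_continuous.
    apply: differentiable_continuous.
    exact: (cost_differentiable twist (cyl_Om Bs p0) (YOm Yy)).
  have p0 : 0 <= p by move: pH; rewrite in_itv/= => /andP[].
  by exists p; split => //; rewrite -(twist_extends twist)//; exact: cyl_in.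
have [q0 qE] := getPex ex; rewrite /qfun cle0; split => //.
by rewrite (twist_extends twist)//; exact: cyl_in.
Qed.

Lemma qfun_ge0 s y sigma : B s -> Y y -> 0 <= qfun c s y sigma.
Proof.
move=> Bs Yy; have [le0|lt0] := leP (cE (cyl_point s 0) y) sigma.
  by have [] := qfunP Bs Yy le0.
rewrite /qfun -(twist_extends twist)//; last exact: cyl_in.
by rewrite [cE _ _ <= _]leNgt lt0.
Qed.

Lemma qfun_geE s y sigma p : B s -> Y y -> 0 < p ->
  (p <= qfun c s y sigma) = (cE (cyl_point s p) y <= sigma).
Proof.
move=> Bs Yy p0; have [le0|lt0] := leP (cE (cyl_point s 0) y) sigma.
  have [q0 qE] := qfunP Bs Yy le0; rewrite -[in RHS]qE.
  apply/idP/idP => [pq|]; first by rewrite cE_nondecreasing// ltW.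
  by rewrite !leNgt; apply: contra => qp; exact: cE_increasing.
rewrite {1}/qfun -(twist_extends twist)//; last exact: cyl_in.
rewrite [cE _ _ <= sigma]leNgt lt0 /= leNgt p0; apply/esym/negbTE; rewrite -ltNge.
by apply: (lt_trans lt0); exact: cE_increasing.
Qed.

Section level_profile.
Variable tau : R.
Local Notation lp := (level_profile Y c psi tau).

Lemma level_profile_has_sup s : B s ->
  has_sup [set qfun c s y (psi y + tau) | y in Y].
Proof.
move=> Bs; have [y Yy] := Y0; split; first by exists (qfun c s y (psi y + tau)), y.
have [H H0 hH] := potential_proper tau; exists H => _ [z Yz <-].
have [q0|q0] := leP (qfun c s z (psi z + tau)) 0; first exact: (le_trans q0).
have := lexx (qfun c s z (psi z + tau)); rewrite qfun_geE// => le.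
rewrite -[leLHS](height_cyl s); apply: hH; first by apply: cyl_in => //; exact: ltW.
apply: (le_trans (potential_le (cyl_Om Bs (ltW q0)) Yz)).
by rewrite lerBlDl.
Qed.

(** A supremum of inverses is an inverse of the infimum: p lies below one of the
    numbers q(s, y, psi y + tau) when c((s, p), y) - psi y <= tau for some y.
    As the profile is defined by a supremum, the direct implication is proved
    with a slightly smaller height p - d. *)
Lemma level_profile_geE s p : B s -> 0 < p ->
  (p <= lp s) = (potential (cyl_point s p) <= tau).
Proof.
move=> Bs p0; apply/idP/idP => [|fp]; last first.
  have [y Yy fE] := potential_exists (cyl_Om Bs (ltW p0)).
  apply: (@le_trans _ _ (qfun c s y (psi y + tau))).
    by rewrite qfun_geE// -lerBlDl -fE.
  by apply: sup_upper_bound; [exact: level_profile_has_sup|exists y].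
rewrite [_ <= tau]leNgt [p <= _]leNgt; apply: contra => fp.
have /nbhs_ballP[e /= e0 he] : \forall p' \near p, tau < potential (cyl_point s p').
  exact: (cvgr_gt _ (potential_vertical_continuous Bs (ltW p0))).
pose d := Num.min e p / 2.
have [d0 de dp] : [/\ 0 < d, d < e & d < p].
  have m0 : 0 < Num.min e p by rewrite lt_min e0.
  have dm : d < Num.min e p by rewrite /d; lra.
  by move: dm; rewrite lt_min => /andP[-> ->]; rewrite divr_gt0.
have fpd : tau < potential (cyl_point s (p - d)).
  by apply: he; rewrite /ball /= opprB subrKC gtr0_norm.
have pd0 : 0 < p - d by rewrite subr_gt0.
apply: (@le_lt_trans _ _ (p - d)); last by rewrite gtrBl.
apply: ge_sup; first by have [] := level_profile_has_sup Bs.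
move=> _ [y Yy <-]; rewrite leNgt; apply/negP => /ltW.
rewrite qfun_geE// => le; move: fpd; rewrite ltNge => /negP; apply.
apply: (le_trans (potential_le (cyl_Om Bs (ltW pd0)) Yy)).
by rewrite lerBlDl.
Qed.

Lemma level_profile_ge0 s : B s -> 0 <= lp s.
Proof.
move=> Bs; have [y Yy] := Y0; apply: (le_trans (qfun_ge0 (psi y + tau) Bs Yy)).
by apply: sup_upper_bound; [exact: level_profile_has_sup|exists y].
Qed.

Lemma measurable_level_profile : measurable_fun B lp.
Proof.
move=> mB; apply: (measurability _ (@RGenCInfty.measurableE R)) => //.
move=> _ [_ [a ->] <-].
have [a0|a0] := leP a 0.
  rewrite (_ : _ `&` _ = B); first exact: base_measurable.
  apply/seteqP; split => [s []//|s Bs]; split => //=.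
  by rewrite in_itv/= andbT (le_trans a0)// level_profile_ge0.
rewrite (_ : _ `&` _ = (fun s => cyl_point s a) @^-1` sublevel tau).
  apply: measurable_preimage; last exact: measurable_sublevel.
  exact: (measurable_fun_pair1 a (@measurable_cyl_point R m)).
apply/seteqP; split => s /=; rewrite in_itv/= andbT.
  by move=> [Bs]; rewrite level_profile_geE// => fs; split => //; exact: cyl_in (ltW a0).
move=> [[]]; rewrite base_cyl height_cyl => Bs _ fs.
by split => //; rewrite level_profile_geE.
Qed.

Lemma subgraph_level_profile x : 0 < height x ->
  subgraph B lp x <-> sublevel tau x.
Proof.
move=> h0; split=> [[Bx /andP[_]]|[[Bx _] /= fx]].
  rewrite level_profile_geE// cyl_base_height => fx.
  by split => //; split => //; exact: ltW.
split => //; rewrite (ltW h0) /= level_profile_geE//.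
by rewrite cyl_base_height.
Qed.

(** The two sets agree at positive heights.  The bottom of the cylinder, all of
    which belongs to the subgraph, is null. *)
Lemma lebesgue_subgraph_level A : measurable A ->
  lambda (A `&` subgraph B lp) = lambda (A `&` sublevel tau).
Proof.
move=> mA; have mlp := measurable_level_profile.
have mS := measurable_subgraph base_measurable mlp.
have msl := measurable_sublevel tau.
pose Z := cylinder B `&` [set x : E | height x = 0].
have mZ : measurable Z.
  apply: measurableI; first exact: (measurable_cylinder base_measurable).
  exact: (measurable_preimage (@measurable_height R m) (measurable_set1 0)).
apply: (measure_eq_off_null _ _ mZ); [exact: measurableI|exact: measurableI|
  exact: bottom_null|].
move=> x nZ; split=> -[Ax Dx]; split => //.
  have Bx : cylinder B x by case: Dx => Bx /andP[h0 _].
  apply/subgraph_level_profile => //; rewrite lt_neqAle Bx.2 andbT.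
  by apply/eqP => h0; apply: nZ.
have Bx : cylinder B x by case: Dx.
apply/subgraph_level_profile => //; rewrite lt_neqAle Bx.2 andbT.
by apply/eqP => h0; apply: nZ.
Qed.

Lemma is_density_level_profile :
  is_density B lp <-> lambda (sublevel tau) = 1%E.
Proof.
have <- : lambda (subgraph B lp) = lambda (sublevel tau).
  by rewrite -[LHS](congr1 lambda (setTI _)) lebesgue_subgraph_level// setTI.
rewrite lebesgue_subgraph; last 3 first.
- exact: base_measurable.
- exact: measurable_level_profile.
- exact: level_profile_ge0.
split=> [[]//|h]; split => //; first exact: measurable_level_profile.
exact: level_profile_ge0.
Qed.

End level_profile.

(** The value [get] picks is characterised through the existence of some tau for
    which the profile is a density. *)
Lemma tau_ofP : is_density B (pbar_of B Y c psi) /\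
  lambda (sublevel (tau_of B Y c psi)) = 1%E.
Proof.
have [t t1] := sublevel_unit.
have ex : exists t, is_density B (level_profile Y c psi t).
  by exists t; apply/is_density_level_profile.
have d := getPex ex; split => //.
by apply/is_density_level_profile; exact: d.
Qed.

End potential.

End potential_on_cylinder.

(** * The bathtub identity *)

Lemma add_max_opp (R : realDomainType) (a K : R) :
  a + K + Num.max (- a) 0 = Num.max a 0 + K.
Proof.
have /orP[a0|a0] := le_total a 0.
  by rewrite max_l ?oppr_ge0// max_r//; ring.
by rewrite max_r ?oppr_le0// max_l//; ring.
Qed.

Section integral_lemmas.
Context d (X : measurableType d) (R : realType).
Variable mu : {measure set X -> \bar R}.
Local Open Scope ereal_scope.

Lemma ge0_integral_mrestr D (mD : measurable D) A (f : X -> \bar R) :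
  measurable A -> measurable_fun A f -> (forall x, A x -> 0 <= f x) ->
  \int[mrestr mu mD]_(x in A) f x = \int[mu]_(x in A `&` D) f x.
Proof.
move=> mA mf f0.
rewrite (@ge0_negligible_integral _ _ _ _ A (~` D))//; last 2 first.
- exact: measurableC.
- by rewrite /= /mrestr setICl measure0.
rewrite setDE setCK; apply: eq_measure_integral => U mU UAD.
by rewrite /= /mrestr setIidl//; apply: (subset_trans UAD); exact: subIsetr.
Qed.

Lemma integral_mrestr D (mD : measurable D) A (f : X -> \bar R) :
  measurable A -> measurable_fun A f ->
  \int[mrestr mu mD]_(x in A) f x = \int[mu]_(x in A `&` D) f x.
Proof.
move=> mA mf; rewrite [LHS]integralE [RHS]integralE !ge0_integral_mrestr//.
- exact: measurable_funeneg.
- exact: measurable_funepos.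
Qed.

Lemma integral_shift (K : R) D (f : X -> R) : measurable D -> mu D < +oo ->
  measurable_fun D f -> (0 <= K)%R -> (forall x, D x -> - K <= f x)%R ->
  \int[mu]_(x in D) (f x)%:E = \int[mu]_(x in D) (f x + K)%:E - K%:E * mu D.
Proof.
move=> mD Doo mf K0 Kf; rewrite integralE.
set P := \int[mu]_(x in D) _^\+ _; set N := \int[mu]_(x in D) _^\- _.
have mfE : measurable_fun D (fun x => (f x)%:E) by exact/measurable_EFinP.
have mfK : measurable_fun D (fun x => (f x + K)%:E).
  by apply/measurable_EFinP; apply: measurable_funD.
have KD : K%:E * mu D \is a fin_num.
  by rewrite fin_numM// ge0_fin_numE.
have Nfin : N \is a fin_num.
  rewrite ge0_fin_numE ?integral_ge0//.
  apply: (@le_lt_trans _ _ (K%:E * mu D)); last by rewrite -ge0_fin_numE// mule_ge0.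
  rewrite -(integral_cst mu mD); apply: ge0_le_integral => //.
  - exact: measurable_funeneg.
  - move=> x Dx; rewrite funenegE -EFinN -EFin_max lee_fin ge_max K0 andbT.
    by rewrite lerNl; exact: Kf.
have : \int[mu]_(x in D) (f x + K)%:E + N = P + K%:E * mu D.
  rewrite -(integral_cst mu mD) -!ge0_integralD//.
  - apply: eq_integral => x _; rewrite funenegE funeposE -EFinN -!EFin_max.
    by rewrite -!EFinD /= add_max_opp.
  - exact: measurable_funepos.
  - by move=> x Dx; rewrite lee_fin; have := Kf x Dx; lra.
  - exact: measurable_funeneg.
clearbody P N => /(congr1 (fun z => z - N - K%:E * mu D)).
by rewrite addeK// => ->; rewrite [RHS]addeAC addeK.
Qed.

Lemma integral_splitD C D (f : X -> \bar R) : measurable C -> measurable D ->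
  D `<=` C -> measurable_fun C f ->
  \int[mu]_(x in C) f x = \int[mu]_(x in D) f x + \int[mu]_(x in C `\` D) f x.
Proof.
move=> mC mD DC mf; rewrite -integral_setU//.
- by rewrite setDUK.
- exact: measurableD.
- by rewrite setDUK.
- by apply/disj_setPS => x [Dx [_ nDx]].
Qed.

(** Pointwise, g = tau + (g - tau)^+ - (tau - g)^+, and D has mass 1.  Thus the
    integral of g over D exceeds tau - \int_C (tau - g)^+ by the two integrals
    on the right, which vanish when D is the sublevel set of g at the level tau.
    The shift by K keeps every integrand non-negative. *)
Lemma bathtub (tau K : R) C D (g : X -> R) : measurable C -> measurable D ->
  D `<=` C -> mu D = 1 -> measurable_fun C g -> (0 <= tau + K)%R ->
  (forall x, C x -> - K <= g x)%R ->
  \int[mu]_(x in D) (g x + K)%:E + \int[mu]_(x in C) (Num.max (tau - g x) 0)%:E =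
  (tau + K)%:E + (\int[mu]_(x in D) (Num.max (g x - tau) 0)%:E +
                  \int[mu]_(x in C `\` D) (Num.max (tau - g x) 0)%:E).
Proof.
move=> mC mD DC D1 mg tK Kg.
have mgD : measurable_fun D g by exact: measurable_funS mg.
have mpos (A : set X) : measurable A -> A `<=` C ->
    measurable_fun A (fun x => (Num.max (tau - g x) 0)%:E).
  move=> mA AC; apply/measurable_EFinP; apply: measurable_maxr => //.
  by apply: measurable_funB => //; exact: measurable_funS mg.
rewrite (integral_splitD mC mD DC (mpos _ mC _))//.
rewrite addeA [RHS]addeA; congr (_ + _).
rewrite -ge0_integralD//.
- rewrite -[(tau + K)%:E]mule1 -D1 -(integral_cst mu mD) -ge0_integralD//.
  + apply: eq_integral => x _; rewrite -!EFinD; congr EFin.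
    rewrite -[(tau - g x)%R]opprB /=.
    have := add_max_opp (g x - tau)%R (tau + K)%R.
    set a := Num.max _ 0%R; set b := Num.max _ 0%R; lra.
  + by move=> x _; rewrite lee_fin le_max lexx orbT.
  + apply/measurable_EFinP; apply: measurable_maxr => //.
    exact: measurable_funB.
- by move=> x Dx; rewrite lee_fin; have := Kg x (DC x Dx); lra.
- by apply/measurable_EFinP; exact: measurable_funD.
- by move=> x _; rewrite lee_fin le_max lexx orbT.
- exact: mpos.
Qed.

End integral_lemmas.

(** * First-order optimality of the dual maximiser *)

Lemma measureU_null d (X : measurableType d) (R : realType)
    (mu : {measure set X -> \bar R}) (A D : set X) :
  measurable A -> measurable D -> mu A = 0%E -> mu D = 0%E -> mu (A `|` D) = 0%E.
Proof.
move=> mA mD A0 D0; apply/eqP; rewrite eq_le measure_ge0 andbT.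
apply: (le_trans (measureU2 mu mA mD)).
by rewrite [X in (X + _ <= _)%E]A0 [X in (_ + X <= _)%E]D0 adde0.
Qed.

Section first_order_condition.
Variables (R : realType) (m : nat).
Local Notation E := 'rV[R]_(m + 1).
Variables (B : set 'rV[R]_m) (Y : set E) (c cE : E -> E -> R) (OmX OmY : set E).
Hypothesis Bc : compact B.
Hypothesis Bi : interior B !=set0.
Hypothesis Yc : compact Y.
Hypothesis Y0 : Y !=set0.
Hypothesis hc : cost_assumptions B Y c.
Hypothesis twist : extended_twist B Y c OmX OmY cE.
Variables (nu : probability E R) (yext : E).
Hypothesis nuY : nu Y = 1%E.
Hypothesis nYyext : ~ Y yext.
Local Notation lambda := (lebesgue_rV R (m + 1)).
Local Notation Ye := (ext_Y Y yext).
Local Notation cyl := (cylinder B).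
Local Notation pot := (potential Y cE).

Let XOm := twist_subX twist.

Let mcyl : measurable cyl.
Proof. exact: measurable_cylinder (base_measurable Bc). Qed.

Let mY : measurable Y.
Proof. exact: closed_measurable_mx (target_closed Yc). Qed.

(** The index yext contributes the constant tau. *)
Lemma ext_envelopeE phi tau x : {within Y, continuous phi} -> OmX x ->
  envelope Ye (ext_family cE yext phi tau) x = Num.min (pot phi x) tau.
Proof.
move=> phic Omx; have tw := ext_family_twisted tau Yc nYyext twist phic.
have le := envelope_le (family_compact tw) (family_nonempty tw) (family_continuous tw) Omx.
apply/eqP; rewrite eq_le; apply/andP; split.
  rewrite le_min -[X in _ && (_ <= X)](ext_family_out cE yext phi tau x) le ?andbT; last by right.
  have [y Yy ->] := potential_exists Yc Y0 twist phic Omx.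
  by rewrite -(ext_family_in cE phi tau nYyext x Yy) le//; left.
have [y yx] := argmin_exists (family_compact tw) (family_nonempty tw) (family_continuous tw) Omx.
rewrite (envelope_eq yx) ge_min; case: yx => [[Yy|->]] _.
  by rewrite (ext_family_in _ _ _ nYyext)// (potential_le Yc Y0 twist phic Omx Yy).
by rewrite ext_family_out lexx orbT.
Qed.

Section maximiser.
Variables (psi : E -> R) (y0 : E).
Hypothesis psimax : is_maximiser_G B Y c nu psi.
Hypothesis Yy0 : Y y0.

Let psic : {within Y, continuous psi} := psimax.1.
Let tau := tau_of B Y c psi.
Local Notation S := (sublevel B Y cE psi tau).
Local Notation u := (ext_family cE yext psi tau).
Let tw := ext_family_twisted tau Yc nYyext twist psic.
Local Notation uniq_at := (unique_argmin Ye u).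

Definition ext_map : E -> E := argmin_map OmX Ye u y0.
Local Notation T := ext_map.

Let S1 : lambda S = 1%E.
Proof. by have [_] := tau_ofP Bc Bi Yc Y0 hc twist psic. Qed.

Let mS : measurable S.
Proof. exact: (measurable_sublevel Bc Yc Y0 twist psic tau). Qed.

Lemma measurable_ext_map : measurable_fun setT T.
Proof. exact: measurable_argmin_map tw y0. Qed.

Lemma ext_map_in x : Ye (T x).
Proof. by apply: argmin_map_in; left. Qed.

Lemma ext_map_argmin x : OmX x -> uniq_at x -> argmin Ye u x = [set T x].
Proof. exact: argmin_mapE. Qed.

Lemma ext_map_below x : OmX x -> uniq_at x -> pot psi x < tau ->
  Y (T x) /\ pot psi x = cE x (T x) - psi (T x).
Proof.
move=> Omx ux flt; have Tx : argmin Ye u x (T x) by rewrite ext_map_argmin.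
have := envelope_eq Tx; rewrite ext_envelopeE// min_l ?ltW//.
case: (ext_map_in x) => [YT|-> fE]; first by rewrite (ext_family_in _ _ _ nYyext).
by move: flt; rewrite fE ext_family_out ltxx.
Qed.

Lemma ext_map_above x : OmX x -> uniq_at x -> tau < pot psi x -> T x = yext.
Proof.
move=> Omx ux fgt; have Tx : argmin Ye u x (T x) by rewrite ext_map_argmin.
have := envelope_eq Tx; rewrite ext_envelopeE// min_r ?ltW//.
case: (ext_map_in x) => [YT|//]; rewrite (ext_family_in _ _ _ nYyext)// => tE.
have := potential_le Yc Y0 twist psic Omx YT; rewrite -tE.
by rewrite leNgt fgt.
Qed.

Lemma target_fin phi : {within Y, continuous phi} ->
  nu.-integrable Y (EFin \o phi).
Proof.
move=> phic; apply: measurable_bounded_integrable mY _ _ _.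
- by rewrite [X in (X < _)%E]nuY ltry.
- exact: within_continuous_measurable_rV mY phic.
- have [K K0 hK] := psi_bounded Yc phic.
  exists K; split; first exact: num_real.
  by move=> M KM y Yy; rewrite /= (le_trans (hK y Yy))// ltW.
Qed.

(** With this notation, tau - deficit phi + \int phi dnu bounds G_nu phi below
    for the threshold tau of psi, and equals G_nu psi when phi = psi. *)
Definition deficit phi : \bar R :=
  (\int[lambda]_(x in cyl) (Num.max (tau - pot phi x) 0)%:E)%E.

Lemma measurable_deficit phi A : {within Y, continuous phi} -> measurable A ->
  A `<=` cyl -> measurable_fun A (fun x => Num.max (tau - pot phi x) 0).
Proof.
move=> phic mA sAC; apply: measurable_maxr => //; apply: measurable_funB => //.
by apply: measurable_funS (measurable_potential Bc Yc Y0 twist phic).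
Qed.

Lemma deficitE phi A : {within Y, continuous phi} -> measurable A -> A `<=` cyl ->
  (forall x, cyl x -> pot phi x < tau -> A x) ->
  deficit phi = (\int[lambda]_(x in A) (Num.max (tau - pot phi x) 0)%:E)%E.
Proof.
move=> phic mA sAC hA; rewrite /deficit (integral_splitD _ mcyl mA sAC); last first.
  by apply/measurable_EFinP; exact: measurable_deficit.
rewrite [X in (_ + X)%E]integral0_eq ?adde0// => x [Cx nAx].
rewrite max_r// subr_le0 leNgt; apply/negP => fx; apply: nAx; exact: hA.
Qed.

Lemma deficit_fin phi K : {within Y, continuous phi} -> (forall y, Y y -> phi y <= K) ->
  deficit phi \is a fin_num.
Proof.
move=> phic hK; have msl := measurable_sublevel Bc Yc Y0 twist phic tau.
rewrite (deficitE phic msl); last 2 first.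
- by move=> x [].
- by move=> x Cx fx; split => //; exact: ltW.
have pos x : (0 <= (Num.max (tau - pot phi x) 0)%:E)%E.
  by rewrite lee_fin le_max lexx orbT.
rewrite ge0_fin_numE ?integral_ge0//.
apply: (@le_lt_trans _ _ (`|tau + K|%:E * lambda (sublevel B Y cE phi tau))%E).
  rewrite -integral_cst//; apply: ge0_le_integral => //.
    apply/measurable_EFinP; apply: measurable_deficit => //.
    by move=> x [].
  move=> x [Cx _]; rewrite lee_fin ge_max normr_ge0 andbT.
  apply: le_trans (ler_norm _); rewrite lerD2l lerNl.
  exact: (potential_ge Yc Y0 hc twist phic hK).
rewrite lte_mul_pinfty//.
exact: (sublevel_fin Bc Yc Y0 hc twist phic tau).
Qed.

Lemma transported_potentialE (phi : E -> R) (K : R) (D : set E) (mD : measurable D) :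
  {within Y, continuous phi} -> 0 <= K -> (forall y, Y y -> phi y <= K) ->
  D `<=` cyl -> lambda D = 1%E ->
  (\int[lebesgue_on D]_(x in cyl) (ctransform Y c phi x)%:E =
   \int[lambda]_(x in D) (pot phi x + K)%:E - K%:E)%E.
Proof.
move=> phic K0 hK DC D1.
have mf := measurable_potential Bc Yc Y0 twist phic.
transitivity (\int[mrestr lambda mD]_(x in cyl) (pot phi x)%:E)%E.
  apply: (@eq_integral _ _ _ (mrestr lambda mD)) => x; rewrite inE => Cx.
  by rewrite (ctransform_potential twist).
rewrite integral_mrestr//; last exact/measurable_EFinP.
rewrite setIidr// (integral_shift mD _ _ K0).
- by rewrite [X in (_ - _ * X)%E]D1 mule1.
- by rewrite [X in (X < _)%E]D1 ltry.
- exact: measurable_funS mf.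
move=> x Dx; apply: (potential_ge Yc Y0 hc twist phic hK); exact: DC.
Qed.

Let tauK (K : R) : (forall y, Y y -> psi y <= K) -> 0 <= tau + K.
Proof.
move=> hK; have [x [Cx /= fx]] : S !=set0.
  apply/set0P/eqP => S0'; move: S1; rewrite S0' measure0 => /eqP.
  by rewrite eq_sym onee_eq0.
by have := potential_ge Yc Y0 hc twist psic hK Cx; lra.
Qed.

(** The bathtub identity on the subgraph of any density, with its two excess
    terms dropped. *)
Lemma Gfun_ge (phi : E -> R) (K : R) : {within Y, continuous phi} -> 0 <= K ->
  (forall y, Y y -> phi y <= K) -> 0 <= tau + K ->
  (tau%:E - deficit phi + \int[nu]_(y in Y) (phi y)%:E <= Gfun B Y c nu phi)%E.
Proof.
move=> phic K0 hK tK; apply/ereal_infP => _ [p [mp p0 p1] <-].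
have mD := measurable_subgraph (base_measurable Bc) mp.
have DC : subgraph B p `<=` cyl by move=> x [Bx /andP[]].
have D1 : lambda (subgraph B p) = 1%E.
  by rewrite lebesgue_subgraph//; exact: base_measurable.
rewrite leeD2r// (transported_potentialE mD phic K0 hK DC D1).
have := bathtub mcyl mD DC D1 (measurable_potential Bc Yc Y0 twist phic) tK
  (potential_ge Yc Y0 hc twist phic hK).
rewrite -/(deficit phi).
have dfin := deficit_fin phic hK.
move: dfin; case: (deficit phi) => // d _.
set P := (\int[lambda]_(x in subgraph B p) _)%E.
set e1 := (\int[lambda]_(x in subgraph B p) _)%E.
set e2 := (\int[lambda]_(x in _ `\` _) _)%E.
have e10 : (0 <= e1)%E.
  by apply: integral_ge0 => x _; rewrite lee_fin le_max lexx orbT.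
have e20 : (0 <= e2)%E.
  by apply: integral_ge0 => x _; rewrite lee_fin le_max lexx orbT.
clearbody P e1 e2 => H.
have : ((tau + K)%:E <= P + d%:E)%E by rewrite H leeDl// adde_ge0.
case: P H => [P| |] _ //=.
- by rewrite -EFinD -!EFinB !lee_fin; lra.
- by move=> _; exact: leey.
Qed.

(** The density attached to psi is a competitor for which the excess terms of the
    bathtub identity vanish. *)
Lemma Gfun_maximiser_le (K : R) : 0 <= K -> (forall y, Y y -> psi y <= K) ->
  (Gfun B Y c nu psi <= tau%:E - deficit psi + \int[nu]_(y in Y) (psi y)%:E)%E.
Proof.
move=> K0 hK; have tK := tauK hK.
have [dens _] := tau_ofP Bc Bi Yc Y0 hc twist psic.
apply: (@le_trans _ _ (\int[mu_of B (pbar_of B Y c psi)]_(x in cyl)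
  (ctransform Y c psi x)%:E + \int[nu]_(y in Y) (psi y)%:E)%E).
  by apply: ereal_inf_lbound; exists (pbar_of B Y c psi).
rewrite leeD2r//; have mp := dens.
have {mp} mD : measurable (subgraph B (pbar_of B Y c psi)).
  by apply: measurable_subgraph; [exact: base_measurable|case: mp].
have SC : S `<=` cyl by move=> x [].
rewrite (_ : (\int[_]_(x in _) _)%E =
    (\int[lebesgue_on S]_(x in cyl) (ctransform Y c psi x)%:E)%E); last first.
  apply: (@eq_measure_integral _ _ _ _ (mrestr lambda mS) (mrestr lambda mD)) => A mA _.
  exact: (lebesgue_subgraph_level Bc Yc Y0 hc twist psic).
rewrite (transported_potentialE mS psic K0 hK SC S1).
have := bathtub mcyl mS SC S1 (measurable_potential Bc Yc Y0 twist psic) tK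
  (potential_ge Yc Y0 hc twist psic hK).
rewrite -/(deficit psi).
have -> : (\int[lambda]_(x in S) (Num.max (pot psi x - tau) 0)%:E = 0)%E.
  by apply: integral0_eq => x [_ /= fx]; rewrite max_r// subr_le0.
have -> : (\int[lambda]_(x in cyl `\` S) (Num.max (tau - pot psi x) 0)%:E = 0)%E.
  apply: integral0_eq => x [Cx nS]; rewrite max_r// subr_le0 leNgt.
  by apply/negP => fx; apply: nS; split => //; exact: ltW.
have dfin := deficit_fin psic hK.
move: dfin; case: (deficit psi) => // d _.
set P := (\int[lambda]_(x in S) _)%E; clearbody P.
case: P => [P| |] //=.
by rewrite !adde0 -EFinD => -[]; rewrite -!EFinB lee_fin; lra.
Qed.

Section perturbation.
Variable h : E -> R.
Hypothesis ch : continuous h.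
Hypothesis h01 : forall y, 0 <= h y <= 1.

Let phi (t : R) : E -> R := fun y => psi y + t * h y.

Let phic t : {within Y, continuous (phi t)}.
Proof.
apply/subspace_continuousP => y Yy; apply: cvgD.
  by have /subspace_continuousP/(_ y Yy) := psic.
apply: cvgM; first exact: cvg_cst.
by apply: cvg_within_filter; exact: ch.
Qed.

Let phi_le K t : 0 <= t <= 1 -> (forall y, Y y -> psi y <= K) ->
  forall y, Y y -> phi t y <= K + 1.
Proof.
move=> /andP[t0 t1] hK y Yy; rewrite lerD ?hK//.
have /andP[h0 h1] := h01 y; nra.
Qed.

Let pot_le t x : 0 <= t -> OmX x -> pot (phi t) x <= pot psi x.
Proof.
move=> t0 Omx; have [y Yy ->] := potential_exists Yc Y0 twist psic Omx.
have := potential_le Yc Y0 twist (@phic t) Omx Yy.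
have /andP[h0 _] := h01 y; have : 0 <= t * h y by rewrite mulr_ge0.
rewrite /phi; lra.
Qed.

Let pot_ge t x : 0 <= t -> OmX x -> pot psi x - t <= pot (phi t) x.
Proof.
move=> t0 Omx; have [y Yy ->] := potential_exists Yc Y0 twist (@phic t) Omx.
have := potential_le Yc Y0 twist psic Omx Yy.
have /andP[_ h1] := h01 y; have : t * h y <= t by rewrite ler_piMr.
rewrite /phi; lra.
Qed.

Let int_h : nu.-integrable Y (EFin \o h).
Proof. by apply: target_fin; exact: continuous_subspaceT. Qed.

Let hbar := (\int[nu]_(y in Y) (h y)%:E)%E.

Let hbar_fin : hbar \is a fin_num.
Proof. exact: (integrable_fin_num (mu := nu) mY int_h). Qed.

(** Maximality of psi against psi + t h, read through the two bounds on G_nu. *)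
Lemma deficit_perturbation t : 0 < t <= 1 ->
  (t%:E * hbar <= deficit (phi t) - deficit psi)%E.
Proof.
move=> /andP[t0 t1]; have [K K0 hK] := psi_bounded Yc psic.
have {}hK y : Y y -> psi y <= K by move=> Yy; exact: le_trans (ler_norm _) (hK y Yy).
have K10 : 0 <= K + 1 by rewrite addr_ge0.
have tle : 0 <= t <= 1 by rewrite (ltW t0).
have tK : 0 <= tau + (K + 1) by rewrite addrA addr_ge0// tauK.
have lo := Gfun_ge (@phic t) K10 (phi_le tle hK) tK.
have hi := Gfun_maximiser_le K0 hK.
have := le_trans lo (le_trans (psimax.2 _ (@phic t)) hi).
have psi_fin := integrable_fin_num (mu := nu) mY (target_fin psic).
have -> : (\int[nu]_(y in Y) (phi t y)%:E =
    \int[nu]_(y in Y) (psi y)%:E + t%:E * hbar)%E.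
  rewrite -integralZl// -integralD//; first exact: target_fin.
  exact: integrableZl.
have := deficit_fin (@phic t) (phi_le tle hK).
have := deficit_fin psic hK.
move: psi_fin hbar_fin.
case: (\int[nu]_(x in Y) (EFin \o psi) x)%E => // a _.
case: hbar => // b _.
case: (deficit psi) => // e _; case: (deficit (phi t)) => // e' _.
by rewrite -!EFinM -!EFinB -!EFinD !lee_fin; lra.
Qed.

(** A set of finite measure outside which all the integrands vanish for t <= 1. *)
Let W := sublevel B Y cE psi (tau + 1).

Let mW : measurable W.
Proof. exact: (measurable_sublevel Bc Yc Y0 twist psic (tau + 1)). Qed.

Let Wcyl : W `<=` cyl. Proof. by move=> x []. Qed.

Let Wfin : (lambda W < +oo)%E.
Proof. exact: (sublevel_fin Bc Yc Y0 hc twist psic (tau + 1)). Qed.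

Let quot n x : R := n.+1%:R *
  (Num.max (tau - pot (phi n.+1%:R^-1) x) 0 - Num.max (tau - pot psi x) 0).

Let tn01 n : 0 <= (n.+1%:R^-1 : R) <= 1.
Proof. by rewrite invr_ge0 ler0n invf_le1// ler1n. Qed.

Let quot01 n x : cyl x -> 0 <= quot n x <= 1.
Proof.
move=> Cx; have Omx := XOm Cx; have /andP[t0 _] := tn01 n.
have := pot_le t0 Omx; have := pot_ge t0 Omx.
rewrite /quot; set a := pot _ x; set b := pot _ x; set t := _^-1 => h1 h2.
have -> : n.+1%:R = t^-1 by rewrite invrK.
have t0' : 0 < t by rewrite invr_gt0.
have [d0 d1] : 0 <= Num.max (tau - b) 0 - Num.max (tau - a) 0 /\
    Num.max (tau - b) 0 - Num.max (tau - a) 0 <= t.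
  split.
    by rewrite subr_ge0 ge_max !le_max lexx orbT andbT lerD2l lerN2 h2.
  rewrite lerBlDr ge_max; apply/andP; split.
    by rewrite -lerBlDl le_max; apply/orP; left; lra.
  by rewrite addr_ge0 ?le_max ?lexx ?orbT// ltW.
apply/andP; split; first by rewrite mulr_ge0// invr_ge0 ltW.
by rewrite mulrC ler_pdivrMr// mul1r.
Qed.

Let measurable_quot n : measurable_fun W (quot n).
Proof.
apply: measurable_funM => //; apply: measurable_funB.
  exact: (measurable_deficit (@phic _) mW Wcyl).
exact: (measurable_deficit psic mW Wcyl).
Qed.

Let hbar_le n : (hbar <= \int[lambda]_(x in W) (quot n x)%:E)%E.
Proof.
set t : R := n.+1%:R^-1.
have t01 : 0 < t <= 1 by rewrite invr_gt0 ltr0n; case/andP: (tn01 n).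
have := deficit_perturbation t01.
have tle : 0 <= t <= 1 by exact: tn01.
have E1 : deficit (phi t) =
    (\int[lambda]_(x in W) (Num.max (tau - pot (phi t) x) 0)%:E)%E.
  apply: deficitE => // x Cx fx; split => //=.
  have := pot_ge (proj1 (andP tle)) (XOm Cx); case/andP: tle; lra.
have E2 : deficit psi =
    (\int[lambda]_(x in W) (Num.max (tau - pot psi x) 0)%:E)%E.
  apply: deficitE => // x Cx fx; split => //=; lra.
have [K K0 hK] := psi_bounded Yc psic.
have {}hK y : Y y -> psi y <= K by move=> Yy; exact: le_trans (ler_norm _) (hK y Yy).
have fin1 := deficit_fin (@phic t) (phi_le tle hK).
have fin2 := deficit_fin psic hK.
have int f : {within Y, continuous f} -> (\int[lambda]_(x in W)
    (Num.max (tau - pot f x) 0)%:E)%E \is a fin_num ->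
    lambda.-integrable W (fun x => (Num.max (tau - pot f x) 0)%:E).
  move=> fc ffin; apply/integrableP; split.
    by apply/measurable_EFinP; exact: measurable_deficit.
  under eq_integral do rewrite gee0_abs ?lee_fin ?le_max ?lexx ?orbT//.
  by rewrite -ge0_fin_numE// integral_ge0// => x _; rewrite lee_fin le_max lexx orbT.
have int1 : lambda.-integrable W (fun x => (Num.max (tau - pot (phi t) x) 0)%:E).
  by apply: int => //; rewrite -E1.
have int2 : lambda.-integrable W (fun x => (Num.max (tau - pot psi x) 0)%:E).
  by apply: int => //; rewrite -E2.
rewrite E1 E2 -integralB// => le.
rewrite (_ : (\int[lambda]_(x in W) (quot n x)%:E = n.+1%:R%:E *
  \int[lambda]_(x in W) ((Num.max (tau - pot (phi t) x) 0)%:E -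
    (Num.max (tau - pot psi x) 0)%:E))%E); last first.
  rewrite -integralZl//; last exact: integrableB.
by rewrite -lee_pdivrMl.
Qed.

Let he y := if y == yext then 0 else h y.

Let max_min (a b : R) : Num.max (a - b) 0 = a - Num.min b a.
Proof.
have /orP[ab|ab] := le_total a b.
  by rewrite max_r ?subr_le0// min_r// subrr.
by rewrite max_l ?subr_ge0// min_l.
Qed.

(** The envelope theorem in the variable t: the derivative at 0 of
    min over y of (u x y - t he y) is - he at the unique minimiser. *)
Let quot_cvg x : cyl x -> uniq_at x -> quot n x @[n --> \oo] --> he (T x).
Proof.
move=> Cx ux; have Omx := XOm Cx.
(* At yext the perturbation has no effect, whence the truncation he of h. *)
pose v (t : R) y := u x y - t * he y.
have vE t : envelope Ye v t = Num.min (pot (phi t) x) tau.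
  rewrite -(ext_envelopeE _ (@phic t) Omx) /envelope; congr inf.
  apply/seteqP; split => _ [y Yy <-]; exists y => //;
    rewrite /v /he /ext_family /ext_c /ext_psi /phi; case: ifP => _; ring.
have v0 : v 0 = u x by apply/funext => y; rewrite /v mul0r subr0.
have argv : argmin Ye v 0 = [set T x].
  by rewrite -(ext_map_argmin Omx ux) /argmin v0.
have hec y : Ye y -> forall e, 0 < e -> \forall y' \near y, Ye y' -> `|he y' - he y| < e.
  move=> Yey e e0.
  have [[A C] /= [Ay C0] AC'] : \forall y' \near y & x' \near x, Ye y' -> `|he y' - he y| < e.
    case: Yey => [Yy|->]; last first.
      by apply: (near_ext_out Yc nYyext); near=> x'; rewrite subrr normr0.
    apply: (near_ext_in nYyext) => //.
    have heE z : Y z -> he z = h z.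
      by move=> Yz; rewrite /he; case: eqP => // e'; rewrite e' in Yz.
    have /cvgrPdist_lt/(_ e e0) hy : h z @[z --> y] --> h y by exact: ch.
    exists ([set y' | `|h y - h y'| < e], setT) => /=; first by split => //; exact: filterT.
    by move=> [y' x'] /= [hy' _] Yy'; rewrite !heE// distrC.
  apply: filterS Ay => y' Ay'; apply: (AC' (y', x)); split => //=.
  exact: nbhs_singleton.
have vc : jointly_continuous setT Ye v.
  move=> t y _ Yey e e0.
  have e30 : 0 < e / 3 by rewrite divr_gt0.
  have [[A C] /= [Ay C0] AC'] := family_continuous tw Omx Yey e30.
  have d0 : 0 < e / 3 / (`|t| + 1) by rewrite divr_gt0// ltr_wpDl.
  have := hec y Yey _ d0 => hy.
  exists (A `&` [set y' | Ye y' -> `|he y' - he y| < e / 3 / (`|t| + 1)],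
    [set t' | `|t - t'| < Num.min (e / 3) 1]) => /=.
    split; first exact: filterI.
    have m0 : 0 < Num.min (e / 3) 1 by rewrite lt_min e30 ltr01.
    exact: (nbhsx_ballx t _ m0).
  move=> [y' t'] /= [[Ay' hy'] tt'] Yey'.
  have := AC' (y', x) (conj Ay' (nbhs_singleton C0)) Yey' => /= h1.
  have {hy'} h2 := hy' Yey'.
  rewrite (_ : _ - _ = (u x y' - u x y) - t * (he y' - he y) + (t - t') * he y');
    last by rewrite /v; ring.
  apply: (le_lt_trans (ler_normD _ _)).
  have h3 : `|t * (he y' - he y)| < e / 3.
    rewrite normrM; apply: (@le_lt_trans _ _ ((`|t| + 1) * `|he y' - he y|)).
      by rewrite ler_wpM2r// lerDl.
    by rewrite mulrC -ltr_pdivlMr// ltr_wpDl.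
  have h4 : `|(t - t') * he y'| < e / 3.
    move: tt'; rewrite lt_min => /andP[tt' _]; rewrite normrM.
    apply: le_lt_trans tt'; rewrite ler_piMr// /he; case: ifP => _.
      by rewrite normr0.
    by have /andP[a b] := h01 y'; rewrite ger0_norm.
  have := ler_normB (u x y' - u x y) (t * (he y' - he y)).
  by set aa := `|_ - _ * _|; lra.
have fo := envelope_first_order (x0 := (0 : R)) openT (family_compact tw)
  (family_nonempty tw) vc I argv.
apply/cvgrPdist_le => e e0.
have H : \forall t \near (0 : R), v t (T x) - e * `|t - 0| <= envelope Ye v t <= v t (T x).
  apply: fo => // d d0.
  have hT := hec _ (ext_map_in x) d d0.
  exists ([set y' | Ye y' -> `|he y' - he (T x)| < d], setT) => /=.
    by split => //; exact: filterT.
  move=> [y t] /= [hy _] Yey; have {}hy := hy Yey.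
  rewrite /v !mul0r !subr0.
  have : `|t * (he y - he (T x))| <= d * `|t|.
    by rewrite normrM mulrC ler_wpM2r// ltW.
  rewrite ler_norml => /andP[]; lra.
have := @cvg_harmonic R => /(_ _ H) Hn.
near=> n.
have : v n.+1%:R^-1 (T x) - e * `|n.+1%:R^-1 - 0| <= envelope Ye v n.+1%:R^-1 <= v n.+1%:R^-1 (T x).
  by near: n; exact: Hn.
have := vE 0; have -> : phi 0 = psi by apply/funext => y; rewrite /phi mul0r addr0.
rewrite (envelope_eq (_ : argmin Ye v 0 (T x))); last by rewrite argv.
rewrite /quot !max_min vE subr0.
set t := n.+1%:R^-1; have t0 : 0 < t by rewrite invr_gt0.
have -> : n.+1%:R = t^-1 by rewrite invrK.
rewrite (gtr0_norm t0) /v mul0r subr0 => <-.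
set M := Num.min _ _ => /andP[h1 h2].
rewrite ler_norml (_ : _ - _ = t^-1 * (t * he (T x) - (u x (T x) - M))); last first.
  by field; rewrite gt_eqF.
apply/andP; split.
  by rewrite -ler_pdivrMl ?invr_gt0// invrK; lra.
by rewrite -ler_pdivlMl ?invr_gt0// invrK; lra.
Unshelve. all: by end_near. Qed.

Let lim_fun x := h (T x) * \1_S x.

Let measurable_hT : measurable_fun setT (h \o T).
Proof.
apply: (measurableT_comp _ measurable_ext_map).
by apply: within_continuous_measurable_rV => //; exact: continuous_subspaceT.
Qed.

(** The difference quotients of the deficit are bounded by 1 and converge almost
    everywhere, to h (T x) on S and to 0 outside S. *)
Lemma mean_le_transported :
  (hbar <= \int[lambda]_(x in S) (h (T x))%:E)%E.
Proof.
have [N [mN N0 NOm NE]] := non_unique_null tw.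
pose Z := N `|` (cyl `&` [set x | pot psi x = tau]).
have mlev := level_set_measurable Bc Yc Y0 twist psic tau.
have lev0 := level_set_null Bc Yc Y0 hc twist psic tau.
have mZ : measurable Z by exact: measurableU.
have Z0 : lambda Z = 0%E.
  exact: measureU_null.
have cvgl x : W x -> ~ Z x -> quot n x @[n --> \oo] --> lim_fun x.
  move=> Wx nZ; have Cx := Wcyl Wx; have Omx := XOm Cx.
  have ux : uniq_at x by apply: contrapT => nu'; apply: nZ; left; exact/(NE x Omx).
  have -> : lim_fun x = he (T x); last exact: quot_cvg.
  rewrite /lim_fun indicE; have [flt|fgt|feq] := ltgtP (pot psi x) tau.
  - rewrite mem_set ?mulr1; last by split => //; exact: ltW.
    have [YT _] := ext_map_below Omx ux flt.
    by rewrite /he; case: eqP => // e; rewrite e in YT.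
  - rewrite memNset ?mulr0; last by move=> [_ /=]; rewrite leNgt fgt.
    by rewrite /he (ext_map_above Omx ux fgt) eqxx.
  - by exfalso; apply: nZ; right.
have mlim : measurable_fun W (EFin \o lim_fun).
  apply/measurable_EFinP; apply: measurable_funM.
    exact: (measurable_funTS measurable_hT).
  by apply: measurable_indic.
have cvgq : {ae lambda, forall x, W x -> (quot n x)%:E @[n --> \oo] --> (lim_fun x)%:E}.
  exists Z; split => // x /= nx; apply: contrapT => nZ; apply: nx => Wx.
  by apply/fine_cvgP; split; [exact: nearW|exact: cvgl].
have bq : {ae lambda, forall x n, W x -> (`|(quot n x)%:E| <= cst 1 x)%E}.
  apply: aeW => x n Wx; rewrite /= lee_fin.
  by have /andP[q0 q1] := quot01 n (Wcyl Wx); rewrite ger0_norm.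
have i1 : lambda.-integrable W (cst 1%E).
  apply/integrableP; split; first exact: measurable_cst.
  rewrite (_ : (\int[lambda]_(x in W) `|cst 1 x|)%E = lambda W)//.
  rewrite -[RHS]mul1e -integral_cst//; apply: eq_integral => x _.
  by rewrite /= normr1.
have mq n : measurable_fun W (fun x => (quot n x)%:E).
  by apply/measurable_EFinP; exact: measurable_quot.
have [_ _ cvgI] := dominated_convergence mW mq mlim cvgq i1 bq.
have le_lim : (hbar <= \int[lambda]_(x in W) (lim_fun x)%:E)%E.
  by apply: (cvge_to_ge cvgI); near=> n => /=; exact: hbar_le.
apply: (le_trans le_lim).
rewrite (integral_splitD _ mW mS _ mlim); last first.
  by move=> x [Cx /= fx]; split => //=; rewrite (le_trans fx)// lerDl.
rewrite [X in (_ + X <= _)%E]integral0_eq; last first.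
  by move=> x [_ nS]; rewrite /= /lim_fun indicE memNset// mulr0.
rewrite adde0 (eq_integral (fun x => (h (T x))%:E))// => x xS.
by rewrite /= /lim_fun indicE xS mulr1.
Unshelve. all: by end_near. Qed.

End perturbation.

(** Both measures have mass 1.  Hence the inequalities between the means of h and
    of 1 - h are equalities. *)
Lemma target_measure_transported A : measurable A ->
  nu A = lambda (S `&` T @^-1` A).
Proof.
have mT : measurable_fun setT T := measurable_ext_map.
have nuT : nu setT = 1%E by exact: probability_setT.
have nuYC : nu (~` Y) = 0%E.
  by rewrite probability_setC// nuY subee.
pose m2 := pushforward (mrestr lambda mS) T.
have m2E A' : m2 A' = lambda (S `&` T @^-1` A').
  by rewrite /m2 /pushforward /mrestr /= setIC.
have m2T : m2 setT = 1%E by rewrite m2E preimage_setT setIT.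
move=> mA; rewrite -m2E.
apply: (@measure_eq_continuous R (m + 1) nu m2) => //.
- by rewrite [X in (X < _)%E]nuT ltry.
- by rewrite [X in (X < _)%E]m2T ltry.
move=> h ch h01.
have mh : measurable_fun setT h.
  by apply: within_continuous_measurable_rV => //; exact: continuous_subspaceT.
have nuE (g : E -> R) : continuous g -> (forall y, 0 <= g y <= 1) ->
    (\int[nu]_x (g x)%:E = \int[nu]_(x in Y) (g x)%:E)%E.
  move=> cg g01; rewrite (@ge0_negligible_integral _ _ _ nu setT (~` Y))//.
  - by rewrite setTD setCK.
  - exact: measurableC.
  - apply/measurable_EFinP; apply: within_continuous_measurable_rV => //.
    exact: continuous_subspaceT.
  - by move=> y _; rewrite lee_fin; case/andP: (g01 y).
have m2I (g : E -> R) : continuous g -> (forall y, 0 <= g y <= 1) ->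
    (\int[m2]_x (g x)%:E = \int[lambda]_(x in S) (g (T x))%:E)%E.
  move=> cg g01; have mg : measurable_fun setT g.
    by apply: within_continuous_measurable_rV => //; exact: continuous_subspaceT.
  rewrite ge0_integral_pushforward//; last 2 first.
  - exact/measurable_EFinP.
  - by move=> y _; rewrite lee_fin; case/andP: (g01 y).
  rewrite preimage_setT ge0_integral_mrestr ?setTI//.
  - by apply/measurable_EFinP; exact: (measurableT_comp mg mT).
  - by move=> y _; rewrite lee_fin; case/andP: (g01 (T y)).
(* The reverse inequality comes from the complementary test function. *)
pose g (y : E) : R := 1 - h y.
have cg : continuous g.
  move=> y; have c1 : {for y, continuous (cst 1 : E -> R)} by exact: cst_continuous.
  have cy : {for y, continuous h} by exact: ch.
  exact: (continuousB c1 cy).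
have g01 y : 0 <= g y <= 1.
  by have /andP[a b] := h01 y; rewrite /g; apply/andP; split; lra.
have le1 := mean_le_transported ch h01.
have le2 := mean_le_transported cg g01.
rewrite -nuE// -m2I// in le1; rewrite -nuE// -m2I// in le2.
have sum (mu : {measure set E -> \bar R}) : mu setT = 1%E ->
    (\int[mu]_x (h x)%:E + \int[mu]_x (g x)%:E = 1)%E.
  move=> mu1; rewrite -ge0_integralD//.
  - rewrite (eq_integral (cst 1%E)); first by rewrite integral_cst// mul1e.
    by move=> y _; rewrite -EFinD /g subrKC.
  - by move=> y _; rewrite lee_fin; case/andP: (h01 y).
  - exact/measurable_EFinP.
  - by move=> y _; rewrite lee_fin; case/andP: (g01 y).
  - by apply/measurable_EFinP; apply: measurable_funB.
have s1 := sum nu nuT; have s2 : (\int[m2]_x (h x)%:E + \int[m2]_x (g x)%:E = 1)%E.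
  by apply: sum.
have ge0 (mu : {measure set E -> \bar R}) (f : E -> R) : (forall y, 0 <= f y <= 1) ->
    (0 <= \int[mu]_x (f x)%:E)%E.
  by move=> f01; apply: integral_ge0 => y _; rewrite lee_fin; case/andP: (f01 y).
have a0 := ge0 nu _ h01; have b0 := ge0 nu _ g01.
have c0 : (0 <= \int[m2]_x (h x)%:E)%E by apply: ge0.
have d0 : (0 <= \int[m2]_x (g x)%:E)%E by apply: ge0.
move: s1 s2 le1 le2 a0 b0 c0 d0.
set a := (\int[nu]_x _)%E; set b := (\int[nu]_x _)%E.
set a' := (\int[m2]_x _)%E; set b' := (\int[m2]_x _)%E.
clearbody a b a' b'.
case: a => [a| |] //; case: b => [b| |] //; case: a' => [a'| |] //;
  case: b' => [b'| |] //.
by rewrite -!EFinD => -[s1] [s2]; rewrite !lee_fin => *; congr EFin; lra.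
Qed.

End maximiser.
End first_order_condition.

(** * Optimal maps from potentials *)

Lemma ae_lebesgue_on (R : realType) n (D M : set 'rV[R]_n) (P : 'rV[R]_n -> Prop) :
  measurable D -> measurable M -> lebesgue_rV R n M = 0%E ->
  (forall x, D x -> ~ M x -> P x) -> {ae lebesgue_on D, forall x, D x -> P x}.
Proof.
move=> mD mM M0 MP; exists M; split => //.
  by apply: (subset_measure0 _ _ _ M0) => //; exact: measurableI.
move=> x /= nP; apply: contrapT => nM; apply: nP => Dx; exact: MP.
Qed.

Section optimality_from_potentials.
Variables (R : realType) (n : nat).
Local Notation E := 'rV[R]_n.
Local Notation lambda := (lebesgue_rV R n).
Variables (D Y : set E) (C : E -> E -> R) (F G : E -> R) (K : R).
Hypothesis mD : measurable D.
Hypothesis mY : measurable Y.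
Hypothesis Dfin : (lambda D < +oo)%E.
Hypothesis mC : measurable_fun (D `*` Y) (fun z : E * E => C z.1 z.2).
Hypothesis mF : measurable_fun D F.
Hypothesis mG : measurable_fun Y G.
Hypothesis FK : forall x, D x -> `|F x| <= K.
Hypothesis GK : forall y, Y y -> `|G y| <= K.
Hypothesis C0 : forall x y, D x -> Y y -> 0 <= C x y.
Hypothesis slack : forall x y, D x -> Y y -> F x + G y <= C x y.
Variable nu : set E -> \bar R.
Hypothesis nuYC : nu (~` Y) = 0%E.

(** A transport map is measurable on D only; the pushforward requires a map that
    is measurable everywhere. *)
Definition extend_map (T' : E -> E) x : E := if x \in D then T' x else 0.

Lemma extend_mapE T' x : D x -> extend_map T' x = T' x.
Proof. by move=> Dx; rewrite /extend_map mem_set. Qed.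

Lemma measurable_extend_map T' : measurable_fun D T' ->
  measurable_fun setT (extend_map T').
Proof.
move=> mT' _ A mA; rewrite setTI.
rewrite (_ : _ @^-1` A = (D `&` T' @^-1` A) `|`
    (if `[< A 0 >] then ~` D else set0)); last first.
  apply/seteqP; split => x /=; rewrite /extend_map.
    case: ifPn => [|]; rewrite ?inE ?notin_setE => Dx Ax; first by left.
    by right; rewrite asboolT.
  move=> [[Dx AT]|]; first by rewrite mem_set.
  by case: asboolP => // A0 nDx; rewrite memNset.
apply: measurableU; first exact: mT'.
by case: ifP => // _; exact: measurableC.
Qed.

Section transport_cost.
Variable T' : E -> E.
Hypothesis tT' : is_transport_map D (lebesgue_on D) nu T'.

Let W := D `&` T' @^-1` Y.

Let mW : measurable W. Proof. exact: tT'.1. Qed.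

Let sWD : W `<=` D. Proof. by move=> x []. Qed.

Lemma transport_missing_null : lambda (D `\` W) = 0%E.
Proof.
rewrite -nuYC -(tT'.2 _ (measurableC mY)) /lebesgue_on; congr (lambda _).
apply/seteqP; split => x /=.
  by move=> [Dx nW]; split => //; split => //= YT; apply: nW.
by move=> [[Dx nY] _]; split => // -[].
Qed.

Lemma measurable_along_transport (f : E * E -> R) :
  measurable_fun (D `*` Y) f -> measurable_fun W (fun x => f (x, T' x)).
Proof.
move=> mf; have mp : measurable_fun setT (fun x => (x, extend_map T' x)).
  apply: measurable_fun_pair; first exact: measurable_id.
  exact: measurable_extend_map tT'.1.
apply: (eq_measurable_fun (fun x => f (x, extend_map T' x))).
  by move=> x; rewrite inE => -[Dx _]; rewrite extend_mapE.
apply: (measurable_comp (measurableX mD mY) _ mf).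
  by move=> _ [x [Dx YT] <-]; split => //=; rewrite extend_mapE.
exact: measurable_funTS mp.
Qed.

(** The cost of T' in excess of the dual value of the potentials F and G. *)
Definition transport_slack : \bar R :=
  (\int[lambda]_(x in W) (C x (T' x) - F x - G (T' x))%:E)%E.

Lemma measurable_slack_along :
  measurable_fun W (fun x => C x (T' x) - F x - G (T' x)).
Proof.
apply: (measurable_along_transport (f := fun z => C z.1 z.2 - F z.1 - G z.2)).
apply: measurable_funB; first apply: measurable_funB => //.
  apply: (measurable_comp mD _ mF); first by move=> _ [z [Dz _] <-].
  exact: measurable_funTS measurable_fst.
apply: (measurable_comp mY _ mG); first by move=> _ [z [_ Yz] <-].
exact: measurable_funTS measurable_snd.
Qed.

Lemma slack_along_ge0 x : W x -> (0 <= (C x (T' x) - F x - G (T' x))%:E)%E.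
Proof. by move=> [Dx YT]; rewrite lee_fin; have := slack Dx YT; lra. Qed.

Lemma map_cost_along :
  map_cost D Y C (lebesgue_on D) T' = (\int[lambda]_(x in W) (C x (T' x))%:E)%E.
Proof.
rewrite /map_cost (@integral_mrestr _ _ _ lambda D mD W)//.
  by rewrite setIidl.
apply/measurable_EFinP.
exact: (measurable_along_transport (f := fun z => C z.1 z.2)).
Qed.

Definition target_mean : \bar R := (\int[lambda]_(x in W) (G (T' x) + K)%:E)%E.

Let measurable_GT : measurable_fun W (fun x => G (T' x) + K).
Proof.
apply: measurable_funD => //.
apply: (measurable_along_transport (f := fun z => G z.2)).
apply: (measurable_comp mY _ mG); first by move=> _ [z [_ Yz] <-].
exact: measurable_funTS measurable_snd.
Qed.

Let GT0 x : W x -> (0 <= (G (T' x) + K)%:E)%E.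
Proof.
by move=> [_ YT]; rewrite lee_fin; have := GK YT; rewrite ler_norml; lra.
Qed.

Let FK0 x : D x -> (0 <= (F x + K)%:E)%E.
Proof. by move=> Dx; rewrite lee_fin; have := FK Dx; rewrite ler_norml; lra. Qed.

Let bounded_integral_fin (f : E -> R) A : measurable A -> A `<=` D ->
  measurable_fun A f -> (forall x, A x -> 0 <= f x <= K + K) ->
  (\int[lambda]_(x in A) (f x)%:E)%E \is a fin_num.
Proof.
move=> mA AD mf f0; rewrite ge0_fin_numE; last first.
  by apply: integral_ge0 => x Ax; rewrite lee_fin; case/andP: (f0 x Ax).
have [A0|/set0P[a Aa]] := eqVneq A set0; first by rewrite A0 integral_set0 ltry.
have K0 : 0 <= K + K by have /andP[h1 h2] := f0 a Aa; exact: le_trans h1 h2.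
apply: (@le_lt_trans _ _ ((K + K)%:E * lambda A)%E).
  rewrite -integral_cst//; apply: ge0_le_integral => //.
  - by move=> x Ax; rewrite lee_fin; case/andP: (f0 x Ax).
  - exact/measurable_EFinP.
  - by move=> x Ax; rewrite lee_fin; case/andP: (f0 x Ax).
rewrite lte_mul_pinfty// (le_lt_trans _ Dfin)//.
by apply: le_measure; rewrite ?inE.
Qed.

Lemma target_mean_fin : target_mean \is a fin_num.
Proof.
apply: bounded_integral_fin => // x [Dx YT].
by have := GK YT; rewrite ler_norml; lra.
Qed.

Lemma source_mean_fin : (\int[lambda]_(x in D) (F x + K)%:E)%E \is a fin_num.
Proof.
apply: bounded_integral_fin => //; first exact: measurable_funD.
by move=> x Dx; have := FK Dx; rewrite ler_norml; lra.
Qed.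

Let mass : ((K + K)%:E * lambda W = (K + K)%:E * lambda D)%E.
Proof.
congr (_ * _)%E; apply: (measure_eq_off_null mW mD (N := D `\` W)).
- exact: measurableD.
- exact: transport_missing_null.
- move=> x nDW; split => [[]//|Dx]; apply: contrapT => nW; exact: nDW.
Qed.

(** The constant K makes every term non-negative, so that the identity holds
    even when the cost of T' is infinite. *)
Lemma map_cost_decomposition :
  (map_cost D Y C (lebesgue_on D) T' + (K + K)%:E * lambda D =
   transport_slack +
   (\int[lambda]_(x in D) (F x + K)%:E + target_mean))%E.
Proof.
have [D0|/set0P[a Da]] := eqVneq D set0.
  rewrite map_cost_along /transport_slack /target_mean.
  by rewrite /W D0 set0I measure0 !integral_set0 mule0 !adde0.
have K0 : 0 <= K by exact: le_trans (normr_ge0 _) (FK Da).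
have mCW := measurable_along_transport (f := fun z => C z.1 z.2) mC.
have mFW : measurable_fun W F by exact: (measurable_funS mD sWD mF).
rewrite map_cost_along -mass -(integral_cst lambda mW) -ge0_integralD//; last 3 first.
- by move=> x [Dx YT]; rewrite lee_fin C0.
- exact/measurable_EFinP.
- by move=> x _; rewrite lee_fin addr_ge0.
have mFK : measurable_fun D (fun x => (F x + K)%:E).
  by apply/measurable_EFinP; exact: measurable_funD.
rewrite (ge0_negligible_integral (measurableD mD mW) mD mFK FK0
  transport_missing_null) setDD setIidr//.
have mFKW : measurable_fun W (fun x => (F x + K)%:E) by exact: (measurable_funS mD sWD mFK).
have mGTW : measurable_fun W (fun x => (G (T' x) + K)%:E) by exact/measurable_EFinP.
have FKW0 x : W x -> (0 <= (F x + K)%:E)%E by case=> Dx _; exact: FK0.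
have mslackW : measurable_fun W (fun x => (C x (T' x) - F x - G (T' x))%:E).
  by apply/measurable_EFinP; exact: measurable_slack_along.
rewrite -(ge0_integralD lambda mW FKW0 mFKW GT0 mGTW).
rewrite -(ge0_integralD lambda mW slack_along_ge0 mslackW); last 2 first.
- by move=> x Wx; apply: adde_ge0; [exact: FKW0|exact: GT0].
- exact: emeasurable_funD.
apply: eq_integral => x _; rewrite -!EFinD; congr EFin; lra.
Qed.

End transport_cost.

Lemma target_meanE T' : is_transport_map D (lebesgue_on D) nu T' ->
  (target_mean T' =
   \int[pushforward (mrestr lambda mD) (extend_map T')]_(y in Y) (G y + K)%:E)%E.
Proof.
move=> h; have h1 := measurable_extend_map h.1.
rewrite ge0_integral_pushforward//; last 2 first.
- by apply/measurable_EFinP; exact: measurable_funD.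
- by move=> y; rewrite inE => Yy; rewrite lee_fin; have := GK Yy; rewrite ler_norml; lra.
have mext_Y : measurable (extend_map T' @^-1` Y).
  by rewrite -[X in measurable X]setTI; exact: h1.
rewrite ge0_integral_mrestr//; last 2 first.
- apply/measurable_EFinP; apply: measurable_funD => //.
  apply: (measurable_comp mY _ mG); first by move=> _ [x + <-].
  exact: measurable_funTS h1.
- by move=> y Yy; rewrite lee_fin /=; have := GK Yy; rewrite ler_norml; lra.
rewrite /target_mean (_ : extend_map T' @^-1` Y `&` D = D `&` T' @^-1` Y); last first.
  apply/seteqP; split => x /=; first by move=> [YT Dx]; rewrite -extend_mapE.
  by move=> [Dx YT]; rewrite extend_mapE.
by apply: eq_integral => x; rewrite inE => -[Dx _]; rewrite /= extend_mapE.
Qed.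

(** The mean of G depends on the image measure only. *)
Lemma target_mean_eq T1 T2 : is_transport_map D (lebesgue_on D) nu T1 ->
  is_transport_map D (lebesgue_on D) nu T2 -> target_mean T1 = target_mean T2.
Proof.
move=> t1 t2; rewrite !target_meanE//.
have push T' A : is_transport_map D (lebesgue_on D) nu T' -> measurable A ->
    pushforward (mrestr lambda mD) (extend_map T') A = nu A.
  move=> t mA; rewrite -(t.2 A mA) /pushforward /mrestr /lebesgue_on /=.
  congr (lambda _); apply/seteqP; split => x /=.
    by move=> [AT Dx]; rewrite -extend_mapE.
  by move=> [[Dx AT] _]; rewrite extend_mapE.
have h1 := measurable_extend_map t1.1; have h2 := measurable_extend_map t2.1.
by apply: eq_measure_integral => // A mA _; rewrite [LHS]push// [RHS]push.
Qed.

Variables (T : E -> E) (N : set E).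
Hypothesis tT : is_transport_map D (lebesgue_on D) nu T.
Hypothesis mN : measurable N.
Hypothesis N0 : lambda N = 0%E.
Hypothesis tight : forall x, D x -> ~ N x ->
  [/\ Y (T x), C x (T x) = F x + G (T x) &
      forall y, Y y -> C x y = F x + G y -> y = T x].

Lemma transport_slack_optimal : transport_slack T = 0%E.
Proof.
have mW : measurable (D `&` T @^-1` Y) by exact: tT.1.
rewrite /transport_slack (@ge0_negligible_integral _ _ _ lambda _ N)//.
- apply: integral0_eq => x [[Dx YT] nN]; have [_ -> _] := tight Dx nN.
  by congr EFin; ring.
- by apply/measurable_EFinP; exact: measurable_slack_along.
- exact: slack_along_ge0.
Qed.

(** The slack of T vanishes.  A competitor of the same cost has zero slack too, so
    that it takes almost everywhere the only value that makes F + G <= C tight. *)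
Theorem unique_optimal_of_potentials :
  is_unique_optimal_map D Y C (lebesgue_on D) nu T.
Proof.
have const_fin : ((K + K)%:E * lambda D)%E \is a fin_num.
  by rewrite fin_numM// ge0_fin_numE.
have sfin := source_mean_fin.
have decT := map_cost_decomposition tT.
rewrite transport_slack_optimal add0e in decT.
split; first split => // T' tT'.
  have := map_cost_decomposition tT'; rewrite (target_mean_eq tT' tT) -decT => decT'.
  rewrite -(leeD2rE _ _ const_fin) decT' leeDr//.
  by apply: integral_ge0 => x; exact: slack_along_ge0.
move=> T' [tT' optT'].
have mW : measurable (D `&` T' @^-1` Y) by exact: tT'.1.
have slack0 : transport_slack T' = 0%E.
  have tfin := target_mean_fin tT.
  have := map_cost_decomposition tT'; rewrite (target_mean_eq tT' tT) => decT'.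
  have := optT' T tT; rewrite -(leeD2rE _ _ const_fin) decT' decT.
  have s0 : (0 <= transport_slack T')%E.
    by apply: integral_ge0 => x; exact: slack_along_ge0.
  have Ifin : (\int[lambda]_(x in D) (F x + K)%:E + target_mean T)%E \is a fin_num.
    by apply/fin_numP; move: sfin tfin; set a := (\int[_]_(x in _) _)%E;
      set b := target_mean T; clearbody a b; case: a => //; case: b.
  move: Ifin s0; set I := (_ + _)%E; set sl := transport_slack T'.
  clearbody I sl => Ifin s0; rewrite -[X in (_ <= X)%E]add0e (leeD2rE _ _ Ifin) => s1.
  by apply/eqP; rewrite eq_le s1.
have ms : measurable_fun (D `&` T' @^-1` Y)
    (fun x => (C x (T' x) - F x - G (T' x))%:E).
  by apply/measurable_EFinP; exact: measurable_slack_along.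
have : ae_eq lambda (D `&` T' @^-1` Y)
    (fun x => (C x (T' x) - F x - G (T' x))%:E) (cst 0%E).
  apply/(ae_eq_integral_abs _ mW ms).
  rewrite -[RHS]slack0; apply: eq_integral => x; rewrite inE => Wx.
  by rewrite gee0_abs//; exact: slack_along_ge0.
move=> [M [mM M0 hM]].
apply: (@ae_lebesgue_on _ _ _ (M `|` N `|` (D `\` (D `&` T' @^-1` Y)))).
- exact: mD.
- by apply: measurableU; [exact: measurableU|exact: measurableD].
- apply: measureU_null; [exact: measurableU|exact: measurableD| |].
    exact: measureU_null.
  exact: transport_missing_null.
move=> x Dx nM.
have nN : ~ N x by move=> Nx; apply: nM; left; right.
have Wx : (D `&` T' @^-1` Y) x.
  by apply: contrapT => nW; apply: nM; right.
have [_ _] := tight Dx nN; apply; first by case: Wx.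
apply/eqP; rewrite -subr_eq0 opprD addrA; apply/eqP.
have : ~ ~ ((D `&` T' @^-1` Y) x ->
    (C x (T' x) - F x - G (T' x))%:E = cst 0%E x).
  by move=> h; apply: nM; left; left; exact: hM.
by move=> /contrapT/(_ Wx) [].
Qed.

End optimality_from_potentials.

(** * Complementary slackness *)

Lemma ge0_integral0_null d (X : measurableType d) (R : realType)
    (mu : {measure set X -> \bar R}) (A : set X) (f : X -> R) :
  measurable A -> measurable_fun A f -> (forall x, A x -> 0 <= f x) ->
  (\int[mu]_(x in A) (f x)%:E = 0)%E ->
  measurable (A `&` [set x | 0 < f x]) /\ mu (A `&` [set x | 0 < f x]) = 0%E.
Proof.
move=> mA mf f0 int0.
have mpos : measurable (A `&` [set x | 0 < f x]).
  rewrite (_ : [set x | 0 < f x] = f @^-1` `]0, +oo[%classic); first exact: mf.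
  by apply/seteqP; split => x /=; rewrite in_itv/= andbT.
split => //.
have mfE : measurable_fun A (EFin \o f) by exact/measurable_EFinP.
have : ae_eq mu A (EFin \o f) (cst 0%E).
  apply/(ae_eq_integral_abs _ mA mfE); rewrite -[RHS]int0.
  by apply: eq_integral => x; rewrite inE => Ax; rewrite /= ger0_norm// f0.
move=> [N [mN N0 hN]]; apply/eqP; rewrite eq_le measure_ge0 andbT -[leRHS]N0.
apply: le_measure; rewrite ?inE// => x [Ax /= fx]; apply: hN => /(_ Ax) /= [].
by move=> fx0; rewrite fx0 ltxx in fx.
Qed.

Section complementary_slackness.
Variables (R : realType) (m : nat).
Local Notation E := 'rV[R]_(m + 1).
Variables (B : set 'rV[R]_m) (Y : set E) (c cE : E -> E -> R) (OmX OmY : set E).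
Hypothesis Bc : compact B.
Hypothesis Bi : interior B !=set0.
Hypothesis Yc : compact Y.
Hypothesis Y0 : Y !=set0.
Hypothesis hc : cost_assumptions B Y c.
Hypothesis twist : extended_twist B Y c OmX OmY cE.
Variables (nu : probability E R) (yext : E).
Hypothesis nuY : nu Y = 1%E.
Hypothesis nYyext : ~ Y yext.
Variables (psi : E -> R) (y0 : E).
Hypothesis psimax : is_maximiser_G B Y c nu psi.
Hypothesis Yy0 : Y y0.
Local Notation lambda := (lebesgue_rV R (m + 1)).
Local Notation Ye := (ext_Y Y yext).
Local Notation cyl := (cylinder B).
Local Notation f := (potential Y cE psi).
Local Notation tau := (tau_of B Y c psi).
Local Notation S := (sublevel B Y cE psi tau).
Local Notation u := (ext_family cE yext psi tau).
Local Notation T := (ext_map B Y c cE OmX yext psi y0).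

Let psic : {within Y, continuous psi} := psimax.1.
Let XOm := twist_subX twist.
Let tw := ext_family_twisted tau Yc nYyext twist psic.

Let mcyl : measurable cyl.
Proof. exact: measurable_cylinder (base_measurable Bc). Qed.

Let mY : measurable Y.
Proof. exact: closed_measurable_mx (target_closed Yc). Qed.

Let mf : measurable_fun cyl f.
Proof. exact: (measurable_potential Bc Yc Y0 twist psic). Qed.

Let mpsi : measurable_fun Y psi.
Proof. exact: within_continuous_measurable_rV. Qed.

Let mS : measurable S.
Proof. exact: (measurable_sublevel Bc Yc Y0 twist psic tau). Qed.

Let S1 : lambda S = 1%E.
Proof. by have [_] := tau_ofP Bc Bi Yc Y0 hc twist psic. Qed.

Let SC : S `<=` cyl. Proof. by move=> x []. Qed.

Lemma measurable_cost :
  measurable_fun (cyl `*` Y) (fun z : E * E => cE z.1 z.2).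
Proof.
apply: within_continuous_measurable_prod; first exact: measurableX.
apply: continuous_in_subspaceT => z; rewrite inE => -[Xz Yz].
apply: differentiable_continuous.
by have [] := twist_C1 twist (conj (XOm Xz) (twist_subY twist Yz)).
Qed.

(** The slack of the dual constraint f x + psi y <= c(x, y). *)
Definition gap (z : E * E) : R := cE z.1 z.2 - psi z.2 - f z.1.

Lemma gap_ge0 z : (cyl `*` Y) z -> 0 <= gap z.
Proof.
move=> [Xz Yz]; have := potential_le Yc Y0 twist psic (XOm Xz) Yz.
by rewrite /gap; lra.
Qed.

Lemma measurable_gap : measurable_fun (cyl `*` Y) gap.
Proof.
apply: measurable_funB; first apply: measurable_funB.
- exact: measurable_cost.
- apply: (measurable_comp mY _ mpsi); first by move=> _ [z [_ Yz] <-].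
  exact: measurable_funTS measurable_snd.
- apply: (measurable_comp mcyl _ mf); first by move=> _ [z [Xz _] <-].
  exact: measurable_funTS measurable_fst.
Qed.

Section coupling.
Variables (D : set E) (g : {measure set (E * E) -> \bar R}).
Hypothesis mD : measurable D.
Hypothesis DC : D `<=` cyl.
Hypothesis D1 : lambda D = 1%E.
Hypothesis cg : couplings (lebesgue_on D) nu g.

Let gl A : measurable A -> g (A `*` setT) = lambda (A `&` D).
Proof. by move=> /cg[]. Qed.

Let gr A : measurable A -> g (setT `*` A) = nu A.
Proof. by move=> /cg[]. Qed.

Lemma coupling_off_target : g (setT `*` ~` Y) = 0%E.
Proof.
rewrite gr; last exact: measurableC.
by rewrite probability_setC// nuY subee.
Qed.

Lemma coupling_off_source (A : set E) : measurable A -> lambda (A `&` D) = 0%E ->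
  g (A `*` setT) = 0%E.
Proof. by move=> mA <-; exact: gl. Qed.

Lemma coupling_off_domain : g (~` D `*` setT) = 0%E.
Proof.
by apply: coupling_off_source; [exact: measurableC|rewrite setICl measure0].
Qed.

Lemma coupling_mass : g (cyl `*` Y) = 1%E.
Proof.
transitivity (g (cyl `*` setT)).
  apply: (@measure_eq_off_null _ _ _ g _ _ (setT `*` ~` Y)).
  - exact: measurableX.
  - exact: measurableX.
  - by apply: measurableX => //; exact: measurableC.
  - exact: coupling_off_target.
  - move=> [x y] /= nY; split => [[]//|[Cx _]]; split => //=.
    by apply: contrapT => nYy; apply: nY.
by rewrite gl// setIidr.
Qed.

Lemma coupling_integral_fst (h : E -> R) : measurable_fun cyl h ->
  (forall x, cyl x -> 0 <= h x) ->
  (\int[g]_(z in cyl `*` Y) (h z.1)%:E = \int[lambda]_(x in D) (h x)%:E)%E.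
Proof.
move=> mh h0; have mhE : measurable_fun cyl (EFin \o h) by exact/measurable_EFinP.
have -> : cyl `*` Y = (fst @^-1` cyl) `\` (setT `*` ~` Y).
  apply/seteqP; split => [[x y] [Cx Yy]|[x y] [Cx nY]]; split => //=.
    by move=> [].
  by apply: contrapT => nYy; apply: nY.
have mpre : measurable ((@fst E E) @^-1` cyl).
  by rewrite -[X in measurable X]setTI; exact: measurable_fst.
rewrite -ge0_negligible_integral//; last 4 first.
- by apply: measurableX => //; exact: measurableC.
- apply/measurable_EFinP; apply: (measurable_comp mcyl _ mh); first by move=> _ [z + <-].
  exact: measurable_funTS measurable_fst.
- by move=> z Cz; rewrite lee_fin h0.
- exact: coupling_off_target.
transitivity (\int[pushforward g fst]_(x in cyl) (h x)%:E)%E.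
  rewrite [RHS]ge0_integral_pushforward//.
  by move=> y; rewrite inE => Cy; rewrite lee_fin h0.
transitivity (\int[mrestr lambda mD]_(x in cyl) (h x)%:E)%E.
  apply: eq_measure_integral => A mA _.
  rewrite /= /pushforward /mrestr -gl//; congr (g _).
  by apply/seteqP; split => [[x y] //=|[x y] []].
by rewrite ge0_integral_mrestr// setIidr.
Qed.

Lemma coupling_integral_snd (h : E -> R) : measurable_fun Y h ->
  (forall y, Y y -> 0 <= h y) ->
  (\int[g]_(z in cyl `*` Y) (h z.2)%:E = \int[nu]_(y in Y) (h y)%:E)%E.
Proof.
move=> mh h0; have mhE : measurable_fun Y (EFin \o h) by exact/measurable_EFinP.
have -> : cyl `*` Y = (snd @^-1` Y) `\` (~` cyl `*` setT).
  apply/seteqP; split => [[x y] [Cx Yy]|[x y] [Yy nC]]; split => //=.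
    by move=> [].
  by apply: contrapT => nCx; apply: nC.
have mpre : measurable ((@snd E E) @^-1` Y).
  by rewrite -[X in measurable X]setTI; exact: measurable_snd.
rewrite -ge0_negligible_integral//; last 4 first.
- by apply: measurableX => //; exact: measurableC.
- apply/measurable_EFinP; apply: (measurable_comp mY _ mh); first by move=> _ [z + <-].
  exact: measurable_funTS measurable_snd.
- by move=> z Cz; rewrite lee_fin h0.
- apply: coupling_off_source; first exact: measurableC.
  by rewrite -[RHS](@measure0 _ _ _ lambda); congr (lambda _); apply/seteqP; split => // x [nC /DC].
transitivity (\int[pushforward g snd]_(x in Y) (h x)%:E)%E.
  rewrite [RHS]ge0_integral_pushforward//.
  by move=> y; rewrite inE => Cy; rewrite lee_fin h0.
apply: eq_measure_integral => A mA _.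
rewrite /= /pushforward -gr//; congr (g _).
by apply/seteqP; split => [[x y] //=|[x y] []].
Qed.

(** The cost of a plan is the integral of the gap plus terms that depend on the
    marginals only. *)
Lemma plan_cost_decomposition (K : R) : 0 <= K -> (forall y, Y y -> `|psi y| <= K) ->
  (plan_cost cyl Y c g + (K + K)%:E =
   \int[g]_(z in cyl `*` Y) (gap z)%:E +
   (\int[lambda]_(x in D) (f x + K)%:E + \int[nu]_(y in Y) (psi y + K)%:E))%E.
Proof.
move=> K0 hK; have mCY : measurable (cyl `*` Y) by exact: measurableX.
have f0 x : cyl x -> 0 <= f x + K.
  move=> Cx; have := potential_ge Yc Y0 hc twist psic (K := K) _ Cx.
  rewrite -lerBlDr sub0r; apply => y Yy; exact: le_trans (ler_norm _) (hK y Yy).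
have psi0 y : Y y -> 0 <= psi y + K.
  by move=> Yy; have := hK y Yy; rewrite ler_norml; lra.
have mfK : measurable_fun cyl (fun x => f x + K) by exact: measurable_funD.
have mpsiK : measurable_fun Y (fun y => psi y + K) by exact: measurable_funD.
rewrite -(coupling_integral_fst mfK f0) -(coupling_integral_snd mpsiK psi0).
have mf1 : measurable_fun (cyl `*` Y) (fun z : E * E => (f z.1 + K)%:E).
  apply/measurable_EFinP; apply: (measurable_comp mcyl _ mfK).
    by move=> _ [z [Xz _] <-].
  exact: measurable_funTS measurable_fst.
have mpsi1 : measurable_fun (cyl `*` Y) (fun z : E * E => (psi z.2 + K)%:E).
  apply/measurable_EFinP; apply: (measurable_comp mY _ mpsiK).
    by move=> _ [z [_ Yz] <-].
  exact: measurable_funTS measurable_snd.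
have mgapE : measurable_fun (cyl `*` Y) (fun z => (gap z)%:E).
  by apply/measurable_EFinP; exact: measurable_gap.
have mc : measurable_fun (cyl `*` Y) (fun z : E * E => (cE z.1 z.2)%:E).
  by apply/measurable_EFinP; exact: measurable_cost.
rewrite -(ge0_integralD g mCY _ mf1 _ mpsi1); last 2 first.
- by move=> z [Xz _]; rewrite lee_fin f0.
- by move=> z [_ Yz]; rewrite lee_fin psi0.
rewrite -(ge0_integralD g mCY _ mgapE); last 3 first.
- by move=> z Cz; rewrite lee_fin gap_ge0.
- by move=> z [Xz Yz]; rewrite -EFinD lee_fin addr_ge0 ?f0 ?psi0.
- exact: emeasurable_funD.
rewrite /plan_cost -[(K + K)%:E]mule1 -coupling_mass -(integral_cst g mCY).
rewrite [X in (X + _)%E](eq_integral (fun z : E * E => (cE z.1 z.2)%:E)); last first.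
  by move=> z; rewrite inE => -[Xz Yz]; rewrite (twist_extends twist).
rewrite -(ge0_integralD g mCY _ mc); last 3 first.
- by move=> z [Xz Yz]; rewrite lee_fin (twist_extends twist)// (cost_ge0 hc).
- by move=> z _; rewrite lee_fin addr_ge0.
- exact: measurable_cst.
apply: eq_integral => z _; rewrite -!EFinD; congr EFin; rewrite /gap; lra.
Qed.

End coupling.

Local Notation p0 := (pbar_of B Y c psi).

Let graph (x : E) : E * E := (x, T x).

Let measurable_graph : measurable_fun setT graph.
Proof.
apply: measurable_fun_pair; first exact: measurable_id.
exact: (measurable_ext_map Yc twist nYyext y0 psimax).
Qed.

(** Off a null set the minimiser is unique and f differs from tau, so that the
    position of x with respect to S decides between Y and yext. *)
Lemma generic_points : exists Z, [/\ measurable Z, lambda Z = 0%E &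
  forall x, cyl x -> ~ Z x -> unique_argmin Ye u x /\ f x != tau].
Proof.
have [N [mN N0 NOm NE]] := non_unique_null tw.
have mlev := level_set_measurable Bc Yc Y0 twist psic tau.
exists (N `|` (cyl `&` [set x | f x = tau])); split.
- exact: measurableU.
- by apply: measureU_null => //; exact: (level_set_null Bc Yc Y0 hc twist psic tau).
- move=> x Cx nZ; split.
    by apply: contrapT => nu'; apply: nZ; left; apply/(NE x (XOm Cx)).
  by apply/eqP => fx; apply: nZ; right.
Qed.

Lemma gap_ext_map x : cyl x -> unique_argmin Ye u x -> f x < tau ->
  Y (T x) /\ gap (x, T x) = 0.
Proof.
move=> Cx ux fx.
have [YT fE] := ext_map_below Yc Y0 twist nYyext psimax Yy0 (XOm Cx) ux fx.
by split => //; rewrite /gap /= fE; ring.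
Qed.

(** A zero gap means that y is a minimiser at x. *)
Lemma gap0_ext_map x y : cyl x -> Y y -> unique_argmin Ye u x -> f x < tau ->
  gap (x, y) = 0 -> y = T x.
Proof.
move=> Cx Yy ux fx; rewrite /gap /= => g0.
have : argmin Ye u x y.
  apply: (argminE (family_compact tw) (family_nonempty tw) (family_continuous tw)).
  - exact: XOm.
  - by left.
  - rewrite (ext_envelopeE Yc Y0 twist nYyext tau psic (XOm Cx)) (min_l (ltW fx)).
    by rewrite (ext_family_in _ _ _ nYyext)//; lra.
by rewrite (ext_map_argmin y0 (XOm Cx) ux).
Qed.

Lemma zero_gap_coupling : exists2 g : {measure set (E * E) -> \bar R},
  couplings (lebesgue_on S) nu g & (\int[g]_(z in cyl `*` Y) (gap z)%:E = 0)%E.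
Proof.
pose mu : {measure set E -> \bar R} := mrestr lambda mS.
have [g gE] : exists g : {measure set (E * E) -> \bar R},
    g = pushforward mu graph :> (set _ -> _).
  unshelve eexists (pushforward mu graph : {measure set (E * E) -> \bar R}) => //.
have mpre A : measurable A -> measurable (graph @^-1` A).
  by move=> mA; rewrite -[X in measurable X]setTI; exact: measurable_graph.
exists g => [A mA|].
  rewrite gE /pushforward /mu /= /mrestr /lebesgue_on; split.
    by congr (lambda _); apply/seteqP; split => [x [[]]|x []].
  rewrite (target_measure_transported Bc Bi Yc Y0 hc twist nuY nYyext psimax Yy0 mA).
  by congr (lambda _); apply/seteqP; split => [x [[_ +] Sx]|x [Sx]].
have mCY : measurable (cyl `*` Y) by exact: measurableX.
have [Z [mZ Z0 hZ]] := generic_points.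
transitivity (\int[mu]_(x in graph @^-1` (cyl `*` Y)) (gap (graph x))%:E)%E.
  rewrite -[RHS](@ge0_integral_pushforward _ _ _ _ _ graph _ mu _ (fun z => (gap z)%:E) mCY)//.
  - by apply: eq_measure_integral => A mA _; rewrite gE.
  - by apply/measurable_EFinP; exact: measurable_gap.
  - by move=> z; rewrite inE => Cz; rewrite lee_fin gap_ge0.
rewrite (@ge0_negligible_integral _ _ _ mu _ (Z `|` ~` S)); last 5 first.
- by apply: measurableU => //; exact: measurableC.
- exact: mpre.
- apply/measurable_EFinP; apply: (measurable_comp mCY _ measurable_gap).
    by move=> _ [x + <-].
  exact: measurable_funTS measurable_graph.
- by move=> x Cx; rewrite lee_fin gap_ge0.
- apply: measureU_null => //; first exact: measurableC.
    have : lambda (Z `&` S) = 0%E by apply: (subset_measure0 _ _ _ Z0) => //; exact: measurableI.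
    by [].
  by rewrite /mu /= /mrestr setICl measure0.
apply: integral0_eq => x [_ nZS].
have Sx : S x by apply: contrapT => nS; apply: nZS; right.
have [|ux fx] := hZ x (SC Sx); first by move=> Zx; apply: nZS; left.
have flt : f x < tau by rewrite lt_neqAle fx; case: Sx.
by have [_ ->] := gap_ext_map (SC Sx) ux flt.
Qed.

Section minimiser.
Variables (p : 'rV[R]_m -> R) (gamma : {measure set (E * E) -> \bar R}).
Hypothesis pmin : is_minimiser_F B Y c nu p.
Hypothesis gopt : is_optimal_plan cyl Y c (mu_of B p) nu gamma.
Local Notation D := (subgraph B p).

Let mD : measurable D.
Proof. by apply: measurable_subgraph; [exact: base_measurable|case: pmin.1]. Qed.

Let DC : D `<=` cyl. Proof. by move=> x [Bx /andP[]]. Qed.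

Let D1 : lambda D = 1%E.
Proof. by case: pmin.1 => *; rewrite lebesgue_subgraph//; exact: base_measurable. Qed.

Let cgamma : couplings (lebesgue_on D) nu gamma := gopt.1.

(** The set S represents the density attached to psi, so that g is also a plan
    for that density; the rest is minimality of gamma and of p. *)
Lemma plan_cost_le (g : {measure set (E * E) -> \bar R}) :
  couplings (lebesgue_on S) nu g ->
  (plan_cost cyl Y c gamma <= plan_cost cyl Y c g)%E.
Proof.
move=> cg; have [dens _] := tau_ofP Bc Bi Yc Y0 hc twist psic.
apply: (@le_trans _ _ (Ffun B Y c nu p)).
  by apply/ereal_infP => _ [g' cg' <-]; exact: gopt.2.
apply: (le_trans (pmin.2 _ dens)); apply: ereal_inf_lbound; exists g => // A mA.
have [gA ->] := cg A mA; split => //; rewrite gA /mu_of /lebesgue_on.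
exact/esym/(lebesgue_subgraph_level Bc Yc Y0 hc twist psic).
Qed.

Let excess := (\int[lambda]_(x in D) (Num.max (f x - tau) 0)%:E)%E.
Let shortfall := (\int[lambda]_(x in cyl `\` D) (Num.max (tau - f x) 0)%:E)%E.
Let gap_cost := (\int[gamma]_(z in cyl `*` Y) (gap z)%:E)%E.

(** By the cost decomposition and the bathtub identity, the cost of gamma is that
    of the zero-gap coupling plus these three non-negative quantities, while by
    optimality it is not greater. *)
Lemma no_slack : [/\ gap_cost = 0, excess = 0 & shortfall = 0]%E.
Proof.
have [K K0 hK] := psi_bounded Yc psic.
have psiK y : Y y -> psi y <= K by move=> Yy; exact: le_trans (ler_norm _) (hK y Yy).
have fK := potential_ge Yc Y0 hc twist psic psiK.
have tK : 0 <= tau + K.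
  have [x [Cx /= fx]] : S !=set0.
    apply/set0P/eqP => S0'; move: S1; rewrite S0' measure0 => /eqP.
    by rewrite eq_sym onee_eq0.
  by have := fK x Cx; lra.
have [g cg g0] := zero_gap_coupling.
have := plan_cost_decomposition mS SC S1 cg K0 hK; rewrite g0 add0e => costg.
have := plan_cost_decomposition mD DC D1 cgamma K0 hK => costgamma.
have := plan_cost_le cg.
have := bathtub mcyl mS SC S1 mf tK fK.
have := bathtub mcyl mD DC D1 mf tK fK.
rewrite (_ : (\int[lambda]_(x in S) (Num.max (f x - tau) 0)%:E = 0)%E); last first.
  by apply: integral0_eq => x [_ /= fx]; rewrite max_r// subr_le0.
rewrite (_ : (\int[lambda]_(x in cyl `\` S) (Num.max (tau - f x) 0)%:E = 0)%E); last first.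
  apply: integral0_eq => x [Cx nS]; rewrite max_r// subr_le0 leNgt.
  by apply/negP => fx; apply: nS; split => //; exact: ltW.
rewrite -/excess -/shortfall; move: costg costgamma; rewrite -/gap_cost.
have := deficit_fin Bc Yc Y0 hc twist psi psic psiK; rewrite /deficit.
have : (\int[nu]_(y in Y) (psi y + K)%:E)%E \is a fin_num.
  apply: (integrable_fin_num (mu := nu) mY).
  apply: (target_fin Yc nuY (phi := fun y => psi y + K)).
  apply/subspace_continuousP => y Yy; apply: cvgD; last exact: cvg_cst.
  by have /subspace_continuousP/(_ y Yy) := psic.
have : (0 <= gap_cost)%E.
  by apply: integral_ge0 => z Cz; rewrite lee_fin gap_ge0.
have : (0 <= excess)%E.
  by apply: integral_ge0 => x _; rewrite lee_fin le_max lexx orbT.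
have : (0 <= shortfall)%E.
  by apply: integral_ge0 => x _; rewrite lee_fin le_max lexx orbT.
set a := gap_cost; set e1 := excess; set e2 := shortfall.
set n := (\int[nu]_(y in Y) _)%E; set d := (\int[lambda]_(x in cyl) _)%E.
set I1 := (\int[lambda]_(x in D) _)%E; set I2 := (\int[lambda]_(x in S) _)%E.
set P := plan_cost _ _ _ gamma; set Q := plan_cost _ _ _ g.
clearbody a e1 e2 n d I1 I2 P Q.
case: n => // n; case: d => // d; case: I2 => [I2| |] //; case: Q => [Q| |] //.
case: a => [a| |] //; case: e1 => [e1| |] //; case: e2 => [e2| |] //.
all: case: I1 => [I1| |] //; case: P => [P| |] //.
rewrite -!EFinD !lee_fin => e20 e10 a0 _ _ [q1] [q2] [q3] [q4] q5.
by split; congr EFin; lra.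
Qed.

Lemma minimiser_sublevel : exists M, [/\ measurable M, lambda M = 0%E &
  forall x, cyl x -> ~ M x ->
    [/\ unique_argmin Ye u x, f x != tau & D x <-> f x < tau]].
Proof.
have [_ e0 s0] := no_slack; have [Z [mZ Z0 hZ]] := generic_points.
have mpos A : measurable A -> A `<=` cyl ->
    measurable_fun A (fun x => Num.max (f x - tau) 0) /\
    measurable_fun A (fun x => Num.max (tau - f x) 0).
  by move=> mA AC; split; apply: measurable_maxr => //; apply: measurable_funB => //;
    exact: measurable_funS mf.
have CDC : cyl `\` D `<=` cyl by move=> x [].
have mCD : measurable (cyl `\` D) by exact: measurableD.
have max0 A (h : E -> R) : forall x, A x -> 0 <= Num.max (h x) 0.
  by move=> x _; rewrite le_max lexx orbT.
have [m1 n1] := ge0_integral0_null mD (mpos D mD DC).1 (max0 _ _) e0.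
have [m2 n2] := ge0_integral0_null mCD (mpos _ mCD CDC).2 (max0 _ _) s0.
set M1 := D `&` _ in m1 n1; set M2 := (cyl `\` D) `&` _ in m2 n2.
exists (Z `|` M1 `|` M2); split.
- by apply: measurableU => //; exact: measurableU.
- by apply: measureU_null => //; [exact: measurableU|exact: measureU_null].
move=> x Cx nM.
have [ux fx] : unique_argmin Ye u x /\ f x != tau.
  by apply: hZ => // Zx; apply: nM; left; left.
split => //; split => [Dx|flt].
  rewrite lt_neqAle fx leNgt; apply/negP => fgt; apply: nM; left; right.
  by split => //=; rewrite lt_max subr_gt0 fgt.
apply: contrapT => nDx; apply: nM; right; split => //=.
by rewrite lt_max subr_gt0 flt.
Qed.

(** Almost every (x, y) for gamma has zero gap, hence y = T x. *)
Lemma optimal_plan_graph A : measurable A ->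
  gamma A = lambda (D `&` [set x | A (x, T x)]).
Proof.
move=> mA; have mgA : measurable [set x | A (x, T x)].
  by rewrite -[X in measurable X]setTI; exact: measurable_graph.
have [g0 _ _] := no_slack; have [M [mM M0 hM]] := minimiser_sublevel.
have mCY : measurable (cyl `*` Y) by exact: measurableX.
have [mG G0] := ge0_integral0_null mCY measurable_gap gap_ge0 g0.
set G := _ `&` _ in mG G0.
transitivity (gamma ([set x | A (x, T x)] `*` setT)); last first.
  by rewrite (cgamma mgA).1 /lebesgue_on setIC.
apply: (@measure_eq_off_null _ _ _ gamma _ _
  (G `|` (M `*` setT) `|` (~` D `*` setT) `|` (setT `*` ~` Y))) => //.
- exact: measurableX.
- by do 3?[apply: measurableU => //]; apply: measurableX => //; exact: measurableC.
- have mMT : measurable (M `*` [set: E]) by exact: measurableX.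
  have mDT : measurable (~` D `*` [set: E]).
    by apply: measurableX => //; exact: measurableC.
  have mTY : measurable ([set: E] `*` ~` Y).
    by apply: measurableX => //; exact: measurableC.
  apply: measureU_null => //; first by do 2?[apply: measurableU => //].
    apply: measureU_null => //; first exact: measurableU.
      apply: measureU_null => //; apply: (coupling_off_source cgamma mM).
      by apply: (subset_measure0 _ _ _ M0) => //; exact: measurableI.
    exact: (coupling_off_domain mD cgamma).
  exact: (coupling_off_target cgamma).
move=> [x y] nN.
have Yy : Y y by apply: contrapT => nY; apply: nN; right.
have Dx : D x by apply: contrapT => nD; apply: nN; left; right.
have Cx := DC Dx.
have [|ux fx Df] := hM x Cx; first by move=> Mx; apply: nN; left; left; right.
have gap0 : gap (x, y) = 0.
  apply/eqP; rewrite eq_le gap_ge0// andbT leNgt; apply/negP => gpos.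
  by apply: nN; left; left; left.
have -> : y = T x by apply: gap0_ext_map gap0 => //; exact/Df.
by split => [|[]].
Qed.

End minimiser.

End complementary_slackness.

(** * The extended transport problem *)

Section extended_problem.
Variables (R : realType) (m : nat).
Local Notation E := 'rV[R]_(m + 1).
Variables (B : set 'rV[R]_m) (Y : set E) (c cE : E -> E -> R) (OmX OmY : set E).
Hypothesis Bc : compact B.
Hypothesis Bi : interior B !=set0.
Hypothesis Yc : compact Y.
Hypothesis Y0 : Y !=set0.
Hypothesis hc : cost_assumptions B Y c.
Hypothesis twist : extended_twist B Y c OmX OmY cE.
Variables (nu : probability E R) (yext : E) (P : R).
Hypothesis nuY : nu Y = 1%E.
Hypothesis nYyext : ~ Y yext.
Hypothesis P0 : 0 < P.
Hypothesis bound : is_uniform_bound B Y c P.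
Variables (psi : E -> R) (y0 : E).
Hypothesis psimax : is_maximiser_G B Y c nu psi.
Hypothesis Yy0 : Y y0.
Local Notation lambda := (lebesgue_rV R (m + 1)).
Local Notation Ye := (ext_Y Y yext).
Local Notation cyl := (cylinder B).
Local Notation f := (potential Y cE psi).
Local Notation tau := (tau_of B Y c psi).
Local Notation S := (sublevel B Y cE psi tau).
Local Notation u := (ext_family cE yext psi tau).
Local Notation T := (ext_map B Y c cE OmX yext psi y0).
Local Notation X_P := (slab B P).
Local Notation ce := (ext_c c yext).
Local Notation psi_e := (ext_psi psi tau yext).
Local Notation F := (envelope Ye u).

Let psic : {within Y, continuous psi} := psimax.1.
Let XOm := twist_subX twist.
Let tw := ext_family_twisted tau Yc nYyext twist psic.
Let Fc := family_continuous tw.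

Let mcyl : measurable cyl.
Proof. exact: measurable_cylinder (base_measurable Bc). Qed.

Let mY : measurable Y.
Proof. exact: closed_measurable_mx (target_closed Yc). Qed.

Let mf : measurable_fun cyl f.
Proof. exact: (measurable_potential Bc Yc Y0 twist psic). Qed.

Let mS : measurable S.
Proof. exact: (measurable_sublevel Bc Yc Y0 twist psic tau). Qed.

Let S1 : lambda S = 1%E.
Proof. by have [_] := tau_ofP Bc Bi Yc Y0 hc twist psic. Qed.

Let mX : measurable X_P. Proof. exact: measurable_slab. Qed.

Let XC : X_P `<=` cyl. Proof. by move=> x /slab_le. Qed.

Let mT : measurable_fun setT T.
Proof. exact: (measurable_ext_map Yc twist nYyext y0 psimax). Qed.

Let mpreT A : measurable A -> measurable (T @^-1` A).
Proof. by move=> mA; rewrite -[X in measurable X]setTI; exact: mT. Qed.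

Let msing : measurable [set yext].
Proof.
apply: closed_measurable_mx; apply: compact_closed; first exact: norm_hausdorff.
exact: compact_set1.
Qed.

Let mYe : measurable Ye. Proof. exact: measurableU. Qed.

Let nuYC : nu (~` Y) = 0%E.
Proof. by rewrite probability_setC// nuY subee. Qed.

(** This is where the uniform bound on the densities is used; on the bottom of the
    cylinder, where the subgraph may differ from S, positivity of P suffices. *)
Lemma sublevel_sub_slab : S `<=` X_P.
Proof.
move=> x [[Bx h0] fx]; split => //; rewrite h0 /=.
have [hx|] := ltP 0 (height x); last by move=> /le_trans; apply; exact: ltW.
have [_ /andP[_ hp]] : subgraph B (level_profile Y c psi tau) x.
  by apply/(subgraph_level_profile Bc Yc Y0 hc twist psic tau hx).
exact: le_trans hp (bound psic Bx).
Qed.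

Lemma slab_rest_mass :
  (lambda (X_P `\` S) = P%:E * lebesgue_rV R m B - 1)%E.
Proof.
rewrite (measureD mX mS); last exact: lebesgue_slab_fin.
rewrite setIidr; last exact: sublevel_sub_slab.
by rewrite [X in (_ - X)%E]S1 [X in (X - _)%E](lebesgue_slab Bc (ltW P0)).
Qed.

(** On S the map transports Lebesgue measure to nu, and it sends almost all of the
    rest of the slab to yext. *)
Lemma ext_transport_map : is_transport_map X_P (ext_mu B P) (ext_nu B nu P yext) T.
Proof.
split; first exact: measurable_funTS mT.
move=> A mA; have mTA := mpreT mA.
have mW : measurable (X_P `&` T @^-1` A) by exact: measurableI.
have [Z [mZ Z0 hZ]] := generic_points Bc Yc Y0 hc twist nYyext psimax.
rewrite /ext_mu /lebesgue_on setIAC setIid (measureDI lambda mW mS) addeC.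
rewrite /ext_nu -slab_rest_mass; congr (_ + _)%E.
  rewrite (target_measure_transported Bc Bi Yc Y0 hc twist nuY nYyext psimax Yy0 mA).
  congr (lambda _); apply/seteqP; split => [x [[_ TA] Sx]//|x [Sx TA]].
  by split => //; split => //; exact: sublevel_sub_slab.
have out x : (X_P `\` S) x -> ~ Z x -> T x = yext.
  move=> [Xx nS] nZ; have [ux fx] := hZ x (XC Xx) nZ.
  apply: (ext_map_above Yc Y0 twist nYyext psimax Yy0 (XOm (XC Xx)) ux).
  rewrite ltNge le_eqVlt (negbTE fx) /=; apply/negP => flt; apply: nS.
  by split; [exact: XC|exact: ltW].
have mWS : measurable ((X_P `&` T @^-1` A) `\` S) by exact: measurableD.
have mXS : measurable (X_P `\` S) by exact: measurableD.
rewrite diracE; have [Ay|nAy] := pselect (A yext).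
  rewrite mem_set// mule1; apply: (measure_eq_off_null mWS mXS mZ Z0) => x nZ.
  split => [[[]]//|XSx]; case: (XSx) => Xx nSx.
  by do 2?split => //=; rewrite (out x XSx nZ).
rewrite memNset// mule0 -[RHS](@measure0 _ _ _ lambda).
apply: (measure_eq_off_null mWS measurable0 mZ Z0) => x nZ; split => // -[[Xx TA] nSx].
by apply: nAy; rewrite -(out x _ nZ).
Qed.

Lemma ext_c_extends x y : cyl x -> Ye y -> ext_c cE yext x y = ce x y.
Proof.
rewrite /ext_c; case: eqP => // yy Cx [Yy|//].
exact: (twist_extends twist).
Qed.

Lemma ext_slack x y : cyl x -> Ye y -> F x + psi_e y <= ce x y.
Proof.
move=> Cx Yy; have := envelope_le (family_compact tw) (family_nonempty tw) Fc (XOm Cx) Yy.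
by rewrite /ext_family ext_c_extends//; lra.
Qed.

Lemma ext_tight x : cyl x -> unique_argmin Ye u x ->
  [/\ Ye (T x), ce x (T x) = F x + psi_e (T x) &
      forall y, Ye y -> ce x y = F x + psi_e y -> y = T x].
Proof.
move=> Cx ux; have argT := ext_map_argmin y0 (XOm Cx) ux.
have YT := ext_map_in B c cE OmX yext psi Yy0 x.
split => // [|y Yy cF].
  rewrite (envelope_eq (y := T x)) ?argT//.
  by rewrite /ext_family ext_c_extends//; lra.
have : argmin Ye u x y.
  apply: (argminE (family_compact tw) (family_nonempty tw) Fc (XOm Cx) Yy).
  by rewrite /ext_family ext_c_extends//; lra.
by rewrite argT.
Qed.

Lemma measurable_ext_envelope : measurable_fun cyl F.
Proof.
apply: (eq_measurable_fun (fun x => Num.min (f x) tau)).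
  move=> x; rewrite inE => Cx.
  by rewrite (ext_envelopeE Yc Y0 twist nYyext tau psic (XOm Cx)).
exact: measurable_minr.
Qed.

(** Bounds for the potentials; F is bounded although f is not, thanks to the
    truncation at tau. *)
Lemma ext_bounded : exists K, [/\ forall x, cyl x -> `|F x| <= K,
  forall y, Ye y -> `|psi_e y| <= K & forall y, Y y -> `|psi y| <= K].
Proof.
have [K K0 hK] := psi_bounded Yc psic.
set K' := Num.max K `|tau|; exists K'.
have KK' : K <= K' by rewrite le_max lexx.
have /andP[tau1 tau2] : - K' <= tau <= K' by rewrite -ler_norml le_max lexx orbT.
have psiK' y : Y y -> `|psi y| <= K' by move=> Yy; exact: le_trans (hK y Yy) KK'.
split => [x Cx|y|//].
  rewrite (ext_envelopeE Yc Y0 twist nYyext tau psic (XOm Cx)) ler_norml le_min ge_min.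
  rewrite tau1 tau2 orbT !andbT.
  apply: (potential_ge Yc Y0 hc twist psic _ Cx) => y Yy.
  exact: le_trans (ler_norm _) (psiK' y Yy).
rewrite /ext_psi; case: eqP => [_ _|yy [Yy|//]]; last exact: psiK'.
by rewrite normrN le_max lexx orbT.
Qed.

Lemma measurable_ext_cost : measurable_fun (cyl `*` Ye) (fun z : E * E => ce z.1 z.2).
Proof.
rewrite (_ : cyl `*` Ye = (cyl `*` Y) `|` (cyl `*` [set yext])); last first.
  apply/seteqP; split => [[x y] /= [Cx [Yy|yy]]|[x y] [[Cx Yy]|[Cx yy]]].
  - by left.
  - by right.
  - by split => //; left.
  - by split => //; right.
apply/measurable_funU; [exact: measurableX|exact: measurableX|split].
  apply: (eq_measurable_fun (fun z : E * E => cE z.1 z.2)); last exact: (measurable_cost Bc Yc twist).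
  move=> [x y]; rewrite inE => -[/= Cx Yy]; rewrite /ext_c (twist_extends twist)//.
  by case: eqP => // yy; rewrite yy in Yy.
apply: (eq_measurable_fun (cst (0 : R))); last exact: measurable_cst.
by move=> [x y]; rewrite inE => -[/= _ ->]; rewrite /ext_c eqxx.
Qed.

Lemma measurable_ext_psi : measurable_fun Ye psi_e.
Proof.
apply/measurable_funU => //; split.
  apply: (eq_measurable_fun psi); last exact: within_continuous_measurable_rV.
  move=> y; rewrite inE => Yy; rewrite /ext_psi.
  by case: eqP => // yy; rewrite yy in Yy.
apply: (eq_measurable_fun (cst (- tau : R))); last exact: measurable_cst.
by move=> y; rewrite inE => /= ->; rewrite /ext_psi eqxx.
Qed.

Theorem ext_map_optimal :
  is_unique_optimal_map X_P Ye ce (ext_mu B P) (ext_nu B nu P yext) T.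
Proof.
have [Z [mZ Z0 hZ]] := generic_points Bc Yc Y0 hc twist nYyext psimax.
have [K [FK GK _]] := ext_bounded.
apply: (@unique_optimal_of_potentials _ _ X_P Ye ce F psi_e K _ _ _ _ _ _ _ _ _ _ _ _ T Z) => //.
- exact: lebesgue_slab_fin.
- apply: measurable_funS measurable_ext_cost; first exact: measurableX.
  by move=> [x y] [/= Xx Yy]; split => //; exact: XC.
- exact: measurable_funS measurable_ext_envelope.
- exact: measurable_ext_psi.
- by move=> x /XC; exact: FK.
- move=> x y Xx Yy; rewrite /ext_c; case: eqP => // yy; case: Yy => // Yy.
  by rewrite (cost_ge0 hc)//; exact: XC.
- by move=> x y /XC; exact: ext_slack.
- rewrite /ext_nu diracE memNset ?mule0 ?adde0; last by apply; right.
  apply: (subset_measure0 (B := ~` Y)).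
  + exact: measurableC.
  + exact: measurableC.
  + by move=> y nYe Yy; apply: nYe; left.
  + exact: nuYC.
- exact: ext_transport_map.
- by move=> x /XC Cx nZ; apply: ext_tight => //; have [] := hZ x Cx nZ.
Qed.

Section minimiser.
Variables (p : 'rV[R]_m -> R) (gamma : {measure set (E * E) -> \bar R}).
Hypothesis pmin : is_minimiser_F B Y c nu p.
Hypothesis gopt : is_optimal_plan cyl Y c (mu_of B p) nu gamma.
Local Notation D := (subgraph B p).

Let mp : measurable_fun B p. Proof. by case: pmin.1. Qed.

Let mB : measurable B. Proof. exact: base_measurable. Qed.

Let mD : measurable D. Proof. exact: measurable_subgraph. Qed.

Let DC : D `<=` cyl. Proof. by move=> x [Bx /andP[]]. Qed.

Let D1 : lambda D = 1%E.
Proof. by case: pmin.1 => *; rewrite lebesgue_subgraph. Qed.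

Let below := minimiser_sublevel Bc Bi Yc Y0 hc twist nuY nYyext psimax Yy0 pmin gopt.

Lemma minimiser_transport_map : is_transport_map D (mu_of B p) nu T.
Proof.
split; first exact: measurable_funTS mT.
move=> A mA; have mTA := mpreT mA; have [M [mM M0 hM]] := below.
rewrite /mu_of /lebesgue_on setIAC setIid.
rewrite (target_measure_transported Bc Bi Yc Y0 hc twist nuY nYyext psimax Yy0 mA).
apply: (measure_eq_off_null (N := M)) => //; [exact: measurableI|exact: measurableI|].
move=> x nM; split => -[Xx TA]; split => //.
  by have [_ _ /iffLR/(_ Xx)/ltW] := hM x (DC Xx) nM; split => //; exact: DC.
case: Xx => Cx /= fx; have [_ fn Df] := hM x Cx nM.
by apply/Df; rewrite lt_neqAle fn.
Qed.

(** The pair (F, psi) serves as potentials, rather than (f, psi): f coincides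
    with F almost everywhere on D but need not be bounded there. *)
Theorem restricted_map_optimal :
  is_unique_optimal_map D Y c (mu_of B p) nu T.
Proof.
have [M [mM M0 hM]] := below.
have [K [FK _ GK]] := ext_bounded.
have Fle x : cyl x -> F x <= f x.
  by move=> Cx; rewrite (ext_envelopeE Yc Y0 twist nYyext tau psic (XOm Cx)) ge_min lexx.
apply: (@unique_optimal_of_potentials _ _ D Y c F psi K _ _ _ _ _ _ _ _ _ _ _ _ T M) => //.
- by rewrite [X in (X < _)%E]D1 ltry.
- apply: (eq_measurable_fun (fun z : E * E => cE z.1 z.2)).
    by move=> z; rewrite inE => -[Dz Yz]; rewrite (twist_extends twist)//; exact: DC.
  apply: measurable_funS (measurable_cost Bc Yc twist) => //; first exact: measurableX.
  by move=> [x y] [/= Dx Yy]; split => //; exact: DC.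
- exact: measurable_funS measurable_ext_envelope.
- exact: within_continuous_measurable_rV.
- by move=> x /DC; exact: FK.
- by move=> x y /DC Cx Yy; exact: (cost_ge0 hc).
- move=> x y /DC Cx Yy; have := Fle x Cx.
  have := potential_le Yc Y0 twist psic (XOm Cx) Yy.
  by rewrite (twist_extends twist)//; lra.
- exact: minimiser_transport_map.
- move=> x Dx nM; have Cx := DC Dx; have [ux _ /iffLR/(_ Dx) fx] := hM x Cx nM.
  have [YT fE] := ext_map_below Yc Y0 twist nYyext psimax Yy0 (XOm Cx) ux fx.
  have [_ cT unique] := ext_tight Cx ux.
  have inY y : Y y -> ce x y = c x y /\ psi_e y = psi y.
    by move=> Yy; rewrite /ext_c /ext_psi; case: eqP => // yy; rewrite yy in Yy.
  split => // [|y Yy cy].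
    by have [<- <-] := inY _ YT.
  by apply: unique; [left|have [-> ->] := inY y Yy].
Qed.

(** The subgraph D and the region U above the graph of p overlap in the graph,
    a null set, and cover the slab.  Almost all of D lies in the slab because it
    lies in S. *)
Lemma ext_plan_graph A : measurable A ->
  ext_gamma B p P yext gamma A = ext_mu B P (X_P `&` [set x | A (x, T x)]).
Proof.
move=> mA; have [M [mM M0 hM]] := below.
have mgr (h : E -> E) : measurable_fun setT h -> measurable [set x | A (x, h x)].
  move=> mh; have mg : measurable_fun setT (fun x : E => (x, h x)).
    by apply: measurable_fun_pair => //; exact: measurable_id.
  by rewrite -[X in measurable X]setTI; exact: mg.
have mAT := mgr T mT; have mAy := mgr (cst yext) (measurable_cst _).
rewrite /ext_gamma (optimal_plan_graph Bc Bi Yc Y0 hc twist nuY nYyext psimax Yy0 pmin gopt mA).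
set U := [set x : E | B (base x) /\ (p (base x) <= height x <= P)%R].
have mU : measurable U.
  rewrite (_ : U = (@base R m @^-1` B `&` [set x | p (base x) <= height x]) `&`
     (@height R m @^-1` `]-oo, P])).
    apply: measurableI; first exact: measurable_above_graph.
    rewrite -[X in measurable X]setTI; exact: measurable_height.
  apply/seteqP; split => x /=; rewrite in_itv/=.
    by move=> [Bx /andP[]].
  by move=> [[Bx h1] h2]; split => //; apply/andP.
have -> : (lebesgue_on U \x dirac yext)%E A = lambda (U `&` [set x | A (x, yext)]).
  rewrite /product_measure1.
  transitivity (\int[mrestr lambda mU]_x (\1_[set x | A (x, yext)] x)%:E)%E.
    apply: (@eq_integral _ _ _ (mrestr lambda mU)) => x _ /=.
    rewrite diracE indicE mem_xsection.
    by rewrite (_ : (_ \in A) = (x \in [set x | A (x, yext)]))//; apply/idP/idP; rewrite !inE.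
  by rewrite integral_indic// setIT /= /mrestr setIC.
have p0 s : B s -> 0 <= p s by case: pmin.1 => _ + _; exact.
have UX : U `<=` X_P.
  by move=> x [Bx /andP[h1 h2]]; split => //; rewrite h2 (le_trans (p0 _ Bx)).
have DU0 : lambda (D `&` U) = 0%E.
  apply: lebesgue_graph_null; first exact: measurableI.
  have DUE s q : (D `&` U) (cyl_point s q) -> q = p s.
    move=> [[_ /andP[_ +]] [_ /andP[+ _]]]; rewrite base_cyl height_cyl => h1 h2.
    by apply/eqP; rewrite eq_le h1.
  by move=> s q q' /DUE -> /DUE ->.
have mDU : measurable (D `&` U) by exact: measurableI.
have mW : measurable (X_P `&` [set x | A (x, T x)]) by exact: measurableI.
rewrite /ext_mu /lebesgue_on setIAC setIid (measureDI lambda mW mD) addeC.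
congr (_ + _)%E.
  apply: (measure_eq_off_null (N := M `|` (D `&` U))).
  - exact: measurableI.
  - exact: measurableD.
  - exact: measurableU.
  - exact: measureU_null.
  move=> x nN; have nM : ~ M x by move=> Mx; apply: nN; left.
  have out : cyl x -> ~ D x -> T x = yext.
    move=> Cx nD; have [ux fx Df] := hM x Cx nM.
    apply: (ext_map_above Yc Y0 twist nYyext psimax Yy0 (XOm Cx) ux).
    by rewrite ltNge le_eqVlt (negbTE fx) /=; apply/negP => /Df.
  split => [[Ux Ay]|[[Xx AT] nD]].
    have nD : ~ D x by move=> Dx; apply: nN; right.
    by split => //; split; [exact: UX|rewrite /= out//; exact: XC (UX _ Ux)].
  split; last by rewrite /= -out//; exact: XC.
  case: Xx => Bx /andP[h0 hP]; split => //; rewrite hP andbT leNgt.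
  by apply/negP => /ltW hp; apply: nD; split => //; rewrite h0.
apply: (measure_eq_off_null (N := M)) => //; [exact: measurableI|exact: measurableI|].
move=> x nM; split => [[Dx AT]|[[_ AT] Dx]]; split => //; split => //.
have [_ _ /iffLR/(_ Dx)/ltW fx] := hM x (DC Dx) nM.
by apply: sublevel_sub_slab; split => //; exact: DC.
Qed.

End minimiser.

Lemma ae_differentiable_ext_envelope :
  {ae ext_mu B P, forall x, X_P x -> differentiable F x}.
Proof.
have [Z [mZ Z0 hZ]] := generic_points Bc Yc Y0 hc twist nYyext psimax.
apply: (ae_lebesgue_on mX mZ Z0) => x /XC Cx nZ.
by apply: (differentiable_envelope tw (XOm Cx)); have [] := hZ x Cx nZ.
Qed.

Lemma grad_ext_envelope x : cyl x -> differentiable F x ->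
  grad (ext_c cE yext ^~ (T x)) x = grad F x.
Proof.
move=> /XOm Omx dF; have ux := differentiable_unique_argmin tw Omx dF.
have argT := ext_map_argmin y0 Omx ux.
rewrite -(grad_envelope tw Omx (y := T x) _ dF) ?argT//.
by apply: (ext_c_grad psi tau nYyext twist Omx); exact: ext_map_in.
Qed.

End extended_problem.

Theorem corollary5p2 (R : realType) (m : nat) (hm : (1 <= m)%N)
  (B : set 'rV[R]_m) (hBcompact : compact B) (hBint : interior B !=set0)
  (Y : set 'rV[R]_(m + 1)) (hYcompact : compact Y) (hY0 : Y !=set0)
  (c : 'rV[R]_(m + 1) -> 'rV[R]_(m + 1) -> R)
  (hc : cost_assumptions B Y c)
  (OmX OmY : set 'rV[R]_(m + 1))
  (cE : 'rV[R]_(m + 1) -> 'rV[R]_(m + 1) -> R)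
  (htwist : extended_twist B Y c OmX OmY cE)
  (nu : probability 'rV[R]_(m + 1) R) (hnu : nu Y = 1%E)
  (P : R) (hP0 : 0 < P) (hP : is_uniform_bound B Y c P)
  (yext : 'rV[R]_(m + 1)) (hyext : ~ Y yext)
  (pbar : 'rV[R]_m -> R) (hpbar : is_minimiser_F B Y c nu pbar)
  (psi : 'rV[R]_(m + 1) -> R) (hpsi : is_maximiser_G B Y c nu psi)
  (gamma : {measure set ('rV[R]_(m + 1) * 'rV[R]_(m + 1)) -> \bar R})
  (hgamma : is_optimal_plan (cylinder B) Y c (mu_of B pbar) nu gamma) :
  let X_P := slab B P in
  let mu_e := ext_mu B P in
  let psi_e := ext_psi psi (tau_of B Y c psi) yext in
  (* potential of the extended problem, defined on the open set OmX *)
  let Psi := ctransform (ext_Y Y yext) (ext_c cE yext) psi_e in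
  exists T : 'rV[R]_(m + 1) -> 'rV[R]_(m + 1),
    [/\ is_unique_optimal_map X_P (ext_Y Y yext) (ext_c c yext) mu_e
          (ext_nu B nu P yext) T,
        forall x, X_P x -> ext_Y Y yext (T x),
        forall A, measurable A ->
          ext_gamma B pbar P yext gamma A = mu_e (X_P `&` [set x | A (x, T x)]),
        {ae mu_e, forall x, X_P x -> differentiable Psi x} /\
        (forall x, X_P x -> differentiable Psi x ->
           grad (ext_c cE yext ^~ (T x)) x = grad Psi x)
      & is_unique_optimal_map (subgraph B pbar) Y c (mu_of B pbar) nu T].
Proof.
have [y0 Yy0] := hY0; move=> X_P mu_e psi_e Psi.
exists (ext_map B Y c cE OmX yext psi y0); split.
- exact: (ext_map_optimal hBcompact hBint hYcompact hY0 hc htwist hnu hyext hP0 hP hpsi Yy0).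
- by move=> x _; exact: ext_map_in.
- exact: (ext_plan_graph hBcompact hBint hYcompact hY0 hc htwist hnu hyext hP0 hP hpsi Yy0
    hpbar hgamma).
- split.
    exact: (ae_differentiable_ext_envelope hBcompact hYcompact hY0 hc htwist P hyext hpsi).
  move=> x Xx.
  exact: (grad_ext_envelope hYcompact htwist hyext hpsi Yy0 (slab_le Xx)).
- exact: (restricted_map_optimal hBcompact hBint hYcompact hY0 hc htwist hnu hyext hpsi Yy0
    hpbar hgamma).
Qed.
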